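(* Let $u$ be a unit. As $Q\to\infty$ (through positive integers), the point-process probability measures $P(Q)$ on $\mathbb R_{>0}^2$ converge weakly${}^*$ to $P$; that is, $\lim_{Q\to\infty}\int f\,dP(Q)=\int f\,dP$ for every continuous compactly supported $f:\mathbb R_{>0}^2\to\mathbb R$. (The measures $P(Q)$ and $P$ are defined in the context.)
   Context: A unit is a function $u:[0,1]\to\mathbb R_{>0}$ such that (i) $u$ is continuous; (ii) $[0,1]$ can be partitioned into finitely many subintervals $[s,s']$ (endpoints not necessarily rational), overlapping only at endpoints, such that $u$ is $C^1$ with bounded first derivative on each $(s,s')$. Set $v=1/u$, $C=\int_0^1 v(s)^2\,ds$, $m(s)=C^{-1}v(s)^2$; let $l,L$ be the minimum and maximum of $v$ on $[0,1]$. Rational numbers $p/q$ are in reduced form with $q>0$. $\mathcal F_u(Q)$ is the finite set of rationals $p/q\in[0,1)$ with $u(p/q)\,q\le Q$, and $n(Q)=\sharp\mathcal F_u(Q)$. $Q$ is assumed throughout to be sufficiently large (so that $u(0),u(1)\le Q$ and so that any two successive elements $p/q<p'/q'$ of $\mathcal F_u(Q)\cup\{1\}$ satisfy $p'q-pq'=1$). Limit measure: for $w\in[l,L]$ let $\Omega_w=\{(x,y)\in\mathbb R_{>0}^2: x,y\le w<x+y\}$ and let $P_w$ be Lebesgue measure on $\Omega_w$ normalized by $P_w(\Omega_w)=1$. Let $\Omega=\bigcup_{w\in[l,L]}\Omega_w=\{(x,y):0<x,y\le L,\ l<x+y\}$; $P$ is the probability measure on $\Omega$ (viewed as a measure on $\mathbb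 R_{>0}^2$) defined by $P=\int_0^1P_{v(s)}\,m(s)\,ds$. The measures $P(Q)$: a unimodular lattice $\Lambda\subset\mathbb R^2$ (column vectors) contains a vertical vector if it contains $\binom{0}{d}$ for some $d>0$. Such a lattice has the form $\Lambda=\begin{pmatrix}d^{-1}&0\\ c&d\end{pmatrix}\mathbb Z^2$ with $d>0$ uniquely determined and $c$ determined up to adding integer multiples of $d$; let $\mathcal S$ be the set of such lattices and, for $D>0$, let $\mathcal S\restriction D$ be the set of those containing a vertical vector of length $\le D$. The horocycle flow is $h_t(\Lambda)=\begin{pmatrix}1&-t\\0&1\end{pmatrix}\Lambda$. Put $\Lambda_0=\Lambda_0(Q)=\begin{pmatrix}Q&0\\0&Q^{-1}\end{pmatrix}\mathbb Z^2$, $\Lambda_t=\Lambda_t(Q)=h_t(\Lambda_0)$, and $\mathcal S_t=\mathcal S\restriction v(Q^{-2}t)$ for $t\in[0,Q^2)$. A hitting time (to the sliding section $\mathcal S_t$) is a $t\in[0,Q^2)$ with $\Lambda_t\in\mathcal S_t$; list the hitting times as $0=t_0<t_1<t_2<\cdots$ (they are $n(Q)$ in number). For a hitting time $t_i$ write $\Lambda_{t_i}=\begin{pmatrix}d_i^{-1}&0\\ c&d_i\end{pmatrix}\mathbb Z^2$ with $d_i>0$; among all admissible choices of $c$ (a coset of $d_i\mathbb Z$), let $c_i$ be the largest one such that $0<c\le v\bigl(Q^{-2}(t_i+(cd_i)^{-1})\bigr)$ (where the argument of $v$ is required to lie in $[0,1]$). Then \[ P(Q)=\frac1{n(Q)}\sum_i\delta_{(c_i,d_i)},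 \] the sum being over all hitting times $t_i$, where $\delta$ denotes Dirac mass. *)

(* Defs.v *)
From HB Require Import structures.
From mathcomp Require Import all_boot all_order all_algebra.
From mathcomp Require Import finmap.
From mathcomp Require Import all_classical all_reals all_analysis.
From mathcomp Require Import measurable_realfun.
Set Implicit Arguments.
Unset Strict Implicit.
Unset Printing Implicit Defensive.
Import Order.TTheory GRing.Theory Num.Theory.
Import numFieldNormedType.Exports.
Local Open Scope classical_set_scope.
Local Open Scope ring_scope.

Definition C1_bounded (R : realType) (u : R -> R) (a b : R) : Prop :=
  [/\ {in `]a, b[, forall x, derivable u x 1},
      {in `]a, b[, continuous (derive1 u)} &
      exists M, {in `]a, b[, forall x, `|derive1 u x| <= M}].

(* A unit is a function on [0, 1]; it is represented by a function on R whose
   values outside [0, 1] are irrelevant to everything below. *)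
Record unit_function (R : realType) := UnitFunction {
  unit_fun :> R -> R ;
  unit_gt0 : {in `[0, 1], forall x, 0 < unit_fun x} ;
  unit_cont : {within `[0 : R, 1], continuous unit_fun} ;
  unit_C1 : exists2 s : seq R, itv_partition 0 1 s &
    forall i, (i < size s)%N ->
      C1_bounded unit_fun (nth 0 (0 :: s) i) (nth 0 s i) }.

Section density.
Context {R : realType}.
Implicit Type u : R -> R.

Definition vfun u (s : R) : R := (u s)^-1.

Definition Cconst u : R :=
  \int[@lebesgue_measure R]_(s in `[0, 1]) (vfun u s ^+ 2).

Definition mdens u (s : R) : R := (Cconst u)^-1 * vfun u s ^+ 2.

End density.

(* The plane with its Borel sigma-algebra. Lebesgue measure lives on the copy
   measurableTypeR R of R, hence the product type below; as a set it is R * R. *)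
Notation plane R := (measurableTypeR R * measurableTypeR R)%type.

Section limit_measure.
Context {R : realType}.
Implicit Types (A : set (plane R)) (w : R).

Definition pquadrant : set (R * R) := [set z | 0 < z.1 /\ 0 < z.2].

Definition leb2 : set (plane R) -> \bar R :=
  (@lebesgue_measure R \x @lebesgue_measure R)%E.
HB.instance Definition _ := Measure.on leb2.

Let sigma_finite_leb2 : sigma_finite setT leb2.
Proof.
have /sigma_finiteP[F [TF ndF Foo]] := sigma_finiteT (@lebesgue_measure R).
exists (fun n => F n `*` F n).
  rewrite -setXTT TF predeqE => -[x y]; split; last by move=> [n _ []]; split; exists n.
  move=> [/= [n _ Fnx] [k _ Fky]]; exists (maxn n k) => //; split.
  - by move: x Fnx; exact/subsetPset/ndF/leq_maxl.
  - by move: y Fky; exact/subsetPset/ndF/leq_maxr.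
move=> k; have [mF Fk] := Foo k; split; first exact: measurableX.
by rewrite /leb2 product_measure1E// lte_mul_pinfty// ge0_fin_numE.
Qed.

HB.instance Definition _ :=
  Measure_isSigmaFinite.Build _ _ _ leb2 sigma_finite_leb2.

Definition Omega w : set (plane R) :=
  [set z : R * R | [/\ 0 < z.1, 0 < z.2, z.1 <= w, z.2 <= w & w < z.1 + z.2]].

(* P_w, Lebesgue measure on Omega w normalized by its area w^2 / 2 *)
Definition Pslice w A : \bar R :=
  ((fine (leb2 (Omega w)))^-1%:E * leb2 (A `&` Omega w))%E.

(* P = \int_0^1 P_{v(s)} m(s) ds, evaluated on measurable sets *)
Definition Plim (u : unit_function R) A : \bar R :=
  (\int[@lebesgue_measure R]_(s in `[0%R, 1%R])
     (Pslice (vfun u s) A * (mdens u s)%:E))%E.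

Let measurable_invr : measurable_fun [set: R] (@GRing.inv R).
Proof.
have -> : [set: R] = [set x | x != 0] `|` [set 0].
  by apply/seteqP; split => // x _; case: (eqVneq x 0) => [->|]; [right|left].
apply/measurable_funU; [by apply: open_measurable; exact: open_neq|exact: measurable_set1|].
split; last exact: measurable_fun_set1.
apply: open_continuous_measurable_fun; first exact: open_neq.
by apply/in_setP => x /= x0; exact: inv_continuous.
Qed.

Let measurable_graph :
  measurable [set p : measurableTypeR R * plane R | Omega p.1 p.2].
Proof.
pose T := (measurableTypeR R * plane R)%type.
have m1 : measurable_fun [set: T] (fun p : T => p.1 : R) by exact: measurable_fst.
have m2 : measurable_fun [set: T] (fun p : T => p.2.1 : R).
  exact: (measurableT_comp (@measurable_fst _ _ _ _) (@measurable_snd _ _ _ _)).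
have m3 : measurable_fun [set: T] (fun p : T => p.2.2 : R).
  exact: (measurableT_comp (@measurable_snd _ _ _ _) (@measurable_snd _ _ _ _)).
have mb (b : T -> bool) : measurable_fun [set: T] b -> measurable [set p | b p].
  move=> mb; rewrite (_ : [set p | b p] = setT `&` b @^-1` [set true]).
    exact: mb.
  by apply/seteqP; split => [p /= ->|p [_ /= ->]].
rewrite (_ : [set p | _] =
  [set p : T | [&& 0 < p.2.1, 0 < p.2.2, p.2.1 <= p.1, p.2.2 <= p.1
     & p.1 < p.2.1 + p.2.2]]); last first.
  by apply/seteqP; split => p /=; [case=> -> -> -> -> -> | case/and5P].
apply: mb; do 4 (apply: measurable_and; first by
  [apply: measurable_fun_ltr => //; exact: measurable_cst |
   apply: measurable_fun_ler]).
by apply: measurable_fun_ltr => //; exact: measurable_funD.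
Qed.

Lemma measurable_Omega w : measurable (Omega w).
Proof.
have := measurable_xsection w measurable_graph.
by congr measurable; apply/seteqP; split => z; rewrite /xsection/= ?inE.
Qed.

Let measurable_leb2_Omega A : measurable A ->
  measurable_fun setT (fun w : measurableTypeR R => leb2 (A `&` Omega w)).
Proof.
move=> mA.
pose G := (setT `*` A) `&` [set p : measurableTypeR R * plane R | Omega p.1 p.2].
have mG : measurable G.
  by apply: measurableI; [exact: measurableX|exact: measurable_graph].
have := @measurable_fun_xsection _ _ _ _ _ leb2 _ mG.
congr measurable_fun; apply/funext => w /=; congr leb2.
by apply/seteqP; split => z; rewrite /xsection/= ?inE /G/= => -[]// [].
Qed.

Let Pslice_factor_ge0 w : 0 <= (fine (leb2 (Omega w)))^-1.
Proof. by rewrite invr_ge0 fine_ge0. Qed.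

HB.instance Definition _ w := Measure.copy (Pslice w)
  (mscale (NngNum (Pslice_factor_ge0 w)) (mrestr leb2 (measurable_Omega w))).

Variable u : unit_function R.

Let unit_interval : set (measurableTypeR R) := `[0 : R, 1]%classic.

Let measurable_vfun : measurable_fun unit_interval (vfun u).
Proof.
apply: (measurableT_comp measurable_invr).
apply: (@subspace_continuous_measurable_fun R `[0 : R, 1]%classic u) => //.
exact: unit_cont.
Qed.

Let measurable_Plim_integrand A : measurable A ->
  measurable_fun unit_interval (fun s => Pslice (vfun u s) A * (mdens u s)%:E)%E.
Proof.
move=> mA; apply: emeasurable_funM; last first.
  apply/measurable_EFinP; apply: measurable_funM => //.
  exact: measurable_funX.
apply: (@measurableT_comp _ _ _ _ _ _ (fun w => Pslice w A)) => //.
apply: emeasurable_funM; last exact: measurable_leb2_Omega.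
apply/measurable_EFinP; apply: (measurableT_comp measurable_invr).
apply: (measurableT_comp (@fine_measurable _ _ _)) => //.
under eq_fun do rewrite -(setTI (Omega _)).
exact: measurable_leb2_Omega.
Qed.

Let Cconst_ge0 : 0 <= Cconst u.
Proof. by apply: Rintegral_ge0 => s _; exact: sqr_ge0. Qed.

Let mdens_ge0 s : (0 <= (mdens u s)%:E)%E.
Proof. by rewrite lee_fin mulr_ge0 ?invr_ge0 ?sqr_ge0. Qed.

Let Plim0 : Plim u set0 = 0%E.
Proof. by apply: integral0_eq => s _; rewrite measure0 mul0e. Qed.

Let Plim_ge0 A : (0 <= Plim u A)%E.
Proof. by apply: integral_ge0 => s _; rewrite mule_ge0. Qed.

Let Plim_sigma_additive : semi_sigma_additive (Plim u).
Proof.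
move=> F mF tF mUF; rewrite [X in _ --> X](_ : _ =
    (\sum_(n <oo) Plim u (F n))%E).
  by apply/cvg_closeP; split; [exact: is_cvg_nneseries|rewrite closeE].
rewrite -integral_nneseries//; last 2 first.
- by move=> n; exact: measurable_Plim_integrand.
- by move=> n s _; rewrite mule_ge0.
apply: eq_integral => s _.
rewrite measure_semi_bigcup// muleC -nneseriesZl//; last first.
by apply: eq_eseriesr => n _; rewrite muleC.
Qed.

HB.instance Definition _ := isMeasure.Build _ _ _ (Plim u)
  Plim0 Plim_ge0 Plim_sigma_additive.

End limit_measure.

Section point_process.
Context {R : realType}.
Implicit Types (u : R -> R) (Q : nat) (t c d D : R) (L : set 'cV[R]_2).

(* numq and denq give the reduced form of a rational, with denq r > 0 *)
Definition Farey u Q : set rat :=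
  [set r | 0 <= r < 1 /\ u (ratr r) * (denq r)%:~R <= Q%:R].

Definition Farey_card u Q : nat := #|` fset_set (Farey u Q)|.

Definition mx2 (a11 a12 a21 a22 : R) : 'M[R]_2 :=
  \matrix_(i < 2, j < 2) nth 0 (nth [::] [:: [:: a11; a12]; [:: a21; a22]] i) j.

Definition cvec2 (x y : R) : 'cV[R]_2 := \col_(i < 2) nth 0 [:: x; y] i.

Definition lattice (M : 'M[R]_2) : set 'cV[R]_2 :=
  range (fun z : 'cV[int]_2 => M *m map_mx intr z).

Definition unimodular L := exists2 M, `|\det M| = 1 & L = lattice M.

Definition vertical_lattices D : set (set 'cV[R]_2) :=
  [set L | unimodular L /\ exists2 d, 0 < d <= D & L (cvec2 0 d)].

Definition horocycle t L : set 'cV[R]_2 := [set mx2 1 (- t) 0 1 *m x | x in L].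

Definition Lambda Q t : set 'cV[R]_2 :=
  horocycle t (lattice (mx2 Q%:R 0 0 Q%:R^-1)).

Definition hitting_times u Q : set R :=
  [set t | 0 <= t < Q%:R ^+ 2 /\
           vertical_lattices (vfun u (t / Q%:R ^+ 2)) (Lambda Q t)].

Definition admissible u Q t d : set R :=
  [set c | [/\ Lambda Q t = lattice (mx2 d^-1 0 c d), 0 < c &
     let s := (t + (c * d)^-1) / Q%:R ^+ 2 in 0 <= s <= 1 /\ c <= vfun u s]].

Definition is_mark u Q t : set (R * R) :=
  [set cd | [/\ 0 < cd.2, admissible u Q t cd.2 cd.1 &
     forall c, admissible u Q t cd.2 c -> c <= cd.1]].

(* At a hitting time there is at most one (c_i, d_i) satisfying is_mark, and
   for Q large there is one, so that the default value (0, 0) is not used. *)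
Definition mark u Q t : plane R := xget (0, 0) (is_mark u Q t).

(* fset_set is the finite set of elements of a finite set; all the hitting
   times have the form Q^2 p/q with q <= Q * max v, so they are finitely many. *)
Definition PQ u Q (A : set (plane R)) : \bar R :=
  (((Farey_card u Q)%:R^-1)%:E *
   \sum_(t <- fset_set (hitting_times u Q)) \d_(mark u Q t) A)%E.

Let PQE u Q :
  PQ u Q = mscale ((Farey_card u Q)%:R^-1)%:nng
    (msum (fun i => \d_(mark u Q (nth 0 (fset_set (hitting_times u Q)) i)))
       (size (fset_set (hitting_times u Q)))).
Proof.
apply/funext => A; rewrite /PQ /mscale/= /msum; congr (_ * _)%E.
by rewrite (big_nth 0) big_mkord.
Qed.

Let PQ0 u Q : PQ u Q set0 = 0%E.
Proof. by rewrite PQE measure0. Qed.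

Let PQ_ge0 u Q A : (0 <= PQ u Q A)%E.
Proof. by rewrite PQE measure_ge0. Qed.

Let PQ_sigma_additive u Q : semi_sigma_additive (PQ u Q).
Proof. by rewrite PQE; exact: measure_semi_sigma_additive. Qed.

HB.instance Definition _ u Q := isMeasure.Build _ _ _ (PQ u Q)
  (PQ0 u Q) (PQ_ge0 u Q) (@PQ_sigma_additive u Q).

End point_process.

(* Main.v *)
Require Import Defs.
From mathcomp Require Import all_boot all_order all_algebra.
From mathcomp Require Import finmap.
From mathcomp Require Import all_classical all_reals all_analysis.
From mathcomp Require Import measurable_realfun.
From mathcomp Require Import zify ring lra.

(** Why the theorem holds.

    Hitting times correspond to the reduced fractions p/q of the Farey set, and
    the mark at p/q is (x/Q, q/Q), where x is the denominator of a right neighbour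
    p'/x of p/q, so that p' q - p x = 1. Thus a mark is a coprime pair (x, y)
    divided by Q, and the pair determines the fraction: its numerator [snum x y]
    is minus the inverse of x modulo y ([mark_intro], [mark_elim]). The
    maximality in the choice of c says that x/Q <= v < (x + y)/Q, where v is
    evaluated at neighbouring fractions, which are O(1/Q^2) apart if x and y are
    of order Q. Up to a small margin the marks in a box are therefore the coprime
    pairs whose point (x/Q, y/Q) lies in the box and in Omega w for
    w = v([slope x y]) ([mark_count_upper], [mark_count_lower]). Without the box
    the same pairs count the Farey set ([Farey_card_upper], [Farey_card_lower]).

    To count them, cut [0, 1] into pieces on which v is nearly constant. On one
    piece the coprime pairs must lie in a fixed convex region scaled by Q and
    their slopes in a fixed interval. Two facts are used.

    - The coprime pairs of the region number kappa * area * Q^2 + o(Q^2) for a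
      constant kappa > 0 ([coprime_density]), by a sieve over the lattice points
      of the region.

    - Their slopes are equidistributed in [0, 1) ([equidistribution]). This is
      obtained from the Euclidean algorithm, without exponential sums. A
      cone spanned by a unimodular basis V, V' has mass 1/(|V| |V'|), where | |
      is the sum of the coordinates; the mass is additive when the cone is split
      along V + V'. Writing a pair as j V + k V', for fixed k the slope is
      -1/j modulo k, divided by k and up to 1/k, and j runs over an interval. If
      V' is N times longer than V, these intervals are long compared to k, and
      the distribution of reduced residues in intervals bounds the excess over
      the expected number of slopes in an interval by (C/N) mass Q^2 + o(Q^2).
      Every cone contains such a thin cone carrying at least 1/(N + 1) of its
      mass. A bound rho mass Q^2 valid for all cones (one holds trivially) then
      improves to a mean of rho and C/N with weights N/(N + 1) and 1/(N + 1)
      (this is [contract]), and by iteration rho becomes as small as desired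
      ([excess_small]).

    Summing over the pieces produces a Riemann sum of the area of the slices of
    the box by Omega (v s). Hence P(Q) of a box is asymptotically the quotient of
    kappa times the integral of these areas by kappa times the integral of
    v^2/2, which is P of the box ([box_limit]). Finally, a continuous
    function with compact support in the quadrant is uniformly approximated by
    step functions on a grid of boxes, and the total masses stay bounded. *)

Set Implicit Arguments.
Unset Strict Implicit.
Unset Printing Implicit Defensive.
Import Order.TTheory GRing.Theory Num.Theory.
Import numFieldNormedType.Exports.
Local Open Scope classical_set_scope.
Local Open Scope ring_scope.

(** * Integers coprime to a modulus in an interval *)

Definition sieved (ps : seq nat) (r : nat) : bool := all (fun p => ~~ (p %| r)%N) ps.

Lemma sum_multiples (V : nmodType) (F : nat -> V) (p n : nat) : (0 < p)%N ->
  \sum_(1 <= r < n.+1 | (p %| r)%N) F r = \sum_(1 <= r < (n %/ p).+1) F (p * r)%N.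
Proof.
move=> p0; elim: n => [|n IHn]; first by rewrite div0n !big_geq.
rewrite big_mkcond big_nat_recr //= -big_mkcond IHn divnS//.
have [pn|] := boolP (p %| n.+1)%N; last by rewrite addr0.
rewrite add1n [RHS]big_nat_recr//=; congr (_ + F _).
by rewrite -[LHS](divnK pn) divnS// pn add1n mulnC.
Qed.

Lemma count_multiples (P : pred nat) (p n : nat) : (0 < p)%N ->
  count (fun r => (p %| r)%N && P r) (iota 1 n) =
  count (fun r => P (p * r)%N) (iota 1 (n %/ p)).
Proof.
move=> p0; rewrite -!sum1_count big_mkcondr [RHS]big_mkcond.
have := sum_multiples (fun r => if P r then 1%N else 0%N) n p0.
by rewrite /index_iota !subn1.
Qed.

Lemma sieved_mul (ps : seq nat) (p r : nat) : prime p -> all prime ps ->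
  p \notin ps -> sieved ps (p * r) = sieved ps r.
Proof.
move=> pp pps pnps; apply: eq_in_all => q qps; congr negb.
have pq : prime q by exact: (allP pps).
rewrite Euclid_dvdM// dvdn_prime2//.
by case: eqP => //= qp; move: pnps; rewrite -qp qps.
Qed.

Section sieve.
Context {R : realType}.
Implicit Types ps : seq nat.

(** The proportion of the integers that no prime of [ps] divides. *)
Definition sieve_density (ps : seq nat) : R := \prod_(p <- ps) (1 - p%:R^-1).

Lemma sieve_density_itv ps : all prime ps -> 0 <= sieve_density ps <= 1.
Proof.
elim: ps => [_|p ps IH /= /andP[pp /IH /andP[h0 h1]]].
  by rewrite /sieve_density big_nil ler01 lexx.
have p1 : 1 <= p%:R :> R by rewrite ler1n prime_gt0.
have pi : 0 <= 1 - p%:R^-1 :> R by rewrite subr_ge0 invf_le1// (lt_le_trans ltr01).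
have p2 : 1 - p%:R^-1 <= 1 :> R by rewrite gerBl invr_ge0.
rewrite /sieve_density big_cons -/(sieve_density ps); apply/andP; split; first exact: mulr_ge0.
by rewrite -[leRHS]mulr1; apply: ler_pM.
Qed.

Lemma divn_approx (n p : nat) : (0 < p)%N ->
  `|(n %/ p)%:R - n%:R / p%:R| <= 1 :> R.
Proof.
move=> p0; have pR : 0 < p%:R :> R by rewrite ltr0n.
rewrite {2}(divn_eq n p) natrD natrM mulrDl mulfK ?gt_eqF//.
rewrite opprD addrA subrr add0r normrN ger0_norm ?divr_ge0//.
by rewrite ler_pdivrMr// mul1r ler_nat ltnW// ltn_pmod.
Qed.

(** Legendre's sieve, one prime at a time: the integers up to [n] that [p]
    divides correspond to all integers up to [n %/ p], so a new prime takes the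
    proportion [1 / p] away and at most doubles the error. *)
Lemma sieve_count ps n : all prime ps -> uniq ps ->
  `|(count (sieved ps) (iota 1 n))%:R - n%:R * sieve_density ps| <= 2 ^+ size ps - 1 :> R.
Proof.
elim: ps n => [n _ _|p ps IH n /= /andP[pp pps] /andP[pnps ups]].
  rewrite /sieve_density big_nil mulr1 expr0 subrr.
  rewrite (eq_count (a2 := predT)) ?count_predT ?size_iota ?subrr ?normr0//.
have pgt := prime_gt0 pp.
have E : (count (sieved ps) (iota 1 n) =
    count (sieved (p :: ps)) (iota 1 n) + count (sieved ps) (iota 1 (n %/ p)))%N.
  rewrite -[X in (_ + X)%N](eq_count (a1 := fun r => sieved ps (p * r))); last first.
    by move=> r; exact: sieved_mul.
  rewrite -count_multiples// -!size_filter.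
  rewrite -(count_predC (fun r => p %| r)%N [seq x <- iota 1 n | sieved ps x]).
  by rewrite addnC -!size_filter -!filter_predI.
have /(_ n pps ups) h1 := IH; have /(_ (n %/ p)%N pps ups) h2 := IH.
have h3 := divn_approx n pgt; have /andP[m0 m1] := sieve_density_itv pps.
move/(congr1 (fun k => k%:R : R)): E; rewrite natrD => E.
rewrite {1}/sieve_density big_cons -/(sieve_density ps) exprS.
set A := _%:R in E h1; set B := _%:R in E *; set C := _%:R in E h2.
set x := (n %/ p)%:R in h2 h3; set m := sieve_density ps in h1 h2 m0 m1 *.
have {}E : B = A - C by rewrite E addrK.
have -> : B - n%:R * ((1 - p%:R^-1) * m) =
   (A - n%:R * m) - (C - x * m) - (x - n%:R / p%:R) * m by rewrite E; ring.
have h4 : `|(x - n%:R / p%:R) * m| <= 1.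
  by rewrite normrM (ger0_norm m0) -[leRHS]mulr1 ler_pM.
apply: (le_trans (ler_normB _ _)); apply: (le_trans (lerD (ler_normB _ _) (lexx _))).
set e : R := 2 ^+ _ in h1 h2 *; lra.
Qed.

Lemma sieve_count_itv ps m n : all prime ps -> uniq ps -> (m <= n)%N ->
  `|(count (sieved ps) (iota m.+1 (n - m)))%:R - (n - m)%:R * sieve_density ps|
     <= 2 ^+ (size ps).+1 :> R.
Proof.
move=> pps ups mn; have h1 := sieve_count n pps ups; have h2 := sieve_count m pps ups.
move: h1; rewrite -{1 2}(subnKC mn) iotaD count_cat add1n !natrD mulrDl.
move: h2; set a := (count _ (iota 1 m))%:R.
set b := (count _ (iota m.+1 _))%:R; set c := _ * _; set d := _ * _ => h2 h1.
rewrite exprS; set e : R := 2 ^+ _ in h1 h2 *.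
have -> : b - d = (a + b - (c + d)) - (a - c) by ring.
apply: (le_trans (ler_normB _ _)); lra.
Qed.

(** [k] is at least the product of its primes, all of which exceed 4 except
    possibly 2 and 3; this makes the sieve error [2 ^ omega(k)] of order at most
    [sqrt k], hence negligible against [k]. *)
Lemma omega_bound k : (0 < k)%N -> (4 ^ size (primes k) <= 16 * k)%N.
Proof.
move=> k0.
have H (ps : seq nat) : uniq ps -> all prime ps ->
   (4 ^ size ps <= 4 ^ count (fun p => p < 4) ps * \prod_(p <- ps) p)%N.
  move=> _; elim: ps => [|p ps IH /= /andP[pp /IH h]]; first by rewrite big_nil.
  rewrite big_cons; have := prime_gt1 pp.
  case: (leqP 4 p) => p4 p1.
    by rewrite expnS (leq_trans (leq_mul p4 h))// add0n mulnCA.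
  rewrite expnS /= add1n expnS -mulnA leq_mul2l /= (leq_trans h)//.
  by rewrite leq_mul2l leq_pmull ?orbT// ltnW.
have up := primes_uniq k; have app := all_prime_primes k.
apply: (leq_trans (H _ up app)); apply: leq_mul.
  rewrite -[16%N]/(4 ^ 2)%N leq_exp2l// -size_filter.
  apply: (@uniq_leq_size _ _ [:: 2; 3]%N); first exact: filter_uniq.
  move=> p; rewrite mem_filter => /andP[p4 /(allP app) pp].
  by case: p p4 pp => [|[|[|[|]]]].
have D (ps : seq nat) : uniq ps -> all prime ps -> all (fun p => p %| k)%N ps ->
    (\prod_(p <- ps) p %| k)%N.
  elim: ps => [|p ps IH /= /andP[pn /IH h] /andP[pp aps] /andP[pk ak]].
    by rewrite big_nil dvd1n.
  rewrite big_cons Gauss_dvd ?pk ?h//.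
  rewrite coprime_sym; elim: ps aps pn {IH ak h} => [|q ps IH /= /andP[pq aps]].
    by rewrite big_nil coprime1n.
  rewrite inE negb_or => /andP[pq' /IH h].
  rewrite big_cons coprimeMl h// andbT prime_coprime// dvdn_prime2//.
  by rewrite eq_sym.
apply: dvdn_leq => //; apply: D => //.
by apply/allP => p; rewrite mem_primes => /and3P[].
Qed.

Lemma coprime_sieved k r : (0 < k)%N -> (0 < r)%N ->
  coprime r k = sieved (primes k) r.
Proof.
move=> k0 r0; rewrite coprime_has_primes// -all_predC /sieved.
apply: eq_in_all => p; rewrite mem_primes => /and3P[pp _ _] /=.
by rewrite mem_primes pp r0.
Qed.

Definition totient_err (k : nat) : R := 2 ^+ (size (primes k)).+1.

Lemma totient_err_ge0 k : 0 <= totient_err k. Proof. exact: exprn_ge0. Qed.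

Lemma totient_err_sqr k : (0 < k)%N -> totient_err k ^+ 2 <= 64 * k%:R.
Proof.
move=> k0; rewrite /totient_err -exprM mulnC exprM.
rewrite (_ : 2 ^+ 2 = 4%:R :> R); last by rewrite -natrX.
by rewrite -natrX -natrM ler_nat expnS -[64%N]/(4 * 16)%N -mulnA leq_mul2l /= omega_bound.
Qed.

Lemma totient_err_le k : (0 < k)%N -> totient_err k <= 64 * k%:R.
Proof.
move=> k0; have k1 : 1 <= k%:R :> R by rewrite ler1n.
have h : 64 * k%:R <= (64 * k%:R) ^+ 2 :> R.
  by rewrite expr2 ler_peMl// ?mulr_ge0// (le_trans k1)// ler_peMl// ler1n.
rewrite -ler_sqr ?nnegrE ?totient_err_ge0 ?mulr_ge0//.
exact: le_trans (totient_err_sqr k0) h.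
Qed.

(** [totient_err k ^+ 2] is at most linear in [k], so [totient_err k] is [o(k)]. *)
Lemma totient_err_small (e : R) : 0 < e ->
  exists k0 : nat, forall k, (k0 <= k)%N -> totient_err k <= e * k%:R.
Proof.
move=> e0; exists (Num.truncn (64 / e ^+ 2)).+1 => k hk.
have k0 : (0 < k)%N by exact: leq_trans hk.
have kR : 0 < k%:R :> R by rewrite ltr0n.
rewrite -ler_sqr ?nnegrE ?totient_err_ge0 ?mulr_ge0 ?(ltW e0)//.
apply: (le_trans (totient_err_sqr k0)); rewrite exprMn [k%:R ^+ 2]expr2 mulrA ler_pM2r//.
rewrite mulrC -ler_pdivrMr ?exprn_gt0//.
apply/ltW; apply: (lt_le_trans (truncnS_gt _)); by rewrite ler_nat.
Qed.

Lemma totient_density k (m n : nat) : (0 < k)%N -> (m <= n)%N ->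
  `|(count (fun r => coprime r k) (iota m.+1 (n - m)))%:R
     - (n - m)%:R * sieve_density (primes k)| <= totient_err k.
Proof.
move=> k0 mn.
have := sieve_count_itv (all_prime_primes k) (primes_uniq k) mn.
congr (`|_%:R - _| <= _); apply: eq_in_count => r.
by rewrite mem_iota => /andP[r0 _]; rewrite coprime_sieved// (leq_trans _ r0).
Qed.

End sieve.

(** * The fraction attached to a coprime pair *)

(** For [x] and [y] coprime, [snum x y / y] is the fraction in [0, 1) that has
    a right neighbour of denominator [x], namely [sden x y / x]: Bezout gives
    [sden x y * y - snum x y * x = 1]. *)
Definition snum (x y : nat) : nat := (egcdn y x).2.

Lemma snumP x y : (0 < y)%N -> coprime x y ->
  exists2 p', (p' * y = snum x y * x + 1)%N & (snum x y < y)%N.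
Proof.
move=> y0; rewrite coprime_sym /snum => /eqP cxy.
case: (egcdnP x y0) => p' p /=; rewrite cxy => E; rewrite muln1 => lt.
by exists p'.
Qed.

Lemma bezout_coprime p p' x y : (p' * y = p * x + 1)%N -> coprime x y /\ coprime p y.
Proof.
move=> E.
have H z : (z %| y)%N -> ((z %| x) || (z %| p))%N -> (z %| 1)%N.
  move=> zy zxp; have zpx : (z %| p * x)%N.
    by case/orP: zxp => h; [exact: dvdn_mull|exact: dvdn_mulr].
  by rewrite -(dvdn_addr _ zpx) -E dvdn_mull.
by split; rewrite /coprime -dvdn1; apply: H;
  rewrite ?dvdn_gcdr ?dvdn_gcdl ?orbT.
Qed.

Lemma snum_inj_mod x x' y : (0 < y)%N -> coprime x y -> coprime x' y ->
  snum x y = snum x' y -> x = x' %[mod y].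
Proof.
move=> y0 /(snumP y0)[a Ea _] /(snumP y0)[b Eb _] E.
have [_ cp] := bezout_coprime Ea.
move: cp Ea Eb; rewrite -{}E; move: (snum x y) => p cp Ea Eb.
have : (p * x + 1 = p * x' + 1 %[mod y])%N by rewrite -Ea -Eb !modnMl.
move/eqP; rewrite eqn_modDr => /eqP.
wlog le : x x' {Ea Eb} / (x' <= x)%N.
  by move=> W h; case: (leqP x' x) => [|/ltnW] l; [|symmetry]; apply: W.
move/eqP; rewrite eqn_mod_dvd ?leq_mul2l ?le ?orbT// -mulnBr Gauss_dvdr.
  by rewrite -eqn_mod_dvd// => /eqP.
by rewrite coprime_sym.
Qed.

(** The relation [p' * y = p * x + 1] determines [p] modulo [y]. *)
Lemma snum_uniq p p' x y : (p < y)%N -> (p' * y = p * x + 1)%N -> snum x y = p.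
Proof.
move=> py E; have y0 : (0 < y)%N by exact: leq_ltn_trans py.
have [cx cp] := bezout_coprime E; have [b Eb lt] := snumP y0 cx.
have H : (snum x y * x = p * x %[mod y])%N.
  by apply/eqP; rewrite -(eqn_modDr 1) -E -Eb !modnMl.
have D (m n : nat) : (m < y)%N -> (n < y)%N -> (m <= n)%N -> (m * x = n * x %[mod y])%N ->
    m = n.
  move=> my ny mn /esym/eqP; rewrite eqn_mod_dvd ?leq_mul2r ?mn ?orbT//.
  rewrite -mulnBl Gauss_dvdl 1?coprime_sym// -eqn_mod_dvd// => /eqP.
  by rewrite !modn_small.
by case: (leqP (snum x y) p) => [|/ltnW] h; [|symmetry]; apply: D.
Qed.

Definition sden (x y : nat) : nat := (egcdn y x).1.

Lemma sdenP x y : (0 < x)%N -> (0 < y)%N -> coprime x y ->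
  [/\ (sden x y * y = snum x y * x + 1)%N, (snum x y < y)%N, (0 < sden x y)%N
    & (sden x y <= x)%N].
Proof.
move=> x0 y0; rewrite coprime_sym /snum /sden => /eqP cxy.
case: (egcdnP x y0) => p' p /=; rewrite cxy muln1 => E lt; split=> //.
  by case: p' E => //; rewrite mul0n addn1.
rewrite leqNgt; apply/negP => xp.
have : (p' * y <= y.-1 * x + 1)%N.
  by rewrite E leq_add2r leq_mul2r; apply/orP; right; rewrite -ltnS prednK.
have : (x.+1 * y <= p' * y)%N by rewrite leq_mul2r xp orbT.
move=> h1 h2; have := leq_trans h1 h2.
by case: y y0 {E lt cxy h1 h2} => // y _; nia.
Qed.

Lemma sden_inj_mod x y y' : (0 < x)%N -> (0 < y)%N -> (0 < y')%N ->
  coprime x y -> coprime x y' ->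
  sden x y = sden x y' -> y = y' %[mod x].
Proof.
move=> x0 y0 y'0 /(sdenP x0 y0)[Ea _ _ _] /(sdenP x0 y'0)[Eb _ _ _] E.
have cp : coprime (sden x y) x.
  have : (sden x y * y = x * snum x y + 1)%N by rewrite Ea mulnC.
  move=> F; have F' : (y * sden x y = snum x y * x + 1)%N by rewrite mulnC Ea.
  by have [] := bezout_coprime F'; rewrite coprime_sym.
move: cp Ea Eb; rewrite -{}E; move: (sden x y) => p cp Ea Eb.
have : (p * y = p * y' %[mod x])%N by rewrite Ea Eb !modnMDl.
wlog le : y y' {Ea Eb y0 y'0} / (y' <= y)%N.
  by move=> W h; case: (leqP y' y) => [|/ltnW] l; [|symmetry]; apply: W.
move/eqP; rewrite eqn_mod_dvd ?leq_mul2l ?le ?orbT// -mulnBr Gauss_dvdr.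
  by rewrite -eqn_mod_dvd// => /eqP.
by rewrite coprime_sym.
Qed.

(** In a unimodular basis [(a, b), (a', b')], the fractions attached to [(j, k)]
    and to [j (a, b) + k (a', b')] correspond under the same change of basis:
    both come from completing the pair to a matrix of determinant one. *)
Lemma snum_basis a b a' b' j k : (a * b' = a' * b + 1)%N ->
  (0 < j)%N -> (0 < k)%N -> coprime j k ->
  let x := (j * a + k * a')%N in let y := (j * b + k * b')%N in
  coprime x y /\ snum x y = (sden j k * b + snum j k * b')%N.
Proof.
move=> ab j0 k0 cjk x y; have [E rk t0 tj] := sdenP j0 k0 cjk.
set t := sden j k in E t0 tj *; set r := snum j k in E rk *.
have b'0 : (0 < b')%N by case: b' ab @x @y; rewrite ?muln0 ?addn1.
have F : ((t * a + r * a') * y = (t * b + r * b') * x + 1)%N.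
  rewrite /x /y; nia.
split; first by have [] := bezout_coprime F.
apply: (snum_uniq _ F); rewrite /y -addnS leq_add ?leq_mul2r ?tj ?orbT//.
by rewrite ltn_mul2r b'0.
Qed.

Section slope.
Context {R : realType}.

Definition slope (x y : nat) : R := (snum x y)%:R / y%:R.

Lemma slope_itv x y : (0 < y)%N -> coprime x y -> 0 <= slope x y < 1.
Proof.
move=> y0 /(snumP y0)[_ _ h]; rewrite /slope divr_ge0//=.
by rewrite ltr_pdivrMr ?ltr0n// mul1r ltr_nat.
Qed.

Section basis.
Variables (a b a' b' j k : nat).
Hypothesis ab : (a * b' = a' * b + 1)%N.
Hypotheses (j0 : (0 < j)%N) (k0 : (0 < k)%N) (cjk : coprime j k).
Let x := (j * a + k * a')%N.
Let y := (j * b + k * b')%N.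

Let b'0 : (0 < b')%N.
Proof. by case: b' ab; rewrite ?muln0 ?addn1. Qed.

Let y0 : (0 < y)%N.
Proof. by rewrite /y addn_gt0 !muln_gt0 k0 b'0 orbT. Qed.

(** On a row where [k] is fixed, the slope is [snum j k / k] up to [1 / k], and
    [snum j k] is minus the inverse of [j] modulo [k]: it runs through the reduced
    residues, whatever the basis. *)
Lemma slope_fixed_k :
  (snum j k)%:R <= slope x y * k%:R <= (snum j k)%:R + 1.
Proof.
have [_] := snum_basis ab j0 k0 cjk; rewrite /slope -/x -/y => ->.
have [E rk t0 tj] := sdenP j0 k0 cjk.
rewrite mulrAC ler_pdivlMr ?ltr0n// ler_pdivrMr ?ltr0n// natr1.
rewrite -!natrM; move: E rk t0 tj; set t := sden _ _; set r := snum _ _.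
by move=> E rk t0 tj; rewrite !ler_nat /y; apply/andP; split; nia.
Qed.

(** The same on a column, where [sden j k] is the inverse of [k] modulo [j]. *)
Lemma slope_fixed_j :
  (sden j k)%:R - 1 <= slope x y * j%:R <= (sden j k)%:R.
Proof.
have [_] := snum_basis ab j0 k0 cjk; rewrite /slope -/x -/y => ->.
have [E rk t0 tj] := sdenP j0 k0 cjk.
rewrite mulrAC lerBlDr -[X in _ <= _ + X]divr1 addf_div ?oner_eq0 ?gt_eqF ?ltr0n//.
rewrite ler_pdivlMr ?mulr1 ?mul1r ?ltr0n// ler_pdivrMr ?ltr0n//.
move: E rk t0 tj; set t := sden _ _; set r := snum _ _.
by move=> E rk t0 tj; rewrite /y -?natrM -?natrD -?natrM !ler_nat; apply/andP; split; nia.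
Qed.

End basis.

Lemma sum_indic_sub (s : seq nat) (P X : pred nat) (la : R) :
  \sum_(j <- s | P j) ((X j)%:R - la) =
  (count (fun j => P j && X j) s)%:R - la * (count P s)%:R.
Proof.
elim: s => [|j s IH]; first by rewrite big_nil mulr0 subrr.
rewrite big_cons /= IH; case: (P j); case: (X j); rewrite /= !natrD; ring.
Qed.

Lemma sum_indic_sub_le (s : seq nat) (P X : pred nat) (la : R) : 0 <= la ->
  \sum_(j <- s | P j) ((X j)%:R - la) <= (size s)%:R.
Proof.
move=> la0; rewrite sum_indic_sub lerBlDr (@le_trans _ _ (size s)%:R)//.
  by rewrite ler_nat count_size.
by rewrite lerDl mulr_ge0.
Qed.

(** The constant covers the rounding of the ends of an interval; the sieve is
    applied twice, to the residues that may be hit and to a full period. *)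
Definition block_err (k : nat) : R := 5 + 2 * totient_err k.

Lemma block_err_ge0 k : 0 <= block_err k.
Proof. by rewrite addr_ge0// mulr_ge0// totient_err_ge0. Qed.

(** The error is relatively small for large moduli only; for the finitely many
    others it is at most 133 = 5 + 2 * 64 times the modulus. *)
Lemma block_err_small (e : R) : 0 < e -> exists k0 : nat,
  forall k, (0 < k)%N -> block_err k / k%:R <= e + (k < k0)%:R * 133.
Proof.
move=> e0; have e40 : 0 < e / 4 by rewrite divr_gt0.
have [k1 hk1] := totient_err_small e40.
exists (maxn k1 (Num.truncn (10 / e)).+1) => k k0.
have kR : 0 < k%:R :> R by rewrite ltr0n.
rewrite ler_pdivrMr// /block_err; case: ltnP => h.
  have h1 := @totient_err_le R _ k0; have h2 : 1 <= k%:R :> R by rewrite ler1n.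
  have h3 : 0 <= e * k%:R by rewrite mulr_ge0 ?ltW.
  rewrite mul1r; lra.
move: h; rewrite geq_max => /andP[/hk1 h1 h2].
have h3 : 10 <= e * k%:R.
  rewrite mulrC -ler_pdivrMr//; apply/ltW/(lt_le_trans (truncnS_gt _)).
  by rewrite ler_nat.
rewrite mul0r addr0; lra.
Qed.

(** The classes of integers coprime to [k] are labelled injectively by reduced
    residues [rho]; [X] selects some [j] for which [rho j / k] lies, up to [1 / k], between
    [al] and [be]. *)
Section levels.
Variables (k : nat) (rho : nat -> nat) (X : pred nat) (al be : R).
Hypotheses (k0 : (0 < k)%N) (al0 : 0 <= al) (albe : al <= be) (be1 : be <= 1).
Hypothesis rhoX : forall j, (0 < j)%N -> coprime j k -> X j ->
  coprime (rho j) k /\ al * k%:R - 1 <= (rho j)%:R <= be * k%:R + 1.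
Hypothesis rho_inj : forall i j, (0 < i)%N -> (0 < j)%N -> coprime i k ->
  coprime j k -> rho i = rho j -> i = j %[mod k].

Let lo := Num.truncn (al * k%:R - 1).
Let hi := Num.truncn (be * k%:R + 1).

Lemma block_injection j0 : (0 < j0)%N ->
  (count (fun j => coprime j k && X j) (iota j0 k) <=
   1 + count (fun r => coprime r k) (iota lo.+1 (hi - lo)))%N.
Proof.
move=> j00; rewrite -!size_filter.
set s := [seq j <- iota j0 k | _]; set s' := [seq r <- iota lo.+1 _ | _].
rewrite -(size_map rho) add1n -[_.+1]/(size (lo :: s')).
have sP j : j \in s -> [/\ (j0 <= j < j0 + k)%N, (0 < j)%N, coprime j k & X j].
  rewrite mem_filter mem_iota => /andP[/andP[h1 h2] h3]; split=> //.
  by case/andP: h3 => h _; exact: leq_trans h.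
apply: uniq_leq_size.
  rewrite map_inj_in_uniq ?filter_uniq ?iota_uniq// => i j.
  move=> /sP[ri i0 ci _] /sP[rj jj0 cj _] /(rho_inj i0 jj0 ci cj) E.
  case/andP: ri => ri1 ri2; case/andP: rj => rj1 rj2.
  have /eqP : (i - j0 == j - j0 %[mod k])%N by rewrite -(eqn_modDr j0) !subnK ?E.
  rewrite !modn_small ?ltn_subLR// => /(congr1 (addn^~ j0)).
  by rewrite !subnK.
move=> _ /mapP[j /sP[rj jj0 cj Xj] ->]; have [cr /andP[h1 h2]] := rhoX jj0 cj Xj.
have lor : (lo <= rho j)%N.
  have [h|h] := leP 0 (al * k%:R - 1).
    by rewrite -(ler_nat R) (le_trans _ h1)// truncn_le.
  by rewrite /lo truncn_floor leNgt h.
have hir : (rho j <= hi)%N.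
  by rewrite /hi truncn_ge_nat// addr_ge0 ?mulr_ge0// (le_trans al0).
rewrite inE; have [//|lor'] := eqVneq (rho j) lo; rewrite orFb.
by rewrite mem_filter cr mem_iota /=; lia.
Qed.

Let lohi : (lo <= hi)%N.
Proof.
have h : al * k%:R <= be * k%:R by rewrite ler_wpM2r.
by rewrite /lo /hi; apply: le_truncn; lra.
Qed.

(** Among [k] consecutive integers the selected ones inject into the reduced
    residues of an interval of length about [(be - al) * k], whose number is known
    by the sieve: their share is at most [be - al] up to the error. *)
Lemma block_bound j0 : (0 < j0)%N ->
  \sum_(j <- iota j0 k | coprime j k) ((X j)%:R - (be - al)) <= block_err k.
Proof.
move=> j00; rewrite sum_indic_sub.
have h1 := block_injection j00.
have h2 := @totient_density R _ _ _ k0 lohi.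
have := @totient_density R k j0.-1 (j0.-1 + k) k0 (leq_addr _ _).
rewrite addKn prednK// => h3.
have /andP[m0 m1] := @sieve_density_itv R _ (all_prime_primes k).
have e0 := @totient_err_ge0 R k; rewrite /block_err.
move: h1; rewrite -(ler_nat R) natrD.
set c := (count _ (iota j0 k))%:R; set c' := (count _ (iota lo.+1 _))%:R in h2 *.
set t := (count _ (iota j0 k))%:R in h3 *; move=> h1.
have k1 : 1 <= k%:R :> R by rewrite ler1n.
have ak : 0 <= al * k%:R by rewrite mulr_ge0.
have bk : 0 <= be * k%:R by rewrite mulr_ge0// (le_trans al0).
have h4 : (hi - lo)%:R <= (be - al) * k%:R + 3.
  rewrite natrB//.
  have hhi : hi%:R <= be * k%:R + 1 by rewrite /hi truncn_le addr_ge0.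
  have hlo : al * k%:R - 1 < lo%:R + 1 by rewrite natr1 truncnS_gt.
  lra.
have h5 : (hi - lo)%:R * sieve_density (primes k) <=
   (be - al) * k%:R * sieve_density (primes k) + 3 :> R.
  apply: (le_trans (ler_wpM2r m0 h4)).
  by rewrite mulrDl lerD2l -[leRHS]mulr1 ler_wpM2l.
move: h2 h3; rewrite !ler_norml => /andP[_ h2] /andP[h3 _].
have h6 : (be - al) * (k%:R * sieve_density (primes k) - t) <= totient_err k.
  have l0 : 0 <= be - al by rewrite subr_ge0.
  have l1 : be - al <= 1 by rewrite lerBlDr (le_trans be1)// lerDl.
  apply: (@le_trans _ _ ((be - al) * totient_err k)); first by rewrite ler_wpM2l//; lra.
  by rewrite -[leRHS]mul1r ler_wpM2r.
lra.
Qed.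

(** The interval is cut into blocks of [k] integers and an incomplete one. *)
Lemma level_bound j0 L : (0 < j0)%N ->
  \sum_(j <- iota j0 L | coprime j k) ((X j)%:R - (be - al))
   <= L%:R / k%:R * block_err k + k%:R.
Proof.
have kR : 0 < k%:R :> R by rewrite ltr0n.
rewrite {2}(divn_eq L k) [in iota j0 L](divn_eq L k) natrD natrM mulrDl mulfK ?gt_eqF//.
have := ltn_pmod L k0; set r := (L %% k)%N; set n := (L %/ k)%N => rk.
elim: n j0 => [|n IH] j0 j00.
  rewrite mul0n add0n add0r (le_trans (sum_indic_sub_le _ _ _ _)) ?subr_ge0//.
  rewrite size_iota -[leLHS]add0r lerD ?ler_nat ?(ltnW rk)//.
  by rewrite mulr_ge0 ?block_err_ge0// divr_ge0.
rewrite mulSn -addnA iotaD big_cat /= -natr1.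
have h1 := block_bound j00; have h2 := IH (j0 + k)%N (ltn_addr _ j00).
lra.
Qed.

End levels.
End slope.

(** * Equidistribution of the slopes in a convex region *)

Section sums.
Context {R : realType}.

Lemma sum_shift (f : nat -> R) n k : (forall j, (n < j)%N -> f j = 0) ->
  \sum_(1 <= j < n.+1 | (k < j)%N) f j = \sum_(1 <= i < n.+1) f (i + k)%N.
Proof.
move=> f0; rewrite [RHS](_ : _ = \sum_(1 + k <= j < n.+1 + k) f j); last first.
  by rewrite big_addn addnK.
have [nk|kn] := ltnP n k.
  rewrite big1_seq ?big1_seq// => j; rewrite mem_index_iota.
    by move=> /andP[_ /andP[h _]]; apply: f0; lia.
  by move=> /andP[h1 /andP[_ h2]]; lia.
rewrite [RHS](@big_cat_nat _ _ _ n.+1)//=; [|lia].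
rewrite [X in _ = _ + X]big1_seq ?addr0; last first.
  by move=> j; rewrite mem_index_iota => /andP[_ /andP[h _]]; exact: f0.
by rewrite [RHS](big_nat_widenl (1 + k) 1)//.
Qed.

(** One step of the Euclidean algorithm on the pairs of positive integers: those
    below the diagonal, those above it, and the diagonal. *)
Lemma sum_euclid (F : nat -> nat -> R) n :
  (forall j k, (n < j)%N || (n < k)%N -> F j k = 0) ->
  \sum_(1 <= j < n.+1) \sum_(1 <= k < n.+1) F j k =
  \sum_(1 <= j < n.+1) \sum_(1 <= k < n.+1) F j (j + k)%N +
  \sum_(1 <= j < n.+1) \sum_(1 <= k < n.+1) F (j + k)%N k +
  \sum_(1 <= j < n.+1) F j j.
Proof.
move=> F0.
transitivity (\sum_(1 <= j < n.+1) (\sum_(1 <= k < n.+1 | (j < k)%N) F j k +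
    \sum_(1 <= k < n.+1 | (k < j)%N) F j k + F j j)).
  apply: eq_big_nat => j jn.
  rewrite (bigID (fun k => j < k)%N)/= -addrA; congr (_ + _).
  rewrite (bigID (fun k => k < j)%N)/=; congr (_ + _).
    by apply: eq_bigl => k; case: ltngtP.
  rewrite (eq_bigl (fun k => k == j)); last by move=> k; case: ltngtP.
  by rewrite big_nat1_eq jn.
rewrite !big_split /=; congr (_ + _ + _).
  apply: eq_big_nat => j jn; rewrite (sum_shift (f := F j)).
    by apply: eq_bigr => k _; rewrite addnC.
  by move=> k kn; rewrite F0// kn orbT.
under eq_bigr do rewrite big_mkcond /=.
rewrite exchange_big /= [RHS]exchange_big /=.
apply: eq_big_nat => k kn; rewrite -big_mkcond /= (sum_shift (f := F^~ k))//.
by move=> j jn; rewrite F0// jn.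
Qed.

(** A set of integers without gaps is an interval. *)
Lemma interval_filter (P : pred nat) n :
  (forall i j k, (i <= j <= k)%N -> P i -> P k -> P j) ->
  exists j0 L, (0 < j0)%N /\ [seq j <- iota 1 n | P j] = iota j0 L.
Proof.
move=> Pc; elim: n => [|n [j0 [L [j00 IH]]]]; first by exists 1%N, 0%N.
rewrite -(addn1 n) iotaD filter_cat IH /= add1n.
case: ifP => Pn; last by exists j0, L; rewrite cats0.
case: L IH => [|L] IH; first by exists n.+1, 1%N.
have Lin : forall j, (j0 <= j <= n)%N -> P j.
  move=> j /andP[h1 h2]; apply: (Pc j0 j n.+1) => //.
    by rewrite h1 (leq_trans h2).
  have : j0 \in iota j0 L.+1 by rewrite mem_iota leqnn addnS ltnS leq_addr.
  by rewrite -IH mem_filter => /andP[].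
have j0n : (j0 <= n)%N.
  have : j0 \in iota j0 L.+1 by rewrite mem_iota leqnn addnS ltnS leq_addr.
  by rewrite -IH mem_filter mem_iota add1n ltnS => /andP[_ /andP[]].
have E : n.+1 = (j0 + L.+1)%N.
  have : n \in iota j0 L.+1.
    rewrite -IH mem_filter Lin ?j0n ?leqnn// mem_iota add1n ltnSn.
    by move: j0n; case: n {IH Lin Pn} => //; rewrite leqNgt j00.
  rewrite mem_iota => /andP[_ h1].
  have : (j0 + L)%N \in iota j0 L.+1 by rewrite mem_iota addnS ltnSn leq_addr.
  by rewrite -IH mem_filter mem_iota => /andP[_ /andP[_]]; lia.
by exists j0, L.+2; split=> //; rewrite E -[L.+2]addn1 iotaD.
Qed.

Lemma sum_le_const (s : seq nat) (P : pred nat) (f : nat -> R) (c : R) :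
  0 <= c -> (forall i, P i -> f i <= c) -> (forall i, ~~ P i -> f i <= 0) ->
  \sum_(i <- s) f i <= (count P s)%:R * c.
Proof.
move=> c0 h1 h2; elim: s => [|i s IH]; first by rewrite big_nil mul0r.
rewrite big_cons /= natrD mulrDl lerD//.
by case: (boolP (P i)) => Pi; rewrite ?mul1r ?mul0r ?h1 ?h2.
Qed.

Lemma count_le_div n m d : (0 < d)%N ->
  (count (fun k => k * d <= m) (iota 1 n) <= m %/ d)%N.
Proof.
move=> d0; rewrite -size_filter -[leqRHS](size_iota 1).
apply: uniq_leq_size; first by rewrite filter_uniq ?iota_uniq.
move=> k; rewrite mem_filter !mem_iota => /andP[h1 /andP[h2 _]].
by rewrite h2 add1n ltnS leq_divRL.
Qed.

Lemma near_scale (c e : R) : 0 < e -> \forall Q \near \oo, c <= e * Q%:R.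
Proof.
move=> e0; exists (Num.truncn (`|c| / e)).+1 => // Q /= hQ.
rewrite mulrC -ler_pdivrMr//; apply: (@le_trans _ _ (`|c| / e)).
  by rewrite ler_pM2r ?invr_gt0// ler_norm.
by apply/ltW/(lt_le_trans (truncnS_gt _)); rewrite ler_nat.
Qed.

End sums.

Section equidistribution.
Context {R : realType}.
Variables (R0 : nat) (D : R -> R -> bool) (al be : R).
Hypotheses (al0 : 0 <= al) (albe : al <= be) (be1 : be <= 1).
Hypothesis D_bounded : forall X Y, D X Y -> (0 < X <= R0%:R) && (0 < Y <= R0%:R).
Hypothesis D_convex : forall X Y X' Y' t, D X Y -> D X' Y' -> 0 <= t <= 1 ->
  D ((1 - t) * X + t * X') ((1 - t) * Y + t * Y').

Let la := be - al.
Let inI (x y : nat) : bool := al <= slope x y < be.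
Let DQ (Q x y : nat) : bool := D (x%:R / Q%:R) (y%:R / Q%:R).

(** Summed over the coprime pairs of the region [D] scaled by [Q], this is how
    much the number of slopes in [al, be) exceeds the expected proportion. An
    upper bound suffices, as the complementary intervals yield the lower one. *)
Definition excess (Q x y : nat) : R :=
  if coprime x y && DQ Q x y then (inI x y)%:R - la else 0.

Let la0 : 0 <= la. Proof. by rewrite subr_ge0. Qed.

Let excess_le1 Q x y : excess Q x y <= 1.
Proof.
rewrite /excess; case: ifP => // _.
by case: (inI x y); rewrite ?mulr1n ?mulr0n; move: la0; lra.
Qed.

Let DQ_bounded Q x y : DQ Q x y ->
  [/\ (0 < x)%N, (0 < y)%N, (x <= R0 * Q)%N & (y <= R0 * Q)%N].
Proof.
case: Q => [|Q]; first by rewrite /DQ => /D_bounded; rewrite invr0 !mulr0 ltxx.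
move=> /D_bounded; have Q0 : 0 < Q.+1%:R :> R by rewrite ltr0n.
rewrite !(pmulr_lgt0 _ (_ : 0 < Q.+1%:R^-1)) ?invr_gt0// !ler_pdivrMr//.
by rewrite -!natrM !ler_nat !ltr0n => /andP[/andP[-> ->] /andP[-> ->]].
Qed.

Let excess0 Q x y : (R0 * Q < x)%N || (R0 * Q < y)%N -> excess Q x y = 0.
Proof.
move=> h; rewrite /excess; case: ifP => // /andP[_ /DQ_bounded[_ _ xn yn]].
by move: h; rewrite !ltnNge xn yn.
Qed.

Let coprime_basis a b a' b' j k : (a * b' = a' * b + 1)%N ->
  (0 < j)%N -> (0 < k)%N ->
  coprime (j * a + k * a') (j * b + k * b') = coprime j k.
Proof.
move=> ab j0 k0; apply/idP/idP => [|cjk]; last by have [] := snum_basis ab j0 k0 cjk.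
rewrite /coprime -!dvdn1; apply: dvdn_trans.
by rewrite dvdn_gcd !dvdn_add ?dvdn_mulr ?dvdn_gcdl ?dvdn_gcdr.
Qed.

(** The pairs in the open cone spanned by [(a, b)] and [(a', b')]; with the bound
    [R0 * Q] on the coordinates [j] and [k] none of those in the region is lost. *)
Definition cone_sum (a b a' b' Q : nat) : R :=
  \sum_(1 <= j < (R0 * Q).+1) \sum_(1 <= k < (R0 * Q).+1)
    excess Q (j * a + k * a') (j * b + k * b').

Let det1_pos a b a' b' : (a * b' = a' * b + 1)%N -> (0 < a + b)%N /\ (0 < a' + b')%N.
Proof. by case: a b b' => [|a] [|b] [|b']; lia. Qed.

(** Inserting the mediant vector splits a cone into two; the coprime pairs on the
    ray between them reduce to the mediant itself, which accounts for the [1]. *)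
Lemma cone_split a b a' b' Q : (a * b' = a' * b + 1)%N ->
  cone_sum a b a' b' Q <=
  cone_sum a b (a + a') (b + b') Q + cone_sum (a + a') (b + b') a' b' Q + 1.
Proof.
move=> ab; rewrite /cone_sum; set n := (R0 * Q)%N.
set F := fun j k => excess Q (j * a + k * a') (j * b + k * b').
have F0 j k : (n < j)%N || (n < k)%N -> F j k = 0.
  move=> h; apply: excess0; rewrite -/n; move: h.
  have [a0|a0] := posnP a; have [b0|b0] := posnP b; have [a'0|a'0] := posnP a';
  have [b'0|b'0] := posnP b'; nia.
rewrite (sum_euclid F0) lerD//.
  rewrite addrC lerD//.
    rewrite le_eqVlt; apply/orP; left; apply/eqP.
    apply: eq_bigr => j _; apply: eq_bigr => k _; congr excess; lia.
  rewrite le_eqVlt; apply/orP; left; apply/eqP.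
  apply: eq_bigr => j _; apply: eq_bigr => k _; congr excess; lia.
(* on the diagonal only j = 1 gives a coprime pair *)
apply: (@le_trans _ _ (\sum_(1 <= j < n.+1 | j == 1%N) 1)).
  rewrite [leRHS]big_mkcond; apply: ler_sum_nat => j /andP[j1 _].
  case: eqP => [_|/eqP jn1]; first exact: excess_le1.
  rewrite /F /excess -!mulnDr coprimeMl [coprime j _]coprimeMr /coprime gcdnn.
  by rewrite (negbTE jn1).
by rewrite big_nat1_eq; case: ifP.
Qed.

(** One row of a cone: by convexity the region meets it in an interval, of length
    at most [m / A] because of the bound on [j * A + k * A'], and the slopes along
    it are equidistributed up to [block_err k / k] and an incomplete block. *)
Let inner_bound (k n m A A' : nat) (rho : nat -> nat) (Dk X : pred nat) :
  (0 < k)%N -> (0 < A)%N ->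
  (forall j, (0 < j)%N -> coprime j k -> X j ->
    coprime (rho j) k /\ al * k%:R - 1 <= (rho j)%:R <= be * k%:R + 1) ->
  (forall i j, (0 < i)%N -> (0 < j)%N -> coprime i k -> coprime j k ->
    rho i = rho j -> i = j %[mod k]) ->
  (forall i j l, (i <= j <= l)%N -> Dk i -> Dk l -> Dk j) ->
  (forall j, Dk j -> (j * A + k * A' <= m)%N) ->
  \sum_(1 <= j < n.+1) (if coprime j k && Dk j then (X j)%:R - la else 0)
  <= if (k * A' <= m)%N then m%:R / A%:R * (block_err k / k%:R) + k%:R else 0 :> R.
Proof.
move=> k0 A0 hX hinj hconv hm.
have [j0 [L [j00 E]]] := interval_filter n hconv.
rewrite (_ : \sum_(1 <= j < n.+1) _ =
    \sum_(j <- [seq j <- iota 1 n | Dk j] | coprime j k) ((X j)%:R - la)); last first.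
  rewrite big_filter_cond [RHS]big_mkcond /index_iota subn1.
  by apply: eq_bigr => j _; rewrite andbC.
rewrite E.
have := level_bound k0 al0 albe be1 hX hinj L j00.
case: L E => [|L] E.
  rewrite /= !big_nil => _; case: ifP => // _.
  by rewrite addr_ge0// mulr_ge0// divr_ge0// block_err_ge0.
have : (j0 + L)%N \in [seq j <- iota 1 n | Dk j].
  by rewrite E mem_iota addnS leq_addr ltnSn.
rewrite mem_filter => /andP[/hm hj _] h.
have -> : (k * A' <= m)%N by exact: leq_trans (leq_addl _ _) hj.
apply: (le_trans h); rewrite lerD2r mulrAC -mulrA ler_wpM2r//.
  by rewrite divr_ge0// block_err_ge0.
rewrite ler_pdivlMr ?ltr0n// -natrM ler_nat.
by apply: leq_trans hj; apply: leq_trans (leq_addr _ _); rewrite leq_mul2r; lia.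
Qed.

(** In the region, [x + y] is at most [2 * R0 * Q]; this is the square of that
    bound divided by [Q ^+ 2]. *)
Let Cst : R := 4 * R0%:R ^+ 2.

(** Summation over the rows. With [M = 2 * R0 * Q] there are at most [M / A'] of
    them, each losing an incomplete block of length at most [M / A']; in a thin
    cone [A' >= N * A] this makes [M ^+ 2 / A' ^+ 2 <= M ^+ 2 / (N * A * A')]. The
    other errors are [o(Q ^+ 2)]. *)
Let thin_sum (A A' N : nat) (S : nat -> nat -> R) :
  (0 < A)%N -> (0 < A')%N -> (0 < N)%N -> (N * A <= A')%N ->
  (forall Q k, (0 < k)%N -> S Q k <=
    if (k * A' <= 2 * (R0 * Q))%N
    then (2 * (R0 * Q))%:R / A%:R * (block_err k / k%:R) + k%:R else 0) ->
  forall e, 0 < e -> \forall Q \near \oo,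
  \sum_(1 <= k < (R0 * Q).+1) S Q k <= (Cst / N%:R * (A * A')%:R^-1 + e) * Q%:R ^+ 2.
Proof.
move=> A0 A'0 N0 NA hS e e0.
have C0 : 0 <= Cst by rewrite mulr_ge0// sqr_ge0.
pose e' := e / (2 * (Cst + 1)).
have e'0 : 0 < e' by rewrite divr_gt0// mulr_gt0// ltr_wpDl.
have Ce' : Cst * e' <= e / 2.
  rewrite /e' mulrA ler_pdivrMr ?mulr_gt0 ?ltr_wpDl//.
  by rewrite (_ : e / 2 * _ = Cst * e + e) ?lerDl ?ltW//; field.
have [k0 hk0] := block_err_small e'0.
have e20 : 0 < e / 2 by rewrite divr_gt0.
near=> Q.
have hQ : 2 * R0%:R * (k0%:R * 133) <= e / 2 * Q%:R.
  by near: Q; exact: near_scale.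
set n := (R0 * Q)%N; set M : R := (2 * n)%:R.
have A1 : 0 < A%:R :> R by rewrite ltr0n.
have A'1 : 0 < A'%:R :> R by rewrite ltr0n.
have N1 : 0 < N%:R :> R by rewrite ltr0n.
have M0 : 0 <= M by [].
pose g k : R := (k < k0)%:R * 133.
have step k : (1 <= k < n.+1)%N -> S Q k <=
    (if (k * A' <= 2 * n)%N then M / A%:R * e' + M / A'%:R else 0) + M / A%:R * g k.
  move=> /andP[k1 _]; apply: (le_trans (hS Q k k1)).
  have h0 : 0 <= M / A%:R * g k by rewrite mulr_ge0 ?divr_ge0// mulr_ge0.
  rewrite -/n -/M; case: ifP => h; last by rewrite add0r.
  rewrite addrAC -mulrDr lerD//; first by rewrite ler_wpM2l ?divr_ge0// hk0.
  by rewrite ler_pdivlMr// -natrM ler_nat.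
apply: (le_trans (ler_sum_nat step)).
rewrite big_split /= -mulr_sumr.
have h1 : \sum_(1 <= k < n.+1) (if (k * A' <= 2 * n)%N then
     M / A%:R * e' + M / A'%:R else 0) <= M / A'%:R * (M / A%:R * e' + M / A'%:R).
  have p0 : 0 <= M / A%:R * e' + M / A'%:R.
    by apply: addr_ge0; [apply: mulr_ge0; [exact: divr_ge0|exact: ltW]|exact: divr_ge0].
  apply: (le_trans (@sum_le_const R _ (fun k => k * A' <= 2 * n)%N _ _ p0 _ _)).
  - by move=> i ->.
  - by move=> i /negbTE ->.
  rewrite ler_wpM2r// ler_pdivlMr// -natrM ler_nat.
  rewrite /index_iota subn1 /= -leq_divRL//.
  by rewrite count_le_div.
have h2 : \sum_(1 <= k < n.+1) g k <= k0%:R * 133.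
  apply: (le_trans (@sum_le_const R _ (fun k => k < k0)%N _ 133 _ _ _)) => //.
  - by move=> i; rewrite /g => ->; rewrite mul1r.
  - by move=> i /negbTE; rewrite /g => ->; rewrite mul0r.
  rewrite ler_wpM2r// ler_nat -size_filter -[leqRHS](size_iota 0).
  apply: uniq_leq_size; first by rewrite filter_uniq ?iota_uniq.
  by move=> k; rewrite mem_filter mem_iota => /andP[].
have MA : M / A%:R <= M by rewrite ler_pdivrMr// ler_peMr// ler1n.
have MM : M ^+ 2 = Cst * Q%:R ^+ 2.
  by rewrite /M /n /Cst !natrM; ring.
have h3 : M / A%:R * \sum_(1 <= k < n.+1) g k <= e / 2 * Q%:R ^+ 2.
  apply: (@le_trans _ _ (M * (k0%:R * 133))).
    by apply: ler_pM => //; [rewrite divr_ge0|apply: sumr_ge0 => i _; rewrite mulr_ge0].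
  rewrite expr2 [leRHS]mulrA; apply: le_trans (ler_wpM2r (ler0n R Q) hQ).
  by rewrite /M /n !natrM le_eqVlt; apply/orP; left; apply/eqP; ring.
have h4 : M / A'%:R * (M / A%:R * e') <= e / 2 * Q%:R ^+ 2.
  apply: (@le_trans _ _ (M * (M * e'))).
    have MA' : M / A'%:R <= M by rewrite ler_pdivrMr// ler_peMr// ler1n.
    apply: ler_pM => //; first exact: divr_ge0.
      by apply: mulr_ge0; [exact: divr_ge0|exact: ltW].
    by apply: ler_wpM2r => //; exact: ltW.
  by rewrite mulrA -expr2 MM mulrAC ler_wpM2r// exprn_ge0.
have h5 : M / A'%:R * (M / A'%:R) <= Cst / N%:R * (A * A')%:R^-1 * Q%:R ^+ 2.
  rewrite (_ : M / A'%:R * _ = M ^+ 2 * (A'%:R * A'%:R)^-1); last first.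
    by rewrite invfM expr2; ring.
  rewrite MM mulrAC ler_wpM2r ?exprn_ge0// -mulrA ler_wpM2l// -invfM.
  rewrite lef_pV2 ?posrE ?mulr_gt0 ?ltr0n ?muln_gt0 ?A0// -!natrM ler_nat.
  by rewrite mulnA leq_mul2r NA orbT.
rewrite mulrDl.
have -> : e = e / 2 + e / 2 by lra.
move: h1 h3 h4 h5; rewrite mulrDr; lra.
Unshelve. all: by end_near. Qed.

(** Convexity of [D]: the integers whose points on a given line fall into the
    region have no gaps. *)
Let DQ_line (cx cy dx dy Q i j l : nat) : (i <= j <= l)%N ->
  DQ Q (i * dx + cx) (i * dy + cy) -> DQ Q (l * dx + cx) (l * dy + cy) ->
  DQ Q (j * dx + cx) (j * dy + cy).
Proof.
move=> /andP[ij jl] hi hl; have [il|il] := eqVneq i l.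
  by rewrite -(_ : i = j)//; apply/eqP; rewrite eqn_leq ij il jl.
have {}il : (i < l)%N by rewrite ltn_neqAle il (leq_trans ij).
pose t : R := (j%:R - i%:R) / (l%:R - i%:R).
have d0 : 0 < l%:R - i%:R :> R by rewrite subr_gt0 ltr_nat.
have t01 : 0 <= t <= 1.
  rewrite divr_ge0 ?ler_pdivrMr ?mul1r ?lerD2r ?ler_nat ?jl//; first by rewrite subr_ge0 ler_nat.
  exact: ltW.
have dn0 : l%:R - i%:R != 0 :> R by rewrite gt_eqF.
have := D_convex hi hl t01; rewrite /DQ.
have aff (d c : nat) : (1 - t) * ((i * d + c)%:R / Q%:R) + t * ((l * d + c)%:R / Q%:R)
    = (j * d + c)%:R / Q%:R.
  rewrite !mulrA -mulrDl; congr (_ / _); rewrite !natrD !natrM /t; field.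
  exact: dn0.
by rewrite !aff.
Qed.

(** A cone whose second side is at least [N] times as long as the first (in the
    norm [x + y]): sum along the first side, where the rows are long. *)
Let thin_right a b a' b' N : (a * b' = a' * b + 1)%N -> (0 < N)%N ->
  (N * (a + b) <= a' + b')%N -> forall e, 0 < e -> \forall Q \near \oo,
  cone_sum a b a' b' Q <=
    (Cst / N%:R * ((a + b) * (a' + b'))%:R^-1 + e) * Q%:R ^+ 2.
Proof.
move=> ab N0 NA e e0; have [A0 A'0] := det1_pos ab.
pose S Q k := \sum_(1 <= j < (R0 * Q).+1) excess Q (j * a + k * a') (j * b + k * b').
have hS Q k : (0 < k)%N -> S Q k <= if (k * (a' + b') <= 2 * (R0 * Q))%N
    then (2 * (R0 * Q))%:R / (a + b)%:R * (block_err k / k%:R) + k%:R else 0.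
  move=> k0.
  pose X j := inI (j * a + k * a') (j * b + k * b').
  pose Dk j := DQ Q (j * a + k * a') (j * b + k * b').
  apply: le_trans (@inner_bound k (R0 * Q) _ (a + b) (a' + b') (snum^~ k) Dk X _ _ _ _ _ _) => //.
  - apply: ler_sum_nat => j /andP[j1 _]; rewrite /excess (coprime_basis ab)//.
  - move=> j j0 cjk /andP[h1 h2]; have [E _ _ _] := sdenP j0 k0 cjk.
    have [_ ->] := bezout_coprime E; split=> //.
    have /andP[h3 h4] := @slope_fixed_k R _ _ _ _ _ _ ab j0 k0 cjk.
    have kR : 0 < k%:R :> R by rewrite ltr0n.
    move: h1 h2; rewrite -(ler_pM2r kR) -(ltr_pM2r kR) => h1 h2.
    by apply/andP; split; lra.
  - by move=> i j i0 j0 ci cj; exact: snum_inj_mod.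
  - by move=> i j l ijl; exact: DQ_line.
  - by move=> j /DQ_bounded[_ _]; lia.
have := thin_sum A0 A'0 N0 NA hS e0; apply: filterS => Q.
by rewrite /cone_sum exchange_big.
Qed.

(** The mirror image, summing along the second side. *)
Let thin_left a b a' b' N : (a * b' = a' * b + 1)%N -> (0 < N)%N ->
  (N * (a' + b') <= a + b)%N -> forall e, 0 < e -> \forall Q \near \oo,
  cone_sum a b a' b' Q <=
    (Cst / N%:R * ((a + b) * (a' + b'))%:R^-1 + e) * Q%:R ^+ 2.
Proof.
move=> ab N0 NA e e0; have [A0 A'0] := det1_pos ab.
pose S Q j := \sum_(1 <= k < (R0 * Q).+1) excess Q (j * a + k * a') (j * b + k * b').
have hS Q j : (0 < j)%N -> S Q j <= if (j * (a + b) <= 2 * (R0 * Q))%N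
    then (2 * (R0 * Q))%:R / (a' + b')%:R * (block_err j / j%:R) + j%:R else 0.
  move=> j0.
  pose X k := inI (j * a + k * a') (j * b + k * b').
  pose Dk k := DQ Q (j * a + k * a') (j * b + k * b').
  apply: le_trans (@inner_bound j (R0 * Q) _ (a' + b') (a + b) (sden j) Dk X _ _ _ _ _ _) => //.
  - apply: ler_sum_nat => k /andP[k1 _]; rewrite /excess (coprime_basis ab)//.
    by rewrite coprime_sym.
  - move=> k k0; rewrite coprime_sym => cjk /andP[h1 h2].
    have [E _ _ _] := sdenP j0 k0 cjk.
    have E' : (k * sden j k = snum j k * j + 1)%N by rewrite -E mulnC.
    split; first by rewrite coprime_sym; have [] := bezout_coprime E'.
    have /andP[h3 h4] := @slope_fixed_j R _ _ _ _ _ _ ab j0 k0 cjk.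
    have jR : 0 < j%:R :> R by rewrite ltr0n.
    move: h1 h2; rewrite -(ler_pM2r jR) -(ltr_pM2r jR) => h1 h2.
    by apply/andP; split; lra.
  - move=> i k i0 k0; rewrite coprime_sym => ci; rewrite coprime_sym => cj.
    exact: sden_inj_mod.
  - move=> i k l ikl; rewrite /Dk ![(j * _ + _)%N]addnC; exact: DQ_line.
  - by move=> k /DQ_bounded[_ _]; lia.
have := thin_sum A'0 A0 N0 NA hS e0; apply: filterS => Q.
by rewrite /cone_sum [((a' + b') * _)%N]mulnC.
Qed.

(** Counting all points of the cone. *)
Let trivial_bound a b a' b' Q : (a * b' = a' * b + 1)%N ->
  cone_sum a b a' b' Q <= Cst * ((a + b) * (a' + b'))%:R^-1 * Q%:R ^+ 2.
Proof.
move=> ab; have [A0 A'0] := det1_pos ab.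
have A1 : 0 < (a + b)%:R :> R by rewrite ltr0n.
have A'1 : 0 < (a' + b')%:R :> R by rewrite ltr0n.
set n := (R0 * Q)%N; set M : R := (2 * n)%:R.
have -> : Cst * ((a + b) * (a' + b'))%:R^-1 * Q%:R ^+ 2 =
    M / (a + b)%:R * (M / (a' + b')%:R).
  by rewrite /Cst /M /n !natrM invfM; ring.
have cnt d : (0 < d)%N ->
    (count (fun k => k * d <= 2 * n)%N (iota 1 n))%:R <= M / d%:R.
  move=> d0; rewrite ler_pdivlMr ?ltr0n// -natrM ler_nat -leq_divRL//.
  exact: count_le_div.
have pos d : 0 <= M / d%:R by rewrite divr_ge0.
apply: le_trans (ler_wpM2r (pos _) (cnt _ A0)).
rewrite /cone_sum -/n /index_iota subn1 /=; apply: sum_le_const => // j hj.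
  apply: le_trans (cnt _ A'0); rewrite -[leRHS]mulr1.
  apply: sum_le_const => // k hk; rewrite /excess; case: ifP => //.
  by move=> /andP[_ /DQ_bounded[_ _]]; move: hk; rewrite -/n; lia.
rewrite big1// => k _; rewrite /excess; case: ifP => //.
by move=> /andP[_ /DQ_bounded[_ _]]; move: hj; rewrite -/n; lia.
Qed.

(** With the norm [x + y], twice the area of the triangle that the line
    [x + y = 1] cuts from the cone; it is therefore additive under splitting. *)
Let cone_mass (a b a' b' : nat) : R := ((a + b) * (a' + b'))%:R^-1.

Let bounded_by (rho : R) := forall a b a' b', (a * b' = a' * b + 1)%N ->
  forall e, 0 < e -> \forall Q \near \oo,
  cone_sum a b a' b' Q <= (rho * cone_mass a b a' b' + e) * Q%:R ^+ 2.

Let cone_mass_split a b a' b' : (a * b' = a' * b + 1)%N ->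
  cone_mass a b a' b' =
  cone_mass a b (a + a') (b + b') + cone_mass (a + a') (b + b') a' b'.
Proof.
move=> /det1_pos[A0 A'0]; rewrite /cone_mass addnACA.
move: A0 A'0; set A := (a + b)%N; set A' := (a' + b')%N => A0 A'0.
have A1 : A%:R != 0 :> R by rewrite pnatr_eq0 -lt0n.
have A'1 : A'%:R != 0 :> R by rewrite pnatr_eq0 -lt0n.
have AA1 : A%:R + A'%:R != 0 :> R by rewrite -natrD pnatr_eq0; lia.
rewrite !natrM natrD; field; by rewrite A1 A'1 AA1.
Qed.

Let near_const (c e : R) : 0 < e -> \forall Q \near \oo, c <= e * Q%:R ^+ 2.
Proof.
move=> e0; near=> Q.
have h1 : `|c| <= e * Q%:R by near: Q; exact: near_scale.
have Q1 : 1 <= Q%:R :> R by rewrite ler1n; near: Q; exact: nbhs_infty_gt.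
rewrite (le_trans (ler_norm c))// (le_trans h1)// (ler_wpM2l (ltW e0))//.
by rewrite expr2 ler_peMl// (le_trans ler01).
Unshelve. all: by end_near. Qed.

Let det_right a b a' b' i : (a * b' = a' * b + 1)%N ->
  (a * (i * b + b') = (i * a + a') * b + 1)%N.
Proof. by move=> ab; rewrite mulnDr mulnDl ab; lia. Qed.

Let det_left a b a' b' i : (a * b' = a' * b + 1)%N ->
  ((i * a' + a) * b' = a' * (i * b' + b) + 1)%N.
Proof. by move=> ab; rewrite mulnDr mulnDl ab; lia. Qed.

(** Insert [i] mediants next to the first side: what is cut off is bounded by
    [rho] times its mass, and a cone with an elongated second side remains. *)
Let iter_right rho a b a' b' i : bounded_by rho -> (a * b' = a' * b + 1)%N ->
  forall e, 0 < e -> \forall Q \near \oo,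
  cone_sum a b a' b' Q <= cone_sum a b (i * a + a') (i * b + b') Q +
   (rho * (cone_mass a b a' b' - cone_mass a b (i * a + a') (i * b + b')) + e)
     * Q%:R ^+ 2.
Proof.
move=> Bd ab; elim: i => [|i IH] e e0.
  near=> Q; rewrite !mul0n !add0n subrr mulr0 add0r lerDl.
  by rewrite mulr_ge0 ?exprn_ge0// ltW.
have e3 : 0 < e / 3 by rewrite divr_gt0.
have abi := det_right i ab; have abi' := det_right i.+1 ab.
have d : ((a + (i * a + a')) * (i * b + b') = (i * a + a') * (b + (i * b + b')) + 1)%N.
  by move: abi; clear; nia.
near=> Q.
have h1 := cone_split Q abi.
have h2 : 1 <= e / 3 * Q%:R ^+ 2 by near: Q; exact: near_const.
have h3 : cone_sum a b a' b' Q <= cone_sum a b (i * a + a') (i * b + b') Q +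
   (rho * (cone_mass a b a' b' - cone_mass a b (i * a + a') (i * b + b')) + e / 3)
     * Q%:R ^+ 2 by near: Q; exact: IH.
have h4 : cone_sum (a + (i * a + a')) (b + (i * b + b')) (i * a + a') (i * b + b') Q <=
   (rho * cone_mass (a + (i * a + a')) (b + (i * b + b')) (i * a + a') (i * b + b')
     + e / 3) * Q%:R ^+ 2 by near: Q; exact: Bd.
have E := cone_mass_split abi.
rewrite !mulSn -!addnA.
move: h1 h2 h3 h4 E; set T0 := cone_sum a b a' b' Q.
set T1 := cone_sum a b (i * a + a') _ Q; set T2 := cone_sum a b (a + _) _ Q.
set T3 := cone_sum (a + _) _ _ _ Q.
set m1 := cone_mass a b (i * a + a') _; set m2 := cone_mass a b (a + _) _.
set m3 := cone_mass (a + _) _ _ _; set m0 := cone_mass a b a' b'.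
set q := Q%:R ^+ 2; move=> h1 h2 h3 h4 E; rewrite E in h3.
have -> : (rho * (m0 - m2) + e) * q =
   (rho * (m0 - (m2 + m3)) + e / 3) * q + (rho * m3 + e / 3) * q + e / 3 * q.
  by field.
lra.
Unshelve. all: by end_near. Qed.

Let iter_left rho a b a' b' i : bounded_by rho -> (a * b' = a' * b + 1)%N ->
  forall e, 0 < e -> \forall Q \near \oo,
  cone_sum a b a' b' Q <= cone_sum (i * a' + a) (i * b' + b) a' b' Q +
   (rho * (cone_mass a b a' b' - cone_mass (i * a' + a) (i * b' + b) a' b') + e)
     * Q%:R ^+ 2.
Proof.
move=> Bd ab; elim: i => [|i IH] e e0.
  near=> Q; rewrite !mul0n !add0n subrr mulr0 add0r lerDl.
  by rewrite mulr_ge0 ?exprn_ge0// ltW.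
have e3 : 0 < e / 3 by rewrite divr_gt0.
have abi := det_left i ab.
have d : ((i * a' + a) * (i * b' + b + b') = (i * a' + a + a') * (i * b' + b) + 1)%N.
  by move: abi; clear; nia.
near=> Q.
have h1 := cone_split Q abi.
have h2 : 1 <= e / 3 * Q%:R ^+ 2 by near: Q; exact: near_const.
have h3 : cone_sum a b a' b' Q <= cone_sum (i * a' + a) (i * b' + b) a' b' Q +
   (rho * (cone_mass a b a' b' - cone_mass (i * a' + a) (i * b' + b) a' b') + e / 3)
     * Q%:R ^+ 2 by near: Q; exact: IH.
have h4 : cone_sum (i * a' + a) (i * b' + b) (i * a' + a + a') (i * b' + b + b') Q <=
   (rho * cone_mass (i * a' + a) (i * b' + b) (i * a' + a + a') (i * b' + b + b')
     + e / 3) * Q%:R ^+ 2 by near: Q; exact: Bd.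
have E := cone_mass_split abi.
rewrite !mulSn -!addnA ![(_ + (i * _ + _))%N]addnC.
move: h1 h2 h3 h4 E; set T0 := cone_sum a b a' b' Q.
set T1 := cone_sum (i * a' + a) _ a' b' Q; set T2 := cone_sum (_ + a') _ _ _ Q.
set T3 := cone_sum _ _ (_ + a') _ Q.
set m1 := cone_mass (i * a' + a) _ a' b'; set m2 := cone_mass (_ + a') _ _ _.
set m3 := cone_mass _ _ (_ + a') _; set m0 := cone_mass a b a' b'.
set q := Q%:R ^+ 2; move=> h1 h2 h3 h4 E; rewrite E in h3.
have -> : (rho * (m0 - m2) + e) * q =
   (rho * (m0 - (m3 + m2)) + e / 3) * q + (rho * m3 + e / 3) * q + e / 3 * q.
  by field.
lra.
Unshelve. all: by end_near. Qed.

(** Every cone contains a thin cone that carries at least [1 / N.+1] of its mass,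
    reached by [N] mediants next to its shorter side. On it the bound is
    [Cst / N], so that a constant [rho] valid for all cones improves to a
    weighted mean of [rho] and [Cst / N]. *)
Let contract (rho : R) (N : nat) : (0 < N)%N -> bounded_by rho -> Cst / N%:R <= rho ->
  bounded_by (Cst / N%:R + (rho - Cst / N%:R) * (N%:R / N.+1%:R)).
Proof.
move=> N0 Bd le a b a' b' ab e e0; have e2 : 0 < e / 2 by rewrite divr_gt0.
have [A0 A'0] := det1_pos ab.
have NN : N%:R + 1 != 0 :> R by rewrite natr1 pnatr_eq0.
(* x is the mass of the thin cone, y the mass of the whole cone *)
have key (x y q S T : R) : y <= x * N.+1%:R -> 0 <= q -> S <= (Cst / N%:R * x + e / 2) * q ->
    T <= S + (rho * (y - x) + e / 2) * q ->
    T <= ((Cst / N%:R + (rho - Cst / N%:R) * (N%:R / N.+1%:R)) * y + e) * q.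
  move=> yx q0 hS hT; apply: (le_trans hT); apply: (le_trans (lerD hS (lexx _))).
  rewrite -mulrDl ler_wpM2r//.
  have h : (rho - Cst / N%:R) * (y / N.+1%:R) <= (rho - Cst / N%:R) * x.
    by rewrite ler_wpM2l ?subr_ge0// ler_pdivrMr.
  have -> : (Cst / N%:R + (rho - Cst / N%:R) * (N%:R / N.+1%:R)) * y + e =
      rho * y - (rho - Cst / N%:R) * (y / N.+1%:R) + e.
    by rewrite -natr1; move: (Cst / N%:R) => c; field.
  move: h; move: (Cst / N%:R) (y / N.+1%:R) => c z h; lra.
have mass_le A A' B : (0 < A)%N -> (0 < A')%N -> (0 < B)%N ->
    (B <= N.+1 * A')%N -> (A * A')%:R^-1 <= (A * B)%:R^-1 * N.+1%:R :> R.
  move=> h1 h2 h3 h4; rewrite mulrC -ler_pdivrMr ?invr_gt0 ?ltr0n ?muln_gt0 ?h1// invrK.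
  rewrite mulrC ler_pdivrMr ?ltr0n ?muln_gt0 ?h1// -natrM ler_nat mulnCA leq_mul2l.
  by rewrite h4 orbT.
have [AA|/ltnW AA] := leqP (a + b) (a' + b').
  have NAA : (N * (a + b) <= N * (a' + b'))%N by rewrite leq_mul2l AA orbT.
  have thin : (N * (a + b) <= N * a + a' + (N * b + b'))%N.
    by rewrite addnACA -mulnDr leq_addr.
  apply: filterS2 (iter_right N Bd ab e2) (thin_right (det_right N ab) N0 thin e2).
  move=> Q hT hS; apply: key hS hT; last exact: exprn_ge0.
  apply: mass_le => //; rewrite addnACA -mulnDr.
    by rewrite addn_gt0; apply/orP; right.
  by rewrite mulSn addnC leq_add2l.
have NAA : (N * (a' + b') <= N * (a + b))%N by rewrite leq_mul2l AA orbT.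
have thin : (N * (a' + b') <= N * a' + a + (N * b' + b))%N.
  by rewrite addnACA -mulnDr leq_addr.
apply: filterS2 (iter_left N Bd ab e2) (thin_left (det_left N ab) N0 thin e2).
move=> Q hT hS; apply: key hS hT; last exact: exprn_ge0.
by rewrite /cone_mass ![(_ * (a' + b'))%N]mulnC;
  apply: mass_le => //; [move: A0 A'0; clear; nia|lia].
Qed.

Let bounded_mono (r r' : R) : r <= r' -> bounded_by r -> bounded_by r'.
Proof.
move=> rr Bd a b a' b' ab e e0; apply: filterS (Bd _ _ _ _ ab e e0) => Q h.
by apply: (le_trans h); rewrite ler_wpM2r ?exprn_ge0// lerD2r ler_wpM2r// invr_ge0.
Qed.

Let Cst_ge0 : 0 <= Cst. Proof. by rewrite mulr_ge0// sqr_ge0. Qed.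

Let bounded_iter (N i : nat) : (0 < N)%N ->
  bounded_by (Cst / N%:R + Cst * (N%:R / N.+1%:R) ^+ i).
Proof.
move=> N0; elim: i => [|i IH].
  apply: (@bounded_mono Cst); first by rewrite mulr1 lerDr divr_ge0.
  move=> a b a' b' ab e e0; near=> Q; apply: (le_trans (trivial_bound Q ab)).
  by rewrite ler_wpM2r ?exprn_ge0// lerDl ltW.
have := contract N0 IH; rewrite lerDl mulr_ge0 ?exprn_ge0 ?divr_ge0// => /(_ isT).
by rewrite addrAC subrr add0r -mulrA -exprSr.
Unshelve. all: by end_near. Qed.

Let bounded_small (e : R) : 0 < e -> bounded_by e.
Proof.
move=> e0; have e2 : 0 < e / 2 by rewrite divr_gt0.
pose N := (Num.truncn (Cst / (e / 2))).+1.
have N0 : 0 < N%:R :> R by rewrite ltr0n.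
have h1 : Cst / N%:R <= e / 2.
  rewrite ler_pdivrMr// mulrC -ler_pdivrMr//.
  exact/ltW/truncnS_gt.
pose z : R := N%:R / N.+1%:R.
have z1 : `|z| < 1.
  by rewrite ger0_norm ?divr_ge0// ltr_pdivrMr ?ltr0n// mul1r ltr_nat.
have /cvgrPdist_le/(_ _ e2) : (fun i => Cst * z ^+ i) @ \oo --> (Cst * 0 : R).
  by apply: cvgMr; exact: cvg_expr.
rewrite mulr0 => -[i _ /(_ i (leqnn i))]; rewrite /= sub0r normrN => h2.
apply: bounded_mono (@bounded_iter N i isT).
by have := ler_norm (Cst * z ^+ i); rewrite -/z; move: h1 h2; lra.
Qed.

(** The quadrant is the cone of the standard basis. *)
Lemma excess_small (e : R) : 0 < e -> \forall Q \near \oo,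
  \sum_(1 <= x < (R0 * Q).+1) \sum_(1 <= y < (R0 * Q).+1) excess Q x y
    <= e * Q%:R ^+ 2.
Proof.
move=> e0; have e2 : 0 < e / 2 by rewrite divr_gt0.
have ab : (1 * 1 = 0 * 0 + 1)%N by [].
apply: filterS (bounded_small e2 ab e2) => Q.
rewrite /cone_mass /cone_sum invr1 mulr1.
under eq_bigr do under eq_bigr do rewrite !muln1 !muln0 addn0 add0n.
by rewrite -splitr.
Qed.

End equidistribution.

(** * Counting pairs of integers *)

Section pair_count.
Context {R : realType}.
Implicit Types (P : nat -> nat -> bool) (D : R -> R -> bool).

Definition pair_count (n : nat) P : R :=
  \sum_(1 <= x < n.+1) \sum_(1 <= y < n.+1) (P x y)%:R.

Lemma pair_count_le n P P' : (forall x y, (0 < x)%N -> (0 < y)%N -> P x y -> P' x y) ->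
  pair_count n P <= pair_count n P'.
Proof.
move=> h; apply: ler_sum_nat => x /andP[x0 _]; apply: ler_sum_nat => y /andP[y0 _].
by rewrite ler_nat; case: (P x y) (h x y x0 y0) => // ->.
Qed.

Lemma eq_pair_count n P P' : (forall x y, (0 < x)%N -> (0 < y)%N -> P x y = P' x y) ->
  pair_count n P = pair_count n P'.
Proof.
move=> h; apply: eq_big_nat => x /andP[x0 _]; apply: eq_big_nat => y /andP[y0 _].
by rewrite h.
Qed.

Lemma pair_count_true n : pair_count n (fun _ _ => true) = n%:R ^+ 2.
Proof.
by rewrite /pair_count !sumr_const_nat subSS subn0 expr2 -[LHS]mulr_natr.
Qed.

Lemma pair_count_split n P P' : pair_count n P =
  pair_count n (fun x y => P x y && P' x y) +
  pair_count n (fun x y => P x y && ~~ P' x y).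
Proof.
rewrite -big_split; apply: eq_bigr => x _; rewrite -big_split; apply: eq_bigr => y _.
by rewrite /= -natrD; case: (P x y); case: (P' x y).
Qed.

Lemma pair_count_multiples p n P : (0 < p)%N ->
  pair_count n (fun x y => P x y && ((p %| x) && (p %| y))%N) =
  pair_count (n %/ p) (fun x y => P (p * x)%N (p * y)%N).
Proof.
move=> p0; rewrite /pair_count -(@sum_multiples _
  (fun x => \sum_(1 <= y < (n %/ p).+1) (P x (p * y)%N)%:R))// [RHS]big_mkcond.
apply: eq_bigr => x _; case: (boolP (p %| x)%N) => px; last first.
  by rewrite big1// => y _; rewrite andbF.
rewrite -(@sum_multiples _ (fun y => (P x y)%:R))// [RHS]big_mkcond.
by apply: eq_bigr => y _; case: (p %| y)%N; rewrite /= ?andbT ?andbF.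
Qed.

Definition pair_list (n : nat) P : seq (nat * nat) :=
  [seq z <- [seq (x, y) | x <- iota 1 n, y <- iota 1 n] | P z.1 z.2].

Lemma size_pair_list n P : (size (pair_list n P))%:R = pair_count n P.
Proof.
rewrite size_filter -sum1_count natr_sum big_mkcond big_allpairs_dep /=.
rewrite /pair_count /index_iota subn1 /=; apply: eq_bigr => x _.
by apply: eq_bigr => y _; case: (P x y).
Qed.

Lemma uniq_pair_list n P : uniq (pair_list n P).
Proof.
by apply/filter_uniq/allpairs_uniq; rewrite ?iota_uniq// => -[? ?] [? ?] _ _ [-> ->].
Qed.

Lemma mem_pair_list n P x y : ((x, y) \in pair_list n P) =
  [&& (0 < x <= n)%N, (0 < y <= n)%N & P x y].
Proof.
rewrite mem_filter /= andbC andbA; congr (_ && _).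
apply/allpairsP/andP => [[[x' y'] /= [h1 h2 [-> ->]]]|[h1 h2]].
  by move: h1 h2; rewrite !mem_iota !add1n !ltnS.
by exists (x, y) => /=; rewrite !mem_iota !add1n !ltnS.
Qed.

End pair_count.

(** * Two-sided equidistribution *)
Section equidistribution_two_sided.
Context {R : realType}.
Variables (R0 : nat) (D : R -> R -> bool).
Hypothesis D_bounded : forall X Y, D X Y -> (0 < X <= R0%:R) && (0 < Y <= R0%:R).
Hypothesis D_convex : forall X Y X' Y' t, D X Y -> D X' Y' -> 0 <= t <= 1 ->
  D ((1 - t) * X + t * X') ((1 - t) * Y + t * Y').

Definition coprime_in (Q x y : nat) : bool :=
  coprime x y && D (x%:R / Q%:R) (y%:R / Q%:R).

Let slope_count (Q : nat) (al be : R) : R :=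
  pair_count (R0 * Q) (fun x y => coprime_in Q x y && (al <= slope x y < be)).

Let slope_count_upper (al be : R) : 0 <= al -> al <= be -> be <= 1 ->
  forall e, 0 < e -> \forall Q \near \oo,
  slope_count Q al be <=
    (be - al) * pair_count (R0 * Q) (coprime_in Q) + e * Q%:R ^+ 2.
Proof.
move=> al0 albe be1 e e0.
apply: filterS (excess_small al0 albe be1 D_bounded D_convex e0) => Q.
rewrite -lerBlDl; congr (_ <= _).
rewrite /slope_count /pair_count mulr_sumr -sumrB; apply: eq_bigr => x _.
rewrite mulr_sumr -sumrB; apply: eq_bigr => y _.
rewrite /excess /coprime_in; case: (coprime x y && _) => /=.
  by rewrite mulr1.
by rewrite mulr0 subrr.
Qed.

Let slope_count_split Q (al be : R) : 0 <= al -> al <= be -> be <= 1 ->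
  pair_count (R0 * Q) (coprime_in Q) =
  slope_count Q 0 al + slope_count Q al be + slope_count Q be 1.
Proof.
move=> al0 albe be1; rewrite /slope_count /pair_count -!big_split.
apply: eq_big_nat => x /andP[x0 _]; rewrite /= -!big_split.
apply: eq_big_nat => y /andP[y0 _] /=; rewrite -!natrD.
case C: (coprime_in Q x y) => //=.
have /andP[h0 h1] : 0 <= (slope x y : R) < 1 by case/andP: C => cxy _; exact: slope_itv.
rewrite h0 h1 andbT /=; have [hal|hal] := ltP (slope x y) al.
  by rewrite leNgt (lt_le_trans hal albe).
by rewrite leNgt; case: ltP.
Qed.

(** The intervals [0, al), [al, be), [be, 1) partition the slopes, so the lower
    bound for the second follows from the upper bounds for the other two. *)
Lemma equidistribution (al be : R) : 0 <= al -> al <= be -> be <= 1 ->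
  forall e, 0 < e -> \forall Q \near \oo,
  `|pair_count (R0 * Q) (fun x y => coprime_in Q x y && (al <= slope x y < be))
    - (be - al) * pair_count (R0 * Q) (coprime_in Q)| <= e * Q%:R ^+ 2.
Proof.
move=> al0 albe be1 e e0; have e2 : 0 < e / 2 by rewrite divr_gt0.
have bee : be <= be by [].
near=> Q.
have h1 : slope_count Q 0 al <=
    (al - 0) * pair_count (R0 * Q) (coprime_in Q) + e / 2 * Q%:R ^+ 2.
  by near: Q; apply: slope_count_upper => //; exact: le_trans be1.
have h2 : slope_count Q al be <=
    (be - al) * pair_count (R0 * Q) (coprime_in Q) + e * Q%:R ^+ 2.
  by near: Q; apply: slope_count_upper.
have h3 : slope_count Q be 1 <=
    (1 - be) * pair_count (R0 * Q) (coprime_in Q) + e / 2 * Q%:R ^+ 2.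
  by near: Q; apply: slope_count_upper => //; exact: le_trans albe.
have := slope_count_split Q al0 albe be1.
move: h1 h2 h3; rewrite /slope_count.
set c := pair_count _ (coprime_in Q); set q := Q%:R ^+ 2.
move=> h1 h2 h3 E; rewrite ler_norml; apply/andP; split; last by rewrite lerBlDl.
move: h1 h3 E; set c1 := pair_count _ _; set c3 := pair_count _ _; set c2 := pair_count _ _.
lra.
Unshelve. all: by end_near. Qed.

End equidistribution_two_sided.

(** * The density of coprime pairs *)
Section coprime_density.
Context {R : realType}.

Definition euler_factor (p : nat) : R := 1 - (p%:R ^+ 2)^-1.
Definition euler_prod (P : nat) : R := \prod_(1 <= p < P.+1 | prime p) euler_factor p.

Lemma euler_factor_itv p : (0 < p)%N -> 0 <= euler_factor p <= 1.
Proof.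
move=> p0; rewrite subr_ge0 gerBl invr_ge0 exprn_ge0// andbT.
by rewrite invf_le1 ?exprn_gt0 ?ltr0n// exprn_ege1// ler1n.
Qed.

Lemma euler_prod_nonincr : nonincreasing_seq euler_prod.
Proof.
apply/nonincreasing_seqP => P.
have p0 : 0 <= euler_prod P.
  rewrite /euler_prod big_nat_cond; apply: prodr_ge0 => p /andP[/andP[p0 _] _].
  by have /andP[] := euler_factor_itv p0.
rewrite {1}/euler_prod big_mkcond big_nat_recr//= -big_mkcond -/(euler_prod P).
case: ifP => _; last by rewrite mulr1.
by rewrite -[leRHS]mulr1 ler_wpM2l//; have /andP[] := euler_factor_itv (ltn0Sn P).
Qed.

(** Compare with the product over all integers from 2 on, which telescopes:
    the product of [1 - n ^- 2] for [2 <= n <= P.+1] is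
    [P.+2 / (2 * P.+1)]. *)
Lemma euler_prod_lower P : 1 / 2 <= euler_prod P.
Proof.
suff H : (P.+2%:R / (2 * P.+1%:R)) <= euler_prod P.+1.
  apply: le_trans (euler_prod_nonincr (leqnSn P)); apply: le_trans H.
  by rewrite ler_pdivlMr ?mulr_gt0 ?ltr0n// mulrA mul1r mulVf// mul1r ler_nat.
elim: P => [|P IH].
  by rewrite /euler_prod big_mkcond big_nat1 /= mulr1 divff// pnatr_eq0.
rewrite /euler_prod big_mkcond big_nat_recr//= -big_mkcond -/(euler_prod P.+1).
have /andP[f0 f1] := euler_factor_itv (ltn0Sn P.+1).
have h0 : 0 <= P.+2%:R / (2 * P.+1%:R) :> R by rewrite divr_ge0 ?mulr_ge0.
apply: (@le_trans _ _ (euler_prod P.+1 * euler_factor P.+2)); last first.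
  case: ifP => _ //; rewrite ler_wpM2l//; exact: le_trans IH.
apply: le_trans (ler_wpM2r f0 IH).
rewrite le_eqVlt; apply/orP; left; apply/eqP; rewrite /euler_factor.
have -> : P.+3%:R = P.+1%:R + 2 :> R by ring.
have -> : P.+2%:R = P.+1%:R + 1 :> R by ring.
have h1 : P.+1%:R != 0 :> R by rewrite pnatr_eq0.
have h2 : P.+1%:R + 1 != 0 :> R by rewrite natr1 pnatr_eq0.
by move: h1 h2; move: (P.+1%:R) => z h1 h2; field; rewrite h1 h2.
Qed.

(** [1 / d ^ 2 <= 1 / (d - 1) - 1 / d] telescopes. *)
Lemma tail_inv_sqr (P n : nat) : (0 < P)%N ->
  \sum_(P.+1 <= d < n.+1) (d%:R ^+ 2)^-1 <= P%:R^-1 :> R.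
Proof.
move=> P0.
suff H k : \sum_(P.+1 <= d < (P + k).+1) (d%:R ^+ 2)^-1 <= P%:R^-1 - (P + k)%:R^-1 :> R.
  have [Pn|nP] := leqP P n.
    rewrite -(subnKC Pn); apply: (le_trans (H _)).
    by rewrite gerBl invr_ge0.
  by rewrite big_geq ?invr_ge0// ltnW.
elim: k => [|k IH]; first by rewrite addn0 big_geq// subrr.
rewrite addnS big_nat_recr ?ltnS ?leq_addr//=; apply: (le_trans (lerD IH (lexx _))).
set m := (P + k)%N; have m0 : (0 < m)%N by rewrite addn_gt0 P0.
have h1 : m%:R != 0 :> R by rewrite pnatr_eq0 -lt0n.
have h2 : m%:R + 1 != 0 :> R by rewrite natr1 pnatr_eq0.
have h3 : 0 < m%:R :> R by rewrite ltr0n.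
rewrite -lerBrDl -subr_ge0 -natr1.
have -> : P%:R^-1 - (m%:R + 1)^-1 - (P%:R^-1 - m%:R^-1) - ((m%:R + 1) ^+ 2)^-1 =
  (m%:R * (m%:R + 1) ^+ 2)^-1 :> R.
  by move: h1 h2; move: (m%:R) (P%:R^-1) => z c h1 h2; field; rewrite h1 h2.
by rewrite invr_ge0 mulr_ge0// exprn_ge0.
Qed.

(* Real scales t are needed because sieving out p replaces t by t / p; B is any
   bound on the coordinates, since its quotient by p changes along with t. *)
Variables (R0 : nat) (D : R -> R -> bool) (area : R).
Hypothesis lattice_count : forall e, 0 < e -> exists T, forall t B, T <= t ->
  (forall x : nat, x%:R <= R0%:R * t -> (x <= B)%N) ->
  `|pair_count B (fun x y => D (x%:R / t) (y%:R / t)) - t ^+ 2 * area| <= e * t ^+ 2.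

Let no_common (ps : seq nat) (x y : nat) : bool :=
  all (fun p => ~~ ((p %| x) && (p %| y)))%N ps.

(** The sieve in dimension two: the pairs divisible by a new prime [p] correspond
    to all the pairs of the region scaled by [t / p], so [p] multiplies the
    density by [1 - p ^- 2]. *)
Let sieve_pairs (ps : seq nat) : all prime ps -> uniq ps ->
  forall e, 0 < e -> exists T, forall t B, T <= t ->
  (forall x : nat, x%:R <= R0%:R * t -> (x <= B)%N) ->
  `|pair_count B (fun x y => D (x%:R / t) (y%:R / t) && no_common ps x y)
     - t ^+ 2 * (\prod_(p <- ps) euler_factor p * area)| <= e * t ^+ 2.
Proof.
elim: ps => [_ _|p ps IH /= /andP[pp pps] /andP[pnps ups]] e e0.
  have [T hT] := lattice_count e0; exists T => t B tT hB.
  rewrite big_nil mul1r; have := hT t B tT hB; congr (`|_ - _| <= _).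
  by apply: eq_pair_count => x y _ _; rewrite andbT.
have e2 : 0 < e / 2 by rewrite divr_gt0.
have [T hT] := IH pps ups _ e2; exists (Num.max 1 (p%:R * `|T|)) => t B.
rewrite ge_max => /andP[t1 tT] hB.
have p1 : 1 <= p%:R :> R by rewrite ler1n prime_gt0.
have p0 : 0 < p%:R :> R by rewrite (lt_le_trans _ p1).
have t0 : 0 < t by rewrite (lt_le_trans _ t1).
have tT' : T <= t by rewrite (le_trans (ler_norm T))// (le_trans _ tT)// ler_peMl.
have tT'' : T <= t / p%:R.
  by rewrite ler_pdivlMr// (le_trans _ tT)// mulrC ler_wpM2l ?ler_norm// ltW.
have hB' (x : nat) : x%:R <= R0%:R * (t / p%:R) -> (x <= B %/ p)%N.
  rewrite mulrA ler_pdivlMr// -natrM => /hB.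
  by rewrite leq_divRL// prime_gt0.
have h1 := hT t B tT' hB; have h2 := hT _ _ tT'' hB'.
have E : pair_count B (fun x y => D (x%:R / t) (y%:R / t) && no_common ps x y) =
   pair_count B (fun x y => D (x%:R / t) (y%:R / t) && no_common (p :: ps) x y) +
   pair_count (B %/ p) (fun x y => D (x%:R / (t / p%:R)) (y%:R / (t / p%:R)) &&
      no_common ps x y) :> R.
  rewrite (pair_count_split _ _ (fun x y => (p %| x) && (p %| y))%N) addrC.
  congr (_ + _).
    apply: eq_pair_count => x y _ _; rewrite /no_common /= -andbA.
    by congr (_ && _); rewrite andbC.
  rewrite pair_count_multiples ?prime_gt0//; apply: eq_pair_count => x y _ _.
  have scale z : (p * z)%:R / t = z%:R / (t / p%:R) :> R.
    by rewrite natrM invf_div mulrA [z%:R * _]mulrC.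
  rewrite !scale.
  congr (_ && _); rewrite /no_common; apply: eq_in_all => q qps.
  have pq : prime q by exact: (allP pps).
  rewrite !Euclid_dvdM// dvdn_prime2//.
  by case: eqP => //= qp; move: pnps; rewrite -qp qps.
move: E h1 h2; rewrite big_cons.
set A := pair_count _ _; set A' := pair_count _ _; set A'' := pair_count _ _.
set m := \prod_(_ <- _) _ => E h1 h2.
have -> : A' - t ^+ 2 * (euler_factor p * m * area) =
    (A - t ^+ 2 * (m * area)) - (A'' - (t / p%:R) ^+ 2 * (m * area)).
  by rewrite E /euler_factor; field; rewrite gt_eqF.
apply: (le_trans (ler_normB _ _)).
apply: (le_trans (lerD h1 h2)).
rewrite [X in _ <= X * _](splitr e) mulrDl lerD2l ler_wpM2l ?(ltW e2)//.
rewrite ler_sqr ?nnegrE ?divr_ge0 ?(ltW t0)//.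
by rewrite ler_pdivrMr// ler_peMr// ltW.
Qed.

Let primes_upto P := [seq p <- iota 1 P | prime p].

Let no_common_upto P n x y : (0 < x)%N -> (0 < y)%N -> (x <= n)%N ->
  (no_common (primes_upto P) x y)%:R <=
  (coprime x y)%:R + \sum_(P.+1 <= d < n.+1) ((d %| x) && (d %| y))%N%:R :> R.
Proof.
move=> x0 y0 xn; have s0 : 0 <= \sum_(P.+1 <= d < n.+1) ((d %| x) && (d %| y))%N%:R :> R.
  exact: sumr_ge0.
have [_|ncop] := boolP (coprime x y).
  by rewrite -[leLHS]addr0 lerD// ler_nat leq_b1.
have g1 : (1 < gcdn x y)%N.
  by rewrite ltn_neqAle eq_sym ncop gcdn_gt0 x0.
set p := pdiv (gcdn x y); have pp : prime p by exact: pdiv_prime.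
have px : (p %| x)%N by rewrite (dvdn_trans (pdiv_dvd _))// dvdn_gcdl.
have py : (p %| y)%N by rewrite (dvdn_trans (pdiv_dvd _))// dvdn_gcdr.
have [pP|Pp] := leqP p P.
  rewrite (_ : no_common _ _ _ = false) ?addr_ge0//.
  apply/negbTE/allPn; exists p; last by rewrite px py.
  by rewrite mem_filter pp mem_iota add1n ltnS pP prime_gt0.
have pn : (p <= n)%N by rewrite (leq_trans _ xn)// dvdn_leq.
rewrite add0r (bigD1_seq p) ?iota_uniq ?mem_index_iota ?ltnS ?Pp//= px py.
by rewrite -[leLHS]addr0 lerD// ?ler_nat ?leq_b1// sumr_ge0.
Qed.

Let coprime_no_common P x y : coprime x y -> no_common (primes_upto P) x y.
Proof.
move=> cxy; apply/allP => p; rewrite mem_filter => /andP[pp _].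
apply/negP => /andP[px py].
have : (p %| gcdn x y)%N by rewrite dvdn_gcd px.
by rewrite (eqP cxy) dvdn1; case: eqP pp => // ->.
Qed.

(** A pair that survives the primes up to [P] and is not coprime has a common
    divisor [d > P]; there are at most [(n / d) ^ 2] such pairs for each [d]. *)
Let coprime_tail P n (E : nat -> nat -> bool) : (0 < P)%N ->
  @pair_count R n (fun x y => coprime x y && E x y) <=
    @pair_count R n (fun x y => E x y && no_common (primes_upto P) x y) <=
    @pair_count R n (fun x y => coprime x y && E x y) + n%:R ^+ 2 / P%:R.
Proof.
move=> P0; apply/andP; split.
  apply: pair_count_le => x y _ _ /andP[cxy ->].
  exact: coprime_no_common.
apply: (@le_trans _ _ (@pair_count R n (fun x y => coprime x y && E x y) +
   \sum_(P.+1 <= d < n.+1) @pair_count R n (fun x y => true && ((d %| x)%N && (d %| y)%N)))).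
  have -> : \sum_(P.+1 <= d < n.+1) @pair_count R n
      (fun x y => true && ((d %| x)%N && (d %| y)%N)) =
    \sum_(1 <= x < n.+1) \sum_(1 <= y < n.+1)
      \sum_(P.+1 <= d < n.+1) ((d %| x)%N && (d %| y)%N)%:R.
    by rewrite /pair_count exchange_big; apply: eq_bigr => x _; rewrite exchange_big.
  rewrite /pair_count -big_split; apply: ler_sum_nat => x /andP[x0 xn].
  rewrite /= -big_split; apply: ler_sum_nat => y /andP[y0 yn] /=.
  case: (E x y) => /=; last by rewrite andbF add0r sumr_ge0.
  by rewrite andbT; apply: no_common_upto.
rewrite lerD2l; apply: le_trans (ler_wpM2l _ (tail_inv_sqr n P0)); last first.
  exact: exprn_ge0.
rewrite mulr_sumr; apply: ler_sum_nat => d /andP[Pd _].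
have d0 : (0 < d)%N by exact: leq_trans Pd.
rewrite pair_count_multiples// pair_count_true -exprVn -exprMn.
rewrite ler_sqr ?nnegrE ?divr_ge0// ler_pdivlMr ?ltr0n// -natrM ler_nat.
exact: leq_trunc_div.
Qed.

(** The value is the inverse of [zeta(2)]; only its positivity matters below. *)
Definition coprime_const : R := lim (euler_prod @ \oo).

Let euler_prod_cvg : euler_prod @ \oo --> coprime_const.
Proof.
apply: nonincreasing_is_cvgn; first exact: euler_prod_nonincr.
by exists (1 / 2) => _ [P _ <-]; exact: euler_prod_lower.
Qed.

Lemma coprime_const_gt0 : 0 < coprime_const.
Proof.
apply: (@lt_le_trans _ _ (1 / 2)); first by rewrite divr_gt0.
apply: limr_ge; first exact: (cvgP _ euler_prod_cvg).
by near=> P; exact: euler_prod_lower.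
Unshelve. all: by end_near. Qed.

Lemma coprime_density e : 0 < e -> \forall Q \near \oo,
  `|pair_count (R0 * Q) (coprime_in D Q) - Q%:R ^+ 2 * (coprime_const * area)|
    <= e * Q%:R ^+ 2.
Proof.
move=> e0; have e3 : 0 < e / 3 by rewrite divr_gt0.
have ea : 0 < e / 3 / (`|area| + 1) by rewrite divr_gt0// ltr_wpDl.
near \oo => P.
have P0 : (0 < P)%N by near: P; exact: nbhs_infty_gt.
have h1 : R0%:R ^+ 2 / P%:R <= e / 3.
  by rewrite ler_pdivrMr ?ltr0n//; near: P; exact: near_scale.
have h2 : `|coprime_const - euler_prod P| <= e / 3 / (`|area| + 1).
  by near: P; move/cvgrPdist_le : euler_prod_cvg; apply.
have ups : uniq (primes_upto P) by rewrite filter_uniq ?iota_uniq.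
have pps : all prime (primes_upto P) by apply/allP => p; rewrite mem_filter => /andP[].
have [T hT] := sieve_pairs pps ups e3.
near=> Q.
have TQ : T <= Q%:R.
  by rewrite -[leRHS]mul1r; near: Q; exact: near_scale.
have hB (x : nat) : x%:R <= R0%:R * Q%:R :> R -> (x <= R0 * Q)%N.
  by rewrite -natrM ler_nat.
have h3 := hT _ _ TQ hB.
have /andP[h4 h5] := @coprime_tail P (R0 * Q) (fun x y => D (x%:R / Q%:R) (y%:R / Q%:R)) P0.
have h6 : `|coprime_const * area - euler_prod P * area| <= e / 3.
  rewrite -mulrBl normrM (le_trans (ler_wpM2r _ h2))//.
  by rewrite mulrAC ler_pdivrMr ?ltr_wpDl// (ler_wpM2l (ltW e3))// lerDl.
have h7 : (R0 * Q)%:R ^+ 2 / P%:R <= e / 3 * Q%:R ^+ 2.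
  by rewrite natrM exprMn mulrAC ler_wpM2r// exprn_ge0.
have prodE : \prod_(p <- primes_upto P) euler_factor p = euler_prod P.
  by rewrite big_filter /euler_prod /index_iota subn1.
move: h3; rewrite prodE.
have q0 : 0 <= Q%:R ^+ 2 :> R by rewrite exprn_ge0.
move: h4 h5 h7; rewrite /coprime_in.
set A := pair_count _ _; set A' := pair_count _ _; set q := Q%:R ^+ 2 in q0 *.
set r := _ / P%:R => h4 h5 h7 h3.
have h8 : `|q * (coprime_const * area) - q * (euler_prod P * area)| <= e / 3 * q.
  by rewrite -mulrBr normrM (ger0_norm q0) [leRHS]mulrC; exact: ler_wpM2l.
move: h3 h8; rewrite !ler_norml => /andP[h31 h32] /andP[h81 h82].
by apply/andP; split; lra.
Unshelve. all: by end_near. Qed.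

End coprime_density.

(** * Rectangles cut by an antidiagonal *)

Section region.
Context {R : realType}.

(** The traces of boxes on [Omega w] are of this form, with bounds that depend on
    [w]; five independent parameters allow each side to be moved separately. *)
Definition region (a b c d w X Y : R) : bool :=
  [&& a < X, X <= b, c < Y, Y <= d & w < X + Y].

Definition regionS (a b c d w : R) : set (plane R) :=
  [set z : R * R | region a b c d w z.1 z.2].

Lemma region_bounded (R0 : nat) (a b c d w : R) : 0 <= a -> 0 <= c ->
  b <= R0%:R -> d <= R0%:R ->
  forall X Y, region a b c d w X Y -> (0 < X <= R0%:R) && (0 < Y <= R0%:R).
Proof.
move=> a0 c0 bR dR X Y /and5P[h1 h2 h3 h4 _].
by rewrite (le_lt_trans a0 h1) (le_trans h2)// (le_lt_trans c0 h3) (le_trans h4).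
Qed.

Lemma region_convex (a b c d w : R) X Y X' Y' t :
  region a b c d w X Y -> region a b c d w X' Y' -> 0 <= t <= 1 ->
  region a b c d w ((1 - t) * X + t * X') ((1 - t) * Y + t * Y').
Proof.
move=> /and5P[h1 h2 h3 h4 h5] /and5P[k1 k2 k3 k4 k5] /andP[t0 t1].
have t1' : 0 <= 1 - t by rewrite subr_ge0.
have lt_comb (p q r : R) : p < q -> p < r -> p < (1 - t) * q + t * r.
  move=> pq pr; rewrite -subr_gt0.
  have -> : (1 - t) * q + t * r - p = (1 - t) * (q - p) + t * (r - p) by ring.
  have [->|tn0] := eqVneq t 0; first by rewrite subr0 mul1r mul0r addr0 subr_gt0.
  have t0' : 0 < t by rewrite lt_def tn0.
  by rewrite ltr_wpDl ?mulr_ge0 ?mulr_gt0 ?subr_gt0// ltW ?subr_gt0.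
have le_comb (p q r : R) : q <= p -> r <= p -> (1 - t) * q + t * r <= p.
  move=> pq pr; have -> : p = (1 - t) * p + t * p by ring.
  by rewrite lerD// ler_wpM2l.
apply/and5P; split; [exact: lt_comb|exact: le_comb|exact: lt_comb|exact: le_comb|].
have -> : (1 - t) * X + t * X' + ((1 - t) * Y + t * Y') =
  (1 - t) * (X + Y) + t * (X' + Y') by ring.
exact: lt_comb.
Qed.

Lemma measurable_fst_plus_snd :
  measurable_fun [set: plane R] (fun z : plane R => (z.1 : R) + (z.2 : R)).
Proof.
by apply: measurable_funD; [exact: measurable_fst|exact: measurable_snd].
Qed.

Lemma measurable_rect (i j : interval R) :
  measurable ([set` i] `*` [set` j] : set (plane R)).
Proof. by apply: measurableX; exact: measurable_itv. Qed.

Lemma measurable_antidiag (i : interval R) :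
  measurable ([set z : R * R | (z.1 + z.2) \in i] : set (plane R)).
Proof.
rewrite -[X in measurable X]setTI.
exact: (measurable_fst_plus_snd measurableT (measurable_itv i)).
Qed.

Lemma regionE (a b c d w : R) : regionS a b c d w =
  (`]a, b] `*` `]c, d]) `&` [set z : R * R | (z.1 + z.2) \in `]w, +oo[].
Proof.
apply/seteqP; split => -[X Y]; rewrite /regionS /region /= !in_itv /= andbT.
  by move=> /and5P[-> -> -> -> ->].
by move=> [[/andP[-> ->] /andP[-> ->]] ->].
Qed.

Lemma measurable_region (a b c d w : R) : measurable (regionS a b c d w).
Proof.
by rewrite regionE; apply: measurableI; [exact: measurable_rect|exact: measurable_antidiag].
Qed.

Lemma leb2_rect (a b c d : R) : a <= b -> c <= d ->
  leb2 (`]a, b] `*` `]c, d] : set (plane R)) = ((b - a) * (d - c))%:E.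
Proof.
move=> ab cd; rewrite /leb2 product_measure1E//=.
rewrite !lebesgue_measure_itv /= !lte_fin EFinM !EFinB.
case: ltgtP ab => // [ab _|<- _]; last by rewrite subee// !mul0e.
by case: ltgtP cd => // -> _; rewrite subee// mule0.
Qed.

Definition antidiag_strip (M w h : R) : set (plane R) :=
  [set z : R * R | z.1 \in `]- M, M] /\ (z.1 + z.2) \in `](w - h), w]].

Lemma measurable_antidiag_strip M w h : measurable (antidiag_strip M w h).
Proof.
rewrite (_ : antidiag_strip M w h = (`]- M, M] `*` setT) `&`
  [set z : R * R | (z.1 + z.2) \in `](w - h), w]]).
  apply: measurableI; last exact: measurable_antidiag.
  by apply: measurableX => //; exact: measurable_itv.
by apply/seteqP; split => z; rewrite /antidiag_strip /=; [case|case=> [[]]].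
Qed.

(** Cavalieri: every vertical section of the strip has length [h]. *)
Lemma leb2_antidiag_strip (M w h : R) : 0 <= M -> 0 <= h ->
  (leb2 (antidiag_strip M w h) <= (2 * M * h)%:E)%E.
Proof.
move=> M0 h0.
have -> : leb2 (antidiag_strip M w h) =
  (\int[lebesgue_measure]_x (lebesgue_measure (xsection (antidiag_strip M w h) x)))%E by [].
pose g (x : R) : \bar R := (h%:E * (\1_(`]- M, M]%classic : set R) x)%:E)%E.
apply: (@le_trans _ _ (\int[lebesgue_measure]_x (g x))%E); last first.
  rewrite ge0_integralZl_EFin//; last first.
    by apply/measurable_EFinP; exact: measurable_indic.
  rewrite integral_indic//= setIT lebesgue_measure_itv/= lte_fin.
  case: ifP => _; last by rewrite mule0 lee_fin !mulr_ge0.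
  by rewrite -EFinB -EFinM lee_fin opprK; lra.
apply: ge0_le_integral => //.
- apply: measurable_fun_xsection; exact: measurable_antidiag_strip.
- apply/measurable_EFinP/measurable_funM; first exact: measurable_cst.
  exact: measurable_indic.
move=> x _; rewrite /g indicE; have [xM|xM] := boolP (x \in `]- M, M]).
  rewrite mem_set// mule1.
  rewrite (_ : xsection _ x = `](w - h - x), (w - x)]%classic); last first.
    apply/seteqP; split => y; rewrite /xsection /antidiag_strip /= inE /= !in_itv /=.
      by move=> [_ /andP[h1 h2]]; rewrite ltrBlDl h1 lerBrDl h2.
    by rewrite ltrBlDl lerBrDl => ->; move: xM; rewrite in_itv.
  rewrite lebesgue_measure_itv/= lte_fin; case: ifP => _; last by rewrite lee_fin.
  by rewrite -EFinB lee_fin; lra.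
rewrite (_ : xsection _ x = set0) ?measure0 ?mule_ge0 ?lee_fin//.
apply/seteqP; split => y //; rewrite /xsection /antidiag_strip /= inE /= => -[h1].
by rewrite h1 in xM.
Qed.

Definition area (a b c d w : R) : R := fine (leb2 (regionS a b c d w)).

Lemma leb2_region_fin (a b c d w : R) : leb2 (regionS a b c d w) \is a fin_num.
Proof.
rewrite ge0_fin_numE ?measure_ge0//.
apply: (@le_lt_trans _ _ (leb2 (`]a, Num.max a b] `*` `]c, Num.max c d] : set (plane R)))).
  apply: le_measure; rewrite ?inE; [exact: measurable_region|exact: measurable_rect|].
  move=> z /and5P[h1 h2 h3 h4 _]; split; rewrite /= in_itv /= ?h1 ?h3 le_max.
    by rewrite h2 orbT.
  by rewrite h4 orbT.
by rewrite leb2_rect ?le_max ?lexx// ltry.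
Qed.

Lemma areaE (a b c d w : R) : leb2 (regionS a b c d w) = (area a b c d w)%:E.
Proof. by rewrite /area fineK// leb2_region_fin. Qed.

Lemma area_ge0 a b c d w : 0 <= area a b c d w.
Proof. by rewrite /area fine_ge0. Qed.

(** The enlarged region is covered by the original one and five strips, one for
    each side, of area at most [2 * M * h]. *)
Lemma area_enlarge (M a b c d w h : R) : 0 <= M -> 0 <= h ->
  - M <= a - h -> b + h <= M -> - M <= c - h -> d + h <= M ->
  area (a - h) (b + h) (c - h) (d + h) (w - h) <= area a b c d w + 10 * M * h.
Proof.
move=> M0 h0 Ma Mb Mc Md.
pose S1 : set (plane R) := `]a - h, a] `*` `]- M, M].
pose S2 : set (plane R) := `]b, b + h] `*` `]- M, M].
pose S3 : set (plane R) := `]- M, M] `*` `]c - h, c].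
pose S4 : set (plane R) := `]- M, M] `*` `]d, d + h].
pose S5 := antidiag_strip M w h.
have mS1 : measurable S1 by exact: measurable_rect.
have mS2 : measurable S2 by exact: measurable_rect.
have mS3 : measurable S3 by exact: measurable_rect.
have mS4 : measurable S4 by exact: measurable_rect.
have mS5 : measurable S5 by exact: measurable_antidiag_strip.
have m0 := measurable_region a b c d w.
rewrite -lee_fin EFinD -2!areaE.
apply: (@le_trans _ _ (leb2 (regionS a b c d w `|` S1 `|` S2 `|` S3 `|` S4 `|` S5))).
  apply: le_measure; rewrite ?inE; first exact: measurable_region.
    by do !apply: measurableU.
  move=> [X Y] /and5P[/= h1 h2 h3 h4 h5].
  have XM : X \in `]- M, M] by rewrite in_itv /= (le_lt_trans Ma h1) (le_trans h2).
  have YM : Y \in `]- M, M] by rewrite in_itv /= (le_lt_trans Mc h3) (le_trans h4).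
  have [k5|k5] := leP (X + Y) w.
    by right; split=> //=; rewrite in_itv /= h5 k5.
  have [k1|k1] := leP X a.
    by do 4 left; right; split=> //=; rewrite in_itv /= h1 k1.
  have [k2|k2] := leP X b; last first.
    by do 3 left; right; split=> //=; rewrite in_itv /= h2 k2.
  have [k3|k3] := leP Y c.
    by do 2 left; right; split=> //=; rewrite in_itv /= h3 k3.
  have [k4|k4] := leP Y d; last first.
    by left; right; split=> //=; rewrite in_itv /= h4 k4.
  by do 5 left; rewrite /regionS /region /= k1 k2 k3 k4 k5.
have strip (A B : set (plane R)) (k : R) : measurable A -> measurable B ->
    (leb2 B <= (2 * M * h)%:E)%E -> (leb2 A <= leb2 (regionS a b c d w) + k%:E)%E ->
    (leb2 (A `|` B) <= leb2 (regionS a b c d w) + (k + 2 * M * h)%:E)%E.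
  move=> mA mB hB hA; apply: (le_trans (measureU2 _ mA mB)).
  by rewrite EFinD [leRHS]addeA; exact: leeD.
have MM : M - - M = 2 * M by ring.
apply: (@le_trans _ _ (leb2 (regionS a b c d w) +
    (0 + 2 * M * h + 2 * M * h + 2 * M * h + 2 * M * h + 2 * M * h)%R%:E)%E); last first.
  by rewrite leeD2l// lee_fin; lra.
have s1 (x : R) : x - (x - h) = h by ring.
have s2 (x : R) : x + h - x = h by ring.
have r (x y x' y' : R) : x <= y -> x' <= y' -> (y - x) * (y' - x') = 2 * M * h ->
    (leb2 (`]x, y] `*` `]x', y'] : set (plane R)) <= (2 * M * h)%:E)%E.
  by move=> h1 h2 <-; rewrite leb2_rect.
have MlM : - M <= M by rewrite (le_trans _ M0)// oppr_le0.
apply: (strip) => //; [by do !apply: measurableU|exact: leb2_antidiag_strip|].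
apply: (strip) => //; [by do !apply: measurableU|by apply: r; rewrite ?lerDl// MM s2|].
apply: (strip) => //; [by do !apply: measurableU|by apply: r; rewrite ?gerBl// MM s1|].
apply: (strip) => //; first by apply: measurableU.
  by apply: r; rewrite ?lerDl// MM s2 mulrC.
apply: (strip) => //; first by apply: r; rewrite ?gerBl// MM s1 mulrC.
by rewrite adde0.
Qed.

End region.

(** * Lattice points in a region *)

Section lattice_count.
Context {R : realType}.
Implicit Types (t : R) (z : nat * nat).

(** Half-open squares of side [1 / t], each identified by its lower left corner,
    so that distinct lattice points have disjoint cells. *)
Definition cell t z : set (plane R) :=
  `[z.1%:R / t, z.1.+1%:R / t[ `*` `[z.2%:R / t, z.2.+1%:R / t[.

Lemma measurable_cell t z : measurable (cell t z).
Proof. exact: measurable_rect. Qed.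

Lemma in_cell t z (X Y : R) : 0 < t -> cell t z (X, Y) <->
  (z.1%:R <= X * t < z.1.+1%:R) /\ (z.2%:R <= Y * t < z.2.+1%:R).
Proof.
by move=> t0; rewrite /cell /= !in_itv /= !ler_pdivrMr// !ltr_pdivlMr.
Qed.

Lemma cell_bounds t z (X Y : R) : 0 < t -> cell t z (X, Y) ->
  z.1%:R / t <= X < z.1%:R / t + t^-1 /\ z.2%:R / t <= Y < z.2%:R / t + t^-1.
Proof.
move=> t0 /in_cell-/(_ t0)[/andP[h1 h2] /andP[h3 h4]].
have E (m : nat) : m%:R / t + t^-1 = m.+1%:R / t by rewrite -natr1 mulrDl mul1r.
by rewrite !E !ltr_pdivlMr// h2 h4 !ler_pdivrMr// h1 h3.
Qed.

Lemma leb2_cell t z : 0 < t -> leb2 (cell t z) = ((t ^+ 2)^-1)%:E.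
Proof.
move=> t0; rewrite /leb2 product_measure1E//= !lebesgue_measure_itv/= !lte_fin.
rewrite !ltr_pM2r ?invr_gt0// !ltr_nat !ltnSn -!EFinB -EFinM -!mulrBl.
by rewrite -!natr1 ![_ + 1 - _]addrAC !subrr !add0r !mul1r expr2 invfM.
Qed.

Lemma trivIset_cell t (A : set (nat * nat)) : 0 < t -> trivIset A (cell t).
Proof.
move=> t0 [x y] [x' y'] _ _ [[X Y] []].
move=> /in_cell-/(_ t0)[/= /andP[h1 h2] /andP[h3 h4]].
move=> /in_cell-/(_ t0)[/= /andP[k1 k2] /andP[k3 k4]].
have E (m n : nat) (r : R) : m%:R <= r -> r < m.+1%:R -> n%:R <= r -> r < n.+1%:R -> m = n.
  move=> a b c d; apply/eqP; rewrite eqn_leq -(ltnS m) -(ltnS n) -!(ltr_nat R).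
  by rewrite (le_lt_trans a d) (le_lt_trans c b).
by congr pair; [apply: (E _ _ (X * t))|apply: (E _ _ (Y * t))].
Qed.

Lemma leb2_cells t (s : seq (nat * nat)) : 0 < t -> uniq s ->
  leb2 (\bigcup_(z in [set` s]) cell t z) = ((size s)%:R / t ^+ 2)%:E.
Proof.
move=> t0 us; rewrite measure_fin_bigcup; last 3 first.
- exact: finite_seq.
- exact: trivIset_cell.
- by move=> z _; exact: measurable_cell.
rewrite -fsbig_seq//=; under eq_bigr do rewrite leb2_cell//.
rewrite sumEFin; congr EFin; rewrite big_const_seq count_predT iter_addr addr0.
by rewrite mulr_natl.
Qed.

Lemma cell_sub_region t z (a b c d w : R) : 0 < t ->
  region a b c d w (z.1%:R / t) (z.2%:R / t) -> cell t z `<=`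
  regionS (a - t^-1) (b + t^-1) (c - t^-1) (d + t^-1) (w - t^-1).
Proof.
move=> t0 /and5P[p1 p2 p3 p4 p5] [X Y] /cell_bounds-/(_ t0)[/andP[q1 q2] /andP[q3 q4]].
have h0 : 0 < t^-1 by rewrite invr_gt0.
move: p1 p2 p3 p4 p5 q1 q2 q3 q4 h0; rewrite /regionS /region /=.
set x := _%:R / t; set y := _%:R / t; set h := t^-1.
by move=> p1 p2 p3 p4 p5 q1 q2 q3 q4 h0; apply/and5P; split; lra.
Qed.

(** Rounding a point down moves it by less than [1 / t] in each coordinate. The
    margin [2 / t] keeps the coordinates of the lattice point positive. *)
Lemma region_cell t (a b c d w X Y : R) : 0 < t -> 0 <= a -> 0 <= c ->
  region (a + 2 * t^-1) (b - 2 * t^-1) (c + 2 * t^-1) (d - 2 * t^-1) (w + 2 * t^-1) X Y ->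
  exists z, [/\ (0 < z.1)%N && (0 < z.2)%N, cell t z (X, Y) &
    region a b c d w (z.1%:R / t) (z.2%:R / t)].
Proof.
move=> t0 a0 c0 /and5P[p1 p2 p3 p4 p5].
have h0 : 0 < t^-1 by rewrite invr_gt0.
have corner (r s : R) : 0 <= s -> s + 2 * t^-1 < r -> exists k : nat,
    [/\ (0 < k)%N, k%:R <= r * t < k.+1%:R & k%:R / t <= r < k%:R / t + t^-1].
  move=> s0 sr; have rt : 2 <= r * t.
    by rewrite -ler_pdivrMr// ltW// (le_lt_trans _ sr)// lerDr.
  have /andP[k1 k2] : (Num.truncn (r * t))%:R <= r * t < (Num.truncn (r * t)).+1%:R.
    by apply: truncn_itv; rewrite (le_trans _ rt).
  exists (Num.truncn (r * t)); rewrite k1 k2; split=> //.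
    by rewrite truncn_gt0 (le_trans _ rt)// ler1n.
  have E (k : nat) : k%:R / t + t^-1 = k.+1%:R / t by rewrite -natr1 mulrDl mul1r.
  by rewrite ler_pdivrMr// k1 E ltr_pdivlMr.
have [x [x0 x1 /andP[x2 x3]]] := corner _ _ a0 p1.
have [y [y0 y1 /andP[y2 y3]]] := corner _ _ c0 p3.
exists (x, y); split=> /=; [by rewrite x0|exact/in_cell|].
move: p1 p2 p3 p4 p5 h0 x2 x3 y2 y3; rewrite /region.
set x' := x%:R / t; set y' := y%:R / t; set h := t^-1.
by move=> p1 p2 p3 p4 p5 h0 x2 x3 y2 y3; apply/and5P; split; lra.
Qed.

(** The cells of the lattice points of the region are contained in the region
    enlarged by [1 / t] and cover the one shrunk by [2 / t]; both areas differ
    from that of the region by [O(1 / t)]. *)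
Lemma region_lattice_count (R0 : nat) (a b c d w : R) : 0 <= a -> 0 <= c ->
  a <= R0%:R -> c <= R0%:R -> b <= R0%:R -> d <= R0%:R ->
  forall e, 0 < e -> exists T, forall t B, T <= t ->
  (forall x : nat, x%:R <= R0%:R * t -> (x <= B)%N) ->
  `|pair_count B (fun x y => region a b c d w (x%:R / t) (y%:R / t))
     - t ^+ 2 * area a b c d w| <= e * t ^+ 2.
Proof.
move=> a0 c0 aR cR bR dR e e0.
pose M : R := R0%:R + 1.
have R00 : 0 <= R0%:R :> R by [].
have M0 : 0 < M by rewrite ltr_wpDl.
exists (Num.max 1 (20 * M / e)) => t B; rewrite ge_max => /andP[t1 tT] hB.
have t0 : 0 < t by rewrite (lt_le_trans _ t1).
have tn0 : t != 0 by rewrite gt_eqF.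
have t20 : 0 < t ^+ 2 by rewrite exprn_gt0.
have h0 : 0 < t^-1 by rewrite invr_gt0.
have h1 : t^-1 <= 1 by rewrite invf_le1.
have hT : 20 * M * t^-1 <= e by rewrite ler_pdivrMr// [leRHS]mulrC -ler_pdivrMr.
pose P (x y : nat) := region a b c d w (x%:R / t) (y%:R / t).
have bnd (x : nat) (r : R) : r <= R0%:R -> x%:R / t <= r -> (x <= B)%N.
  by move=> rR xr; apply: hB; rewrite -ler_pdivrMr// (le_trans xr).
have sE := @size_pair_list R B P.
have mU : measurable (\bigcup_(z in [set` pair_list B P]) cell t z).
  by apply: fin_bigcup_measurable => // z _; exact: measurable_cell.
have up : (size (pair_list B P))%:R / t ^+ 2 <=
    area (a - t^-1) (b + t^-1) (c - t^-1) (d + t^-1) (w - t^-1).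
  rewrite -lee_fin -areaE -leb2_cells ?uniq_pair_list//.
  apply: le_measure; rewrite ?inE//; first exact: measurable_region.
  move=> [X Y] [[x y]] /=; rewrite mem_pair_list => /and3P[_ _ Pxy].
  exact: cell_sub_region.
have lo : area (a + 2 * t^-1) (b - 2 * t^-1) (c + 2 * t^-1) (d - 2 * t^-1) (w + 2 * t^-1)
    <= (size (pair_list B P))%:R / t ^+ 2.
  rewrite -lee_fin -areaE -leb2_cells ?uniq_pair_list//.
  apply: le_measure; rewrite ?inE//; first exact: measurable_region.
  move=> [X Y] /(region_cell t0 a0 c0)[[x y] [/= /andP[x0 y0] hc hr]].
  exists (x, y) => //=; rewrite mem_pair_list x0 y0 /P hr andbT.
  by case/and5P: hr => _ xb _ yd _; rewrite (bnd _ _ bR xb) (bnd _ _ dR yd).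
have up' : area (a - t^-1) (b + t^-1) (c - t^-1) (d + t^-1) (w - t^-1) <=
    area a b c d w + 10 * M * t^-1.
  apply: area_enlarge; rewrite ?(ltW M0) ?(ltW h0)//.
  - by rewrite lerNl opprB lerBlDr (le_trans h1)// /M addrAC lerDr addr_ge0.
  - by rewrite /M lerD.
  - by rewrite lerNl opprB lerBlDr (le_trans h1)// /M addrAC lerDr addr_ge0.
  - by rewrite /M lerD.
have lo' := @area_enlarge R M (a + 2 * t^-1) (b - 2 * t^-1) (c + 2 * t^-1)
  (d - 2 * t^-1) (w + 2 * t^-1) (2 * t^-1).
rewrite !addrK !subrK in lo'.
have {}lo' : area a b c d w <= area (a + 2 * t^-1) (b - 2 * t^-1) (c + 2 * t^-1)
    (d - 2 * t^-1) (w + 2 * t^-1) + 10 * M * (2 * t^-1).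
  apply: lo'; rewrite ?mulr_ge0 ?(ltW M0) ?(ltW h0)//.
  - by rewrite (le_trans _ a0)// oppr_le0 ltW.
  - by rewrite (le_trans bR)// lerDl.
  - by rewrite (le_trans _ c0)// oppr_le0 ltW.
  - by rewrite (le_trans dR)// lerDl.
rewrite -/P -sE.
have -> : (size (pair_list B P))%:R - t ^+ 2 * area a b c d w =
    t ^+ 2 * ((size (pair_list B P))%:R / t ^+ 2 - area a b c d w) by field.
rewrite normrM ger0_norm ?(ltW t20)// mulrC ler_pM2r// ler_norml.
have Mh : 0 <= M * t^-1 by rewrite mulr_ge0 ?ltW.
move: up lo up' lo' hT Mh; clear; set S := _ / t ^+ 2; set A := area a b c d w.
set A1 := area (a - _) _ _ _ _; set A2 := area (a + _) _ _ _ _; set h := t^-1.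
move=> *.
by apply/andP; split; lra.
Qed.

End lattice_count.

(** * Hitting times and marks *)

Section lattices.
Context {R : realType}.
Implicit Types (t c d : R) (z : 'cV[R]_2).

Lemma cvec2_inj (x y x' y' : R) : cvec2 x y = cvec2 x' y' -> x = x' /\ y = y'.
Proof.
by move=> E; split; [have := congr1 (fun z : 'cV[R]_2 => z 0 0) E
  |have := congr1 (fun z : 'cV[R]_2 => z 1 0) E]; rewrite !mxE.
Qed.

Lemma mulmx2_cvec2 (a b c d x y : R) :
  mx2 a b c d *m cvec2 x y = cvec2 (a * x + b * y) (c * x + d * y).
Proof.
apply/matrixP => i j; rewrite !mxE big_ord_recl big_ord1 !mxE /=.
by case: i => [[|[|[]]]].
Qed.

Lemma cvec2_int (n : 'cV[int]_2) :
  map_mx intr n = cvec2 (n 0 0)%:~R (n 1 0)%:~R :> 'cV[R]_2.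
Proof.
apply/matrixP => i j; rewrite !mxE (ord1 j).
by case: i => [[|[|[]]]//= ?]; congr (_ _ _)%:~R; apply/val_inj.
Qed.

Lemma lattice_mx2 (a b c d : R) z : lattice (mx2 a b c d) z <->
  exists i k : int, z = cvec2 (a * i%:~R + b * k%:~R) (c * i%:~R + d * k%:~R).
Proof.
split=> [[n _ <-]|[i [k ->]]].
  by exists (n 0 0), (n 1 0); rewrite cvec2_int mulmx2_cvec2.
exists (\col_l nth 0 [:: i; k] l) => //.
by rewrite cvec2_int mulmx2_cvec2 !mxE.
Qed.

Lemma mulmx2 (a b c d a' b' c' d' : R) : mx2 a b c d *m mx2 a' b' c' d' =
  mx2 (a * a' + b * c') (a * b' + b * d') (c * a' + d * c') (c * b' + d * d').
Proof.
apply/matrixP => i j; rewrite !mxE big_ord_recl big_ord1 !mxE /=.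
by case: i => [[|[|[]]]]//; case: j => [[|[|[]]]].
Qed.

Lemma det_mx2 (a b c d : R) : \det (mx2 a b c d) = a * d - b * c.
Proof.
rewrite (expand_det_row _ ord0) big_ord_recl big_ord1 /cofactor !det_mx11 !mxE /=.
by rewrite expr0 expr1; ring.
Qed.

Lemma LambdaE (Q : nat) t :
  Lambda Q t = lattice (mx2 Q%:R (- t / Q%:R) 0 Q%:R^-1).
Proof.
have E : mx2 1 (- t) 0 1 *m mx2 Q%:R 0 0 Q%:R^-1 = mx2 Q%:R (- t / Q%:R) 0 Q%:R^-1.
  by rewrite mulmx2; congr mx2; ring.
rewrite /Lambda -E; apply/seteqP; split => z.
  by move=> [_ [n _ <-] <-]; exists n => //; rewrite mulmxA.
move=> [n _ <-]; rewrite -mulmxA; exists (mx2 Q%:R 0 0 Q%:R^-1 *m map_mx intr n) => //.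
by exists n.
Qed.

Lemma LambdaP (Q : nat) t z : Lambda Q t z <->
  exists m n : int, z = cvec2 (Q%:R * m%:~R - t * n%:~R / Q%:R) (n%:~R / Q%:R).
Proof.
rewrite LambdaE lattice_mx2; split => -[m [n ->]]; exists m, n; congr cvec2; ring.
Qed.

Lemma Lambda_unimodular (Q : nat) t : (0 < Q)%N -> unimodular (Lambda Q t).
Proof.
move=> Q0; exists (mx2 Q%:R (- t / Q%:R) 0 Q%:R^-1); last exact: LambdaE.
by rewrite det_mx2 mulr0 subr0 divff ?normr1// pnatr_eq0 -lt0n.
Qed.

Section reduced_fraction.
Variables (Q p q : nat).
Hypotheses (Q0 : (0 < Q)%N) (cpq : coprime p q) (pq : (p < q)%N).
Let t : R := Q%:R ^+ 2 * (p%:R / q%:R).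

Let Q1 : Q%:R != 0 :> R. Proof. by rewrite pnatr_eq0 -lt0n. Qed.
Let q0 : (0 < q)%N. Proof. exact: leq_ltn_trans pq. Qed.
Let q1 : q%:R != 0 :> R. Proof. by rewrite pnatr_eq0 -lt0n. Qed.

Lemma Lambda_vertical : Lambda Q t (cvec2 0 (q%:R / Q%:R)).
Proof.
apply/LambdaP; exists p%:Z, q%:Z; congr cvec2.
by rewrite -!pmulrn /t; field; rewrite Q1 q1.
Qed.

(** [Lambda Q t] is generated by [(Q, 0)] and [(- t / Q, 1 / Q)]. A basis in which
    the first coordinates are [1 / d] and [0] expresses the vertical vector by
    the primitive pair [(p, q)] and the other vector by a pair [(p', x)] with
    [p' * q - p * x = 1]. *)
Lemma Lambda_basis c d : 0 < d -> 0 < c ->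
  Lambda Q t = lattice (mx2 d^-1 0 c d) <->
  d = q%:R / Q%:R /\ exists x p' : nat,
    [/\ (0 < x)%N, (p' * q = p * x + 1)%N & c = x%:R / Q%:R].
Proof.
move=> d0 c0; split=> [E|[-> [x [p' [x0 pp ->]]]]]; last first.
  have ppR : p'%:R * q%:R = p%:R * x%:R + 1 :> R by rewrite -!natrM pp natrD.
  have {}ppR : p'%:R = (p%:R * x%:R + 1) / q%:R :> R by rewrite -ppR mulfK.
  apply/seteqP; split => z.
    move=> /LambdaP[m [n ->]]; apply/lattice_mx2.
    exists (q%:Z * m - p%:Z * n), (p'%:Z * n - x%:Z * m).
    rewrite !rmorphB /= !rmorphM /= -!pmulrn ppR; congr cvec2.
      by rewrite /t invf_div; field; rewrite Q1 q1.
    by field; rewrite Q1 q1.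
  move=> /lattice_mx2[i [k ->]]; apply/LambdaP.
  exists (p'%:Z * i + p%:Z * k), (x%:Z * i + q%:Z * k).
  rewrite !rmorphD /= !rmorphM /= -!pmulrn ppR; congr cvec2.
    by rewrite /t invf_div; field; rewrite Q1 q1.
  by field; rewrite Q1.
have /LambdaP[m [n /cvec2_inj[e1 e2]]] : Lambda Q t (cvec2 0 d).
  by rewrite E; apply/lattice_mx2; exists 0, 1; congr cvec2; ring.
have /LambdaP[m' [n' /cvec2_inj[e3 e4]]] : Lambda Q t (cvec2 d^-1 c).
  by rewrite E; apply/lattice_mx2; exists 1, 0; congr cvec2; ring.
have n0 : (0 < n)%R.
  by move: d0; rewrite e2 pmulr_lgt0 ?ltr0z// invr_gt0 ltr0n.
have n'0 : (0 < n')%R.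
  by move: c0; rewrite e4 pmulr_lgt0 ?ltr0z// invr_gt0 ltr0n.
have f1 : (m * q%:Z = p%:Z * n)%R.
  apply: (@intr_inj R); rewrite !rmorphM /= -!pmulrn.
  have : Q%:R * m%:~R = t * n%:~R / Q%:R by apply/eqP; rewrite -subr_eq0 -e1.
  rewrite /t => h; have -> : m%:~R = Q%:R ^+ 2 * (p%:R / q%:R) * n%:~R / Q%:R / Q%:R :> R.
    by rewrite -h mulrC mulKf.
  by field; rewrite Q1 q1.
have f2 : (n * (m' * q%:Z - p%:Z * n') = q%:Z)%R.
  apply: (@intr_inj R); rewrite rmorphM rmorphB !rmorphM /= -!pmulrn.
  have nR : n%:~R != 0 :> R by rewrite intr_eq0 gt_eqF.
  have : n%:~R * d^-1 = Q%:R :> R by rewrite e2 invf_div mulrC divfK.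
  rewrite e3 /t => h.
  have -> : n%:~R * (m'%:~R * q%:R - p%:R * n'%:~R) =
     n%:~R * (Q%:R * m'%:~R - Q%:R ^+ 2 * (p%:R / q%:R) * n'%:~R / Q%:R) * q%:R / Q%:R :> R.
    by field; rewrite Q1 q1.
  by rewrite h mulrAC divff// mul1r.
have [g gE] : exists g : int, n = (g * q%:Z)%R.
  have : (q%:Z %| n)%Z.
    rewrite -(@Gauss_dvdzr _ p%:Z) ?coprimezE ?absz_nat 1?coprime_sym//.
    by rewrite -f1 dvdz_mull.
  by move=> /dvdzP[g ->]; exists g.
have qZ : 0 < q%:Z :> int by rewrite ltz_nat.
have g1 : g = 1.
  have h1 : (g * (m' * q%:Z - p%:Z * n') = 1)%R.
    by apply: (mulIf (lt0r_neq0 qZ)); rewrite mul1r mulrAC -gE f2.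
  have h2 : (0 < g)%R by rewrite -(pmulr_lgt0 _ qZ) -gE.
  have : `|g|%N == 1%N.
    by rewrite -dvdz1; apply/dvdzP; exists (m' * q%:Z - p%:Z * n'); rewrite mulrC.
  by case: (g) h2 => // k _; rewrite absz_nat => /eqP ->.
rewrite g1 mul1r in gE; split; first by rewrite e2 gE -pmulrn.
have f3 : (m' * q%:Z = p%:Z * n' + 1)%R.
  have : q%:Z * (m' * q%:Z - p%:Z * n') = q%:Z * 1 by rewrite mulr1 -{1}gE f2.
  by move=> /(mulfI (lt0r_neq0 qZ)) => h; rewrite -h; ring.
case: n' n'0 e4 f3 {e3 f2} => // x x0 e4 f3.
case: m' f3 => m' f3; last by move: f3 qZ; rewrite NegzE; clear; nia.
exists x, m'; split=> //.
by apply/eqP; rewrite -eqz_nat PoszD !PoszM; apply/eqP.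
Qed.

End reduced_fraction.
Lemma hitting_timesP (u : R -> R) (Q : nat) t : (0 < Q)%N -> hitting_times u Q t <->
  exists p q : nat, [/\ coprime p q, (p < q)%N, t = Q%:R ^+ 2 * (p%:R / q%:R) &
    q%:R <= Q%:R * vfun u (p%:R / q%:R)].
Proof.
move=> Q0; have Q1 : 0 < Q%:R :> R by rewrite ltr0n.
have Qn : Q%:R != 0 :> R by rewrite gt_eqF.
have Q2 : 0 < Q%:R ^+ 2 :> R by rewrite exprn_gt0.
split=> [[/andP[t0 tQ] [_ [d0 /andP[d0_gt d0v] /LambdaP[m [n /cvec2_inj[e1 e2]]]]]]|].
  have n0 : (0 < n)%R.
    by move: d0_gt; rewrite e2 pmulr_lgt0 ?ltr0z// invr_gt0.
  have nR : 0 < n%:~R :> R by rewrite ltr0z.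
  have tE : t = Q%:R ^+ 2 * (m%:~R / n%:~R).
    have : Q%:R * m%:~R = t * n%:~R / Q%:R by apply/eqP; rewrite -subr_eq0 -e1.
    move=> h; have -> : m%:~R = t * n%:~R / Q%:R / Q%:R :> R.
      by rewrite -h mulrC mulKf.
    by field; rewrite Qn gt_eqF.
  have m0 : (0 <= m)%R.
    by move: t0; rewrite tE pmulr_rge0// pmulr_lge0 ?invr_gt0// ler0z.
  have mn : (m < n)%R.
    by move: tQ; rewrite tE -{2}(mulr1 (Q%:R ^+ 2)) ltr_pM2l// ltr_pdivrMr// mul1r ltr_int.
  case: m m0 mn tE {e1} => // m _; case: n n0 nR e2 => // n n0 nR e2; rewrite ltz_nat => mn.
  rewrite -!pmulrn in nR e2 * => tE.
  pose g := gcdn m n; have g0 : (0 < g)%N by rewrite gcdn_gt0 (leq_ltn_trans _ mn) ?orbT.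
  have nE : (n = n %/ g * g)%N by rewrite divnK ?dvdn_gcdr.
  have mE : (m = m %/ g * g)%N by rewrite divnK ?dvdn_gcdl.
  have gR : g%:R != 0 :> R by rewrite pnatr_eq0 -lt0n.
  have fE : m%:R / n%:R = (m %/ g)%:R / (n %/ g)%:R :> R.
    by rewrite {1}mE {1}nE !natrM -mulf_div divff// mulr1.
  exists (m %/ g)%N, (n %/ g)%N; split.
  - by rewrite /coprime -(eqn_pmul2r g0) mul1n muln_gcdl -mE -nE.
  - by rewrite -(ltn_pmul2r g0) -mE -nE.
  - by rewrite tE fE.
  move: d0v; rewrite -fE tE mulrAC divff ?mul1r ?gt_eqF// e2 ler_pdivrMr// mulrC.
  by apply: le_trans; rewrite ler_nat leq_div.
move=> [p [q [cpq pq -> qv]]]; have q0 : (0 < q)%N by exact: leq_ltn_trans pq.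
have q1 : 0 < q%:R :> R by rewrite ltr0n.
split.
  rewrite mulr_ge0 ?divr_ge0 ?exprn_ge0//= -{2}(mulr1 (Q%:R ^+ 2)) ltr_pM2l//.
  by rewrite ltr_pdivrMr// mul1r ltr_nat.
split; first exact: Lambda_unimodular.
exists (q%:R / Q%:R); last exact: Lambda_vertical.
by rewrite divr_gt0//= ler_pdivrMr// mulrAC divff ?mul1r ?gt_eqF// mulrC.
Qed.

(** The constraint on [c] in terms of fractions: [slope x y + 1 / (x * y)] is the
    right neighbour of denominator [x] of the fraction attached to [(x, y)], and
    the condition puts it in the Farey set, unless it equals 1. *)
Definition next_ok (u : R -> R) (Q x y : nat) : bool :=
  x%:R / Q%:R <= vfun u (slope x y + (x%:R * y%:R)^-1).

Lemma admissibleP (u : R -> R) (Q p q : nat) c d : (0 < Q)%N -> coprime p q ->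
  (p < q)%N -> 0 < d ->
  admissible u Q (Q%:R ^+ 2 * (p%:R / q%:R)) d c <->
  d = q%:R / Q%:R /\ exists x : nat, [/\ (0 < x)%N, coprime x q, snum x q = p,
    c = x%:R / Q%:R & next_ok u Q x q].
Proof.
move=> Q0 cpq pq d0; have q0 : (0 < q)%N by exact: leq_ltn_trans pq.
have Qn : Q%:R != 0 :> R by rewrite pnatr_eq0 -lt0n.
have qn : q%:R != 0 :> R by rewrite pnatr_eq0 -lt0n.
have sE (x : nat) : (0 < x)%N ->
    (Q%:R ^+ 2 * (p%:R / q%:R) + (x%:R / Q%:R * (q%:R / Q%:R))^-1) / Q%:R ^+ 2 =
    p%:R / q%:R + (x%:R * q%:R)^-1 :> R.
  move=> x0; have xn : x%:R != 0 :> R by rewrite pnatr_eq0 -lt0n.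
  by field; rewrite Qn qn xn.
split=> [[E c0 [s01 cv]]|[dE [x [x0 cxq sx cE ok]]]].
  have [dE [x [p' [x0 pp cE]]]] := (Lambda_basis Q0 cpq pq d0 c0).1 E.
  split=> //; exists x; have [cxq _] := bezout_coprime pp.
  have sx := snum_uniq pq pp.
  by split=> //; move: cv; rewrite /next_ok /slope sx cE dE sE.
have c0 : 0 < c by rewrite cE divr_gt0 ?ltr0n.
have [pp _ _ _] := sdenP x0 q0 cxq; rewrite sx in pp.
split=> //; first by apply/(Lambda_basis Q0 cpq pq d0 c0); split=> //; exists x, (sden x q).
rewrite cE dE sE//; split; last by move: ok; rewrite /next_ok /slope sx.
have xR : 0 < x%:R :> R by rewrite ltr0n.
have qR : 0 < q%:R :> R by rewrite ltr0n.
rewrite addr_ge0 ?divr_ge0 ?invr_ge0 ?mulr_ge0//=.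
have -> : p%:R / q%:R + (x%:R * q%:R)^-1 = (p%:R * x%:R + 1) / (x%:R * q%:R) :> R.
  by field; rewrite qn gt_eqF.
rewrite ler_pdivrMr ?mulr_gt0// mul1r -natrM -[X in _ + X](mulr1n 1) -natrD -natrM ler_nat.
by move: pq x0; clear; nia.
Qed.

Definition maximal_next (u : R -> R) (Q x y : nat) : Prop :=
  next_ok u Q x y /\ forall x', (0 < x')%N -> coprime x' y -> snum x' y = snum x y ->
    next_ok u Q x' y -> (x' <= x)%N.

(** A mark consists of the denominators of a right neighbour and of the fraction
    itself, divided by [Q]; the maximality of [c] is
    the maximality of [x] in its class modulo [y]. *)
Lemma mark_intro (u : R -> R) (Q x y : nat) : (0 < Q)%N -> (0 < x)%N -> (0 < y)%N ->
  coprime x y -> y%:R <= Q%:R * vfun u (slope x y) -> maximal_next u Q x y ->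
  hitting_times u Q (Q%:R ^+ 2 * slope x y) /\
  mark u Q (Q%:R ^+ 2 * slope x y) = (x%:R / Q%:R, y%:R / Q%:R).
Proof.
move=> Q0 x0 y0 cxy yv [ok mx].
have [p' pp py] := snumP y0 cxy; have [_ cp] := bezout_coprime pp.
have Q1 : 0 < Q%:R :> R by rewrite ltr0n.
split; first by apply/hitting_timesP => //; exists (snum x y), y.
have d0 : 0 < y%:R / Q%:R :> R by rewrite divr_gt0 ?ltr0n.
apply: xget_unique => [|[c d] [/= d'0 ad dmax]].
  split=> //=; first by apply/admissibleP => //; split=> //; exists x.
  move=> c /(admissibleP _ _ Q0 cp py d0)[_ [x' [x'0 cx' sx' -> ok']]].
  by rewrite ler_pM2r ?invr_gt0// ler_nat; exact: mx.
have [dE [x' [x'0 cx' sx' cE ok']]] := (admissibleP _ _ Q0 cp py d'0).1 ad.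
congr pair; last exact: dE.
apply/eqP; rewrite eq_le cE ler_pM2r ?invr_gt0// ler_nat mx//=.
rewrite -cE; apply: dmax; rewrite dE.
by apply/admissibleP => //; split=> //; exists x.
Qed.

(** The default value of [mark] has a vanishing first coordinate, so positivity of
    that coordinate excludes it. *)
Lemma mark_elim (u : R -> R) (Q : nat) t : (0 < Q)%N -> hitting_times u Q t ->
  0 < (mark u Q t).1 -> exists x y : nat, [/\ (0 < x)%N /\ (0 < y)%N, coprime x y,
    y%:R <= Q%:R * vfun u (slope x y), maximal_next u Q x y &
    t = Q%:R ^+ 2 * slope x y /\ mark u Q t = (x%:R / Q%:R, y%:R / Q%:R)].
Proof.
move=> Q0 /(hitting_timesP _ _ Q0)[p [q [cpq pq -> qv]]] m0.
have q0 : (0 < q)%N by exact: leq_ltn_trans pq.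
have Q1 : 0 < Q%:R :> R by rewrite ltr0n.
move: m0; rewrite /mark; case: xgetP => [[c d] _ [/= d0 ad dmax] c0|]; last by rewrite ltxx.
have [dE [x [x0 cx sx cE ok]]] := (admissibleP _ _ Q0 cpq pq d0).1 ad.
exists x, q; rewrite /slope sx; split=> //; last by rewrite cE dE.
split=> // x' x'0 cx' sx' ok'.
have : x'%:R / Q%:R <= c.
  by apply: dmax; apply/admissibleP => //; split=> //; exists x'; rewrite sx' sx.
by rewrite cE ler_pM2r ?invr_gt0// ler_nat.
Qed.

End lattices.

(** * Uniform continuity, step functions and the area of a slice *)

Section analysis_lemmas.
Context {R : realType}.

(** Heine's theorem: near each point of [K] every small enough [d] works for all
    points of a neighbourhood, and compactness makes the choice uniform. *)
Lemma compact_unif_continuous (T : pseudoMetricType R) (K : set T) (f : T -> R) :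
  compact K -> {within K, continuous f} -> forall e, 0 < e ->
  exists2 d, 0 < d & forall x y, K x -> K y -> ball x d y -> `|f x - f y| <= e.
Proof.
move=> /compact_near_coveringP cK /subspace_continuousP cf e e0.
have e2 : 0 < e / 2 by rewrite divr_gt0.
have := cK R (0^'+) (fun d x => forall y, K x -> K y -> ball x d y -> `|f x - f y| <= e).
move=> /(_ _) [].
  move=> x Kx.
  have /cvgrPdist_le/(_ _ e2) := cf x Kx.
  rewrite near_withinE => /nbhs_ballP[r /= r0 hr].
  exists (ball x (r / 2), [set d | 0 < d < r / 2]).
    split; first by apply: nbhsx_ballx; rewrite divr_gt0.
    by exists (r / 2) => /=; [rewrite divr_gt0|move=> d /=;
      rewrite sub0r normrN => /ltr_normlW h ->].
  move=> [x' d] [/= bx' /andP[d0 dr]] y Kx' Ky bd.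
  have h1 : `|f x - f x'| <= e / 2.
    by apply: hr => //; apply: le_ball bx'; move: r0; clear; lra.
  have h2 : `|f x - f y| <= e / 2.
    apply: hr => //; rewrite (splitr r); apply: ball_triangle bx' _.
    by apply: le_ball bd; exact: ltW.
  rewrite (_ : f x' - f y = (f x - f y) - (f x - f x')); last by ring.
  by rewrite (le_trans (ler_normB _ _))// (splitr e) lerD.
move=> r /= r0 hr; exists (r / 2); first by rewrite divr_gt0.
move=> x y Kx Ky bd; apply: (hr (r / 2)) => //=; last by rewrite divr_gt0.
by rewrite sub0r normrN gtr0_norm ?divr_gt0// ltr_pdivrMr// ltr_pMr// ltr1n.
Qed.

Section step_functions.
Context {d : measure_display} {T : measurableType d}.
Variable mu : {measure set T -> \bar R}.

Let cell_integral (C : set T) (f : T -> R) (c e : R) : measurable C ->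
  (mu C < +oo)%E -> measurable_fun C f -> 0 <= e ->
  (forall x, C x -> `|f x - c| <= e) ->
  (\int[mu]_(x in C) (f x)%:E)%E \is a fin_num /\
  `|fine (\int[mu]_(x in C) (f x)%:E)%E - c * fine (mu C)| <= e * fine (mu C).
Proof.
move=> mC Coo mf e0 h.
have finC : mu C \is a fin_num by rewrite ge0_fin_numE.
have intcst (k : R) : mu.-integrable C (EFin \o cst k).
  apply: measurable_bounded_integrable => //.
  by exists `|k|; split=> [|r kr x _ /=]; [exact: num_real|exact: ltW].
have intf : mu.-integrable C (EFin \o f).
  apply: measurable_bounded_integrable => //.
  exists (`|c| + e); split=> [|r kr x Cx /=]; first exact: num_real.
  rewrite (_ : f x = (f x - c) + c); last by ring.
  by rewrite (le_trans (ler_normD _ _))// (le_trans _ (ltW kr))// addrC lerD2l h.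
have fint : (\int[mu]_(x in C) (f x)%:E)%E \is a fin_num by exact: integrable_fin_num.
split=> //.
have up : (\int[mu]_(x in C) (f x)%:E <= ((c + e) * fine (mu C))%:E)%E.
  rewrite EFinM fineK// -integral_cst//; apply: le_integral => //.
    exact: (intcst (c + e)).
  move=> x; rewrite inE => Cx; rewrite lee_fin -lerBlDl.
  by have := h x Cx; apply: le_trans; exact: ler_norm.
have lo : (((c - e) * fine (mu C))%:E <= \int[mu]_(x in C) (f x)%:E)%E.
  rewrite EFinM fineK// -integral_cst//; apply: le_integral => //.
    exact: (intcst (c - e)).
  move=> x; rewrite inE => Cx; rewrite lee_fin lerBlDr -lerBlDl.
  have := h x Cx; apply: le_trans; rewrite -normrN opprB; exact: ler_norm.
move: up lo; rewrite -(fineK fint) !lee_fin => up lo.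
by rewrite ler_norml; apply/andP; split; lra.
Qed.

Lemma step_integral (I : eqType) (s : seq I) (C : I -> set T) (c : I -> R)
    (f : T -> R) (e : R) : uniq s -> trivIset [set` s] C ->
  (forall i, measurable (C i)) -> (forall i, (mu (C i) < +oo)%E) -> 0 <= e ->
  (forall i, i \in s -> measurable_fun (C i) f) ->
  (forall i x, i \in s -> C i x -> `|f x - c i| <= e) ->
  let D := \big[setU/set0]_(i <- s) C i in measurable_fun D f ->
  (\int[mu]_(x in D) (f x)%:E)%E \is a fin_num /\
  `|fine (\int[mu]_(x in D) (f x)%:E)%E - \sum_(i <- s) c i * fine (mu (C i))|
    <= e * \sum_(i <- s) fine (mu (C i)).
Proof.
move=> us ts mC Coo e0 mf h D mD.
rewrite /D integral_bigsetU_EFin//; last by apply/measurable_EFinP.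
have cells i : i \in s -> (\int[mu]_(x in C i) (f x)%:E)%E \is a fin_num /\
  `|fine (\int[mu]_(x in C i) (f x)%:E)%E - c i * fine (mu (C i))| <= e * fine (mu (C i)).
  by move=> si; apply: cell_integral => //; [exact: mf|move=> x; exact: h].
have -> : (\sum_(i <- s) \int[mu]_(x in C i) (f x)%:E)%E =
   (\sum_(i <- s) fine (\int[mu]_(x in C i) (f x)%:E)%E)%R%:E.
  rewrite -sumEFin; apply: eq_big_seq => i /cells[fi _].
  by rewrite fineK.
split=> //=; rewrite -sumrB mulr_sumr (le_trans (ler_norm_sum _ _ _))//.
rewrite big_seq [leRHS]big_seq; apply: ler_sum => i /cells[_].
exact.
Qed.

End step_functions.

(** The vertical section at [x] is the interval from [w - x] to [w]. *)
Lemma leb2_Omega (w : R) : 0 < w -> leb2 (Omega w) = (w ^+ 2 / 2)%:E.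
Proof.
move=> w0.
have -> : leb2 (Omega w) =
  (\int[lebesgue_measure]_x (lebesgue_measure (xsection (Omega w) x)))%E by [].
rewrite [LHS](_ : _ = \int[lebesgue_measure]_(x in `[0%R, w]) (x%:E))%E; last first.
  rewrite [RHS]integral_mkcond; apply: eq_integral => x _; rewrite patchE.
  case: ifPn => [|nx].
    rewrite inE /= in_itv /= => /andP[x0 xw].
    have [x00|xn0] := eqVneq x 0.
      rewrite (_ : xsection _ _ = set0) ?measure0 ?x00//.
      apply/seteqP; split => y //; rewrite /xsection /= inE => -[/= h1 _ _ _ _].
      by rewrite /= ?x00 ltxx in h1.
    have x0' : 0 < x by rewrite lt_def xn0.
    rewrite (_ : xsection _ x = `](w - x), w]%classic); last first.
      apply/seteqP; split => y; rewrite /xsection /Omega /= inE /= !in_itv /=.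
        by move=> [_ _ _ -> h]; rewrite ltrBlDl h.
      move=> /andP[h1 h2]; split=> //; last by rewrite -ltrBlDl.
      by rewrite (le_lt_trans _ h1)// subr_ge0.
    by rewrite lebesgue_measure_itv/= lte_fin ltrBlDr ltrDl x0' -EFinB opprB addrC subrK.
  rewrite (_ : xsection _ _ = set0) ?measure0//.
  apply/seteqP; split => y //; rewrite /xsection /= inE => -[/= h1 _ h2 _ _].
  by move: nx; rewrite mem_set//= in_itv /= h2 ltW.
rewrite (@continuous_FTC2 _ id (fun x => x ^+ 2 / 2))//.
- by rewrite expr0n /= mul0r sube0.
- by apply: continuous_subspaceT => x; exact: cvg_id.
- have cF : continuous (fun x : R => x ^+ 2 / 2).
    by move=> x; apply: cvgM; [exact: exprn_continuous|exact: cvg_cst].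
  split.
  + by move=> x _; apply: derivableM.
  + exact/cvg_at_right_filter/cF.
  + exact/cvg_at_left_filter/cF.
- move=> x _; rewrite derive1E.
  have dF : is_derive x 1 (fun y : R => y ^+ 2 / 2) x.
    by apply: is_derive_eq; rewrite /GRing.scale /=; field.
  by rewrite derive_val.
Qed.

Section unit_bounds.
Variable u : unit_function R.

Lemma vfun_gt0 s : s \in `[0, 1] -> 0 < vfun u s.
Proof. by move=> s01; rewrite invr_gt0; exact: unit_gt0. Qed.

Lemma vfun_continuous : {within `[0 : R, 1], continuous (vfun u)}.
Proof.
apply/subspace_continuousP => x x01; apply: cvgV.
  by rewrite gt_eqF//; apply: unit_gt0.
by have /subspace_continuousP := @unit_cont R u; apply.
Qed.

Lemma vfun_bounded : exists R0 : nat, forall s, s \in `[0, 1] -> vfun u s <= R0%:R.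
Proof.
have [c c01 hc] := EVT_max ler01 vfun_continuous.
exists (Num.truncn (vfun u c)).+1 => s /hc h; apply: (le_trans h).
exact/ltW/truncnS_gt.
Qed.

Lemma vfun_unif e : 0 < e -> exists2 d, 0 < d & forall s s', s \in `[0, 1] ->
  s' \in `[0, 1] -> `|s - s'| < d -> `|vfun u s - vfun u s'| <= e.
Proof.
move=> e0.
have [d d0 hd] := compact_unif_continuous (@segment_compact R 0 1) vfun_continuous e0.
by exists d => // s s' h h' hs; apply: hd.
Qed.

End unit_bounds.
End analysis_lemmas.

(** * The area of a slice of a box *)

Section slices.
Context {R : realType}.

Lemma area_mono (a b c d w a' b' c' d' w' : R) : a' <= a -> b <= b' -> c' <= c ->
  d <= d' -> w' <= w -> area a b c d w <= area a' b' c' d' w'.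
Proof.
move=> aa bb cc dd ww; rewrite -lee_fin -2!areaE; apply: le_measure; rewrite ?inE.
- exact: measurable_region.
- exact: measurable_region.
move=> z /and5P[h1 h2 h3 h4 h5]; apply/and5P; split.
- exact: le_lt_trans h1.
- exact: le_trans bb.
- exact: le_lt_trans h3.
- exact: le_trans dd.
- exact: le_lt_trans h5.
Qed.

Variables (a b c d : R).
Hypotheses (a0 : 0 <= a) (b0 : 0 <= b) (c0 : 0 <= c) (d0 : 0 <= d).

(** The trace of the box on [Omega w] is the case [w1 = w2 = w]; the two
    occurrences of [w] are separated because the area increases with the first
    and decreases with the second, so that they are perturbed in opposite
    directions. *)
Definition slice (w1 w2 : R) : R := area a (Num.min b w1) c (Num.min d w1) w2.

Lemma slice_param (M h w1 w2 w1' w2' : R) : 0 <= h -> a + b + c + d + h <= M ->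
  w1 <= w1' + h -> w2' - h <= w2 -> slice w1 w2 <= slice w1' w2' + 10 * M * h.
Proof.
move=> h0 hM h1 h2.
have M0 : 0 <= M by move: a0 b0 c0 d0 h0 hM; lra.
have minP (x : R) : Num.min x w1 <= Num.min x w1' + h.
  rewrite addr_minl le_min !ge_min h1 orbT andbT lerDl h0.
  by [].
have minM (x : R) : 0 <= x -> x + h <= M -> Num.min x w1' + h <= M.
  by move=> x0 xM; apply: le_trans xM; rewrite lerD2r ge_min lexx.
apply: (@le_trans _ _ (area (a - h) (Num.min b w1' + h) (c - h) (Num.min d w1' + h) (w2' - h))).
  by apply: area_mono => //; rewrite gerBl.
apply: area_enlarge => //; rewrite ?minM//; move: a0 b0 c0 d0 h0 hM; lra.
Qed.

Lemma setI_Omega (w : R) : (`]a, b] `*` `]c, d]) `&` Omega w =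
  regionS a (Num.min b w) c (Num.min d w) w.
Proof.
apply/seteqP; split => -[X Y]; rewrite /regionS /region /Omega /= !in_itv /= !le_min.
  by move=> [[/andP[-> ->] /andP[-> ->]] [_ _ -> -> ->]].
move=> /and5P[h1 /andP[h2 h3] h4 /andP[h5 h6] h7].
rewrite h1 h2 h4 h5; split=> //; split=> //.
  exact: le_lt_trans a0 h1.
exact: le_lt_trans c0 h4.
Qed.

Variable u : unit_function R.

Definition phi (s : R) : R := slice (vfun u s) (vfun u s).

Lemma phi_continuous : {within `[0 : R, 1], continuous phi}.
Proof.
apply/subspace_continuousP => x x01; apply/cvgrPdist_le => e e0.
pose M := a + b + c + d + 1.
have M0 : 0 < M by rewrite /M; move: a0 b0 c0 d0; lra.
have e'0 : 0 < Num.min 1 (e / (10 * M)) by rewrite lt_min ltr01 divr_gt0// mulr_gt0.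
have /subspace_continuousP/(_ x x01)/cvgrPdist_le/(_ _ e'0) := @vfun_continuous R u.
apply: filterS => y; rewrite le_min => /andP[].
set h := `|_ - _| => h1 he.
have Mh : 10 * M * h <= e by rewrite mulrC -ler_pdivlMr// mulr_gt0.
have h0 : 0 <= h by exact: normr_ge0.
have hM : a + b + c + d + h <= M by rewrite lerD2l.
have v1 : vfun u x <= vfun u y + h by rewrite -lerBlDl ler_norm.
have v2 : vfun u y <= vfun u x + h by rewrite -lerBlDl /h distrC ler_norm.
have k1 : phi x <= phi y + 10 * M * h by apply: slice_param => //; rewrite lerBlDr.
have k2 : phi y <= phi x + 10 * M * h by apply: slice_param => //; rewrite lerBlDr.
have : `|phi x - phi y| <= 10 * M * h.
  by rewrite ler_distl k1 andbT lerBlDr k2.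
by move=> /le_trans; apply.
Qed.

(** The mass that the limit measure gives to the box, up to the factor
    [2 / Cconst u]: the normalization [2 / w ^ 2] of [Pslice w] cancels the
    factor [w ^ 2] of the density. *)
Definition volume : R := \int[@lebesgue_measure R]_(s in `[0%R, 1%R]) phi s.

Let grid (N i : nat) : set R := `[i%:R / N%:R, i.+1%:R / N%:R[%classic.

Let grid_cover N k : (0 < N)%N ->
  \big[setU/set0]_(i <- iota 0 k) grid N i = `[0, k%:R / N%:R[%classic.
Proof.
move=> N0; have NR : 0 < N%:R :> R by rewrite ltr0n.
elim: k => [|k IH].
  by rewrite big_nil mul0r set_itvco0.
rewrite -addn1 iotaD big_cat /= big_seq1 IH add0n addn1.
by apply/esym/itv_bndbnd_setU; rewrite bnd_simp ?divr_ge0// ler_pM2r ?invr_gt0// ler_nat.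
Qed.

Let grid_trivIset N (A : set nat) : (0 < N)%N -> trivIset A (grid N).
Proof.
move=> N0 i j _ _ [x []]; rewrite /grid /= !in_itv /=.
have NR : 0 < N%:R :> R by rewrite ltr0n.
rewrite !ler_pdivrMr// !ltr_pdivlMr// => /andP[h1 h2] /andP[h3 h4].
apply/eqP; rewrite eqn_leq -(ltnS i) -(ltnS j) -!(ltr_nat R).
by rewrite (le_lt_trans h1 h4) (le_lt_trans h3 h2).
Qed.

Lemma riemann_sum e : 0 < e -> exists N0 : nat, forall N, (N0 <= N)%N -> (0 < N)%N ->
  `|volume - \sum_(i <- iota 0 N) phi (i%:R / N%:R) / N%:R| <= e.
Proof.
move=> e0.
have [dl dl0 hdl] := compact_unif_continuous (@segment_compact R 0 1) phi_continuous e0.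
exists (Num.truncn dl^-1).+1 => N N0N N0.
have NR : 0 < N%:R :> R by rewrite ltr0n.
have Nd : N%:R^-1 < dl.
  rewrite -[dl]invrK ltf_pV2 ?posrE ?invr_gt0//.
  by apply: (lt_le_trans (truncnS_gt _)); rewrite ler_nat.
have in01 i : i \in iota 0 N -> 0 <= (i%:R / N%:R : R) <= 1.
  by rewrite mem_iota add0n => /= iN; rewrite divr_ge0// ler_pdivrMr// mul1r ler_nat ltnW.
have sub01 i x : i \in iota 0 N -> grid N i x -> `[0, 1]%classic x.
  move=> iN; rewrite /grid /= !in_itv /= => /andP[h1 h2].
  rewrite (le_trans _ h1) ?divr_ge0//= (le_trans (ltW h2))// ler_pdivrMr// mul1r ler_nat.
  by move: iN; rewrite mem_iota add0n.
have mphi : measurable_fun (`[0, 1]%classic : set (measurableTypeR R)) phi.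
  apply: (@subspace_continuous_measurable_fun R `[0 : R, 1]%classic phi) => //.
  exact: phi_continuous.
have meas i : lebesgue_measure (grid N i) = (N%:R^-1)%:E.
  rewrite /grid lebesgue_measure_itv/= lte_fin ltr_pM2r ?invr_gt0// ltr_nat ltnSn.
  by rewrite -EFinB -mulrBl -natr1 addrAC subrr add0r mul1r.
have [||||i iN|i x iN hx||fin] := @step_integral R _ _ lebesgue_measure nat (iota 0 N)
  (grid N) (fun i => phi (i%:R / N%:R)) phi e (iota_uniq _ _).
- exact: grid_trivIset.
- by move=> i; exact: measurable_itv.
- by move=> i; rewrite [ltLHS](meas i) ltry.
- exact: ltW.
- by apply: measurable_funS mphi => // x; exact: sub01.
- rewrite distrC; apply: hdl; [exact: in01|exact: (sub01 i)|].
  move: hx; rewrite /grid /= in_itv /= -natr1 mulrDl mul1r => /andP[h1 h2].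
  by rewrite /ball /= ler0_norm ?subr_le0// opprB; lra.
- rewrite grid_cover// divff ?gt_eqF//.
  apply: measurable_funS mphi => //.
  by move=> x /=; rewrite !in_itv /= => /andP[-> /ltW].
rewrite grid_cover// divff ?gt_eqF//.
rewrite integral_itv_bndo_bndc; last first.
  apply/measurable_EFinP; apply: measurable_funS mphi => //.
  by move=> x /=; rewrite !in_itv /= => /andP[-> /ltW].
have fmeas i : fine (lebesgue_measure (grid N i)) = N%:R^-1 by rewrite meas.
under [X in _ - X]eq_bigr do rewrite [fine _]fmeas.
under [X in e * X]eq_bigr do rewrite [fine _]fmeas.
rewrite big_const_seq count_predT size_iota iter_addr addr0.
rewrite -[N%:R^-1 *+ N]mulr_natl divff ?gt_eqF//.
by rewrite mulr1.
Qed.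

End slices.

(** * Counting coprime pairs in a shell *)

Section shell_count.
Context {R : realType}.

Definition piece (N i : nat) (s : R) : bool := i%:R / N%:R <= s < i.+1%:R / N%:R.

Lemma slope_partition (n N : nat) (P : nat -> nat -> bool) : (0 < N)%N ->
  (forall x y, P x y -> coprime x y) ->
  pair_count n P = \sum_(i <- iota 0 N) pair_count n (fun x y =>
    P x y && piece N i (slope x y)) :> R.
Proof.
move=> N0 Pc; have NR : 0 < N%:R :> R by rewrite ltr0n.
have H k : pair_count n (fun x y => P x y && (slope x y < k%:R / N%:R :> R)) =
   \sum_(i <- iota 0 k) pair_count n (fun x y =>
    P x y && piece N i (slope x y)) :> R.
  elim: k => [|k IH].
    rewrite big_nil /pair_count big1_seq// => x _; rewrite big1_seq// => y /=.
    rewrite mem_index_iota => /andP[y0 _]; case Pxy: (P x y) => //=.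
    by have /andP[h _] := @slope_itv R _ _ y0 (Pc _ _ Pxy); rewrite mul0r ltNge h.
  rewrite -[in RHS]addn1 iotaD big_cat /= big_seq1 add0n -IH /pair_count -big_split.
  apply: eq_bigr => x _; rewrite -big_split; apply: eq_bigr => y _ /=.
  rewrite -natrD /piece; case: (P x y) => //=; congr _%:R.
  have kk : k%:R / N%:R < k.+1%:R / N%:R :> R by rewrite ltr_pM2r ?invr_gt0// ltr_nat.
  by have [h|h] := ltP (slope x y) (k%:R / N%:R); [rewrite (lt_trans h kk)|case: ltP].
rewrite -H; apply: eq_pair_count => x y _ y0; case Pxy: (P x y) => //=.
by rewrite divff ?gt_eqF//; have /andP[_ ->] := @slope_itv R _ _ y0 (Pc _ _ Pxy).
Qed.

Lemma near_sum (f : nat -> nat -> R) (g : nat -> R) :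
  (forall i e, 0 < e -> \forall Q \near \oo, f i Q <= (g i + e) * Q%:R ^+ 2) ->
  forall N e, 0 < e -> \forall Q \near \oo,
  \sum_(i <- iota 0 N) f i Q <= (\sum_(i <- iota 0 N) g i + e) * Q%:R ^+ 2.
Proof.
move=> h; elim=> [|N IH] e e0.
  by near=> Q; rewrite !big_nil add0r mulr_ge0 ?exprn_ge0// ltW.
have e2 : 0 < e / 2 by rewrite divr_gt0.
apply: filterS2 (IH _ e2) (h N _ e2) => Q h1 h2.
rewrite -addn1 iotaD !big_cat /= !big_seq1 add0n.
apply: (le_trans (lerD h1 h2)); rewrite -mulrDl ler_wpM2r ?exprn_ge0//.
by rewrite addrACA -splitr.
Unshelve. all: by end_near. Qed.

Variables (R0 : nat) (a b c d : R).
Hypotheses (a0 : 0 <= a) (b0 : 0 <= b) (c0 : 0 <= c) (d0 : 0 <= d).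
Hypotheses (aR : a <= R0%:R) (bR : b <= R0%:R) (cR : c <= R0%:R) (dR : d <= R0%:R).
Variable u : unit_function R.

Let kappa : R := coprime_const.

Let piece_region (w1 w2 : R) : R -> R -> bool :=
  region a (Num.min b w1) c (Num.min d w1) w2.

(** For a fixed region the density of coprime pairs and the equidistribution of
    their slopes multiply. *)
Let piece_count (w1 w2 al be : R) : 0 <= al -> al <= be -> be <= 1 ->
  forall e, 0 < e -> \forall Q \near \oo,
  `|pair_count (R0 * Q) (fun x y => coprime_in (piece_region w1 w2) Q x y
       && (al <= slope x y < be))
    - (kappa * ((be - al) * slice a b c d w1 w2)) * Q%:R ^+ 2| <= e * Q%:R ^+ 2.
Proof.
move=> al0 albe be1 e e0; have e2 : 0 < e / 2 by rewrite divr_gt0.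
have mb (x : R) : x <= R0%:R -> Num.min x w1 <= R0%:R.
  by move=> xR; rewrite ge_min xR.
have Db := @region_bounded R R0 _ _ _ _ w2 a0 c0 (mb _ bR) (mb _ dR).
have Dc := @region_convex R a (Num.min b w1) c (Num.min d w1) w2.
have h1 := equidistribution Db Dc al0 albe be1 e2.
have h2 := coprime_density
  (@region_lattice_count R R0 _ _ _ _ w2 a0 c0 aR cR (mb _ bR) (mb _ dR)) e2.
apply: filterS2 h1 h2 => Q; rewrite -/(slice a b c d w1 w2) -/(piece_region w1 w2).
set A := pair_count _ _; set B := pair_count _ _; set q := Q%:R ^+ 2 => h1 h2.
have q0 : 0 <= q by exact: exprn_ge0.
have la : 0 <= be - al <= 1 by rewrite subr_ge0 albe lerBlDr (le_trans be1)// lerDl.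
have -> : A - kappa * ((be - al) * slice a b c d w1 w2) * q =
  (A - (be - al) * B) + (be - al) * (B - q * (kappa * slice a b c d w1 w2)) by ring.
apply: (le_trans (ler_normD _ _)); rewrite [X in _ <= X * _](splitr e) [leRHS]mulrDl lerD//.
case/andP: la => la0 la1.
rewrite normrM (ger0_norm la0); apply: le_trans h2; rewrite -[leRHS]mul1r.
by rewrite ler_wpM2r.
Qed.

(** The trace of the box on [Omega w] with [w = v(slope x y)], thickened by [eta]
    or, for negative [eta], thinned: the margin absorbs the variation of [v]
    between neighbouring fractions. *)
Definition shell (eta : R) (Q x y : nat) : bool := coprime x y &&
  region a (Num.min b (vfun u (slope x y) + eta)) c (Num.min d (vfun u (slope x y) + eta))
    (vfun u (slope x y) - eta) (x%:R / Q%:R) (y%:R / Q%:R).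

Let shell_coprime eta Q x y : shell eta Q x y -> coprime x y.
Proof. by case/andP. Qed.

Let kappa0 : 0 < kappa. Proof. exact: coprime_const_gt0. Qed.

Let M : R := a + b + c + d + 2.
Let M0 : 0 < M. Proof. by rewrite /M ltr_wpDl// !addr_ge0. Qed.

Let vol := volume a b c d u.

(** One choice of the margin and of a partition of [0, 1] on whose pieces [v]
    varies less than the margin, and whose Riemann sum is close to the volume. *)
Let mesh (e : R) : 0 < e -> exists eta N, [/\ 0 < eta <= 1, (0 < N)%N,
  kappa * (20 * M * eta) <= e / 3,
  kappa * `|vol - \sum_(i <- iota 0 N) phi a b c d u (i%:R / N%:R) / N%:R| <= e / 3 &
  forall s s', s \in `[0, 1] -> s' \in `[0, 1] -> `|s - s'| <= N%:R^-1 ->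
    `|vfun u s - vfun u s'| <= eta].
Proof.
move=> e0; pose eta := Num.min 1 (e / 3 / (kappa * (20 * M))).
have kM : 0 < kappa * (20 * M) by rewrite !mulr_gt0.
have eta0 : 0 < eta by rewrite lt_min ltr01 !divr_gt0.
have ek : 0 < e / 3 / kappa by rewrite !divr_gt0.
have [N0 hN0] := riemann_sum a0 b0 c0 d0 u ek.
have [dl dl0 hdl] := vfun_unif u eta0.
pose N := maxn N0 (Num.truncn dl^-1).+1.
have N1 : (0 < N)%N by rewrite /N leq_max orbT.
exists eta, N; split=> //.
- by rewrite eta0 ge_min lexx.
- by rewrite mulrA mulrC -ler_pdivlMr// ge_min lexx orbT.
- by rewrite mulrC -ler_pdivlMr// hN0// leq_maxl.
move=> s s' s01 s'01 h; apply: hdl => //; apply: (le_lt_trans h).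
rewrite -[dl]invrK ltf_pV2 ?posrE ?invr_gt0 ?ltr0n//.
by apply: (lt_le_trans (truncnS_gt _)); rewrite ler_nat leq_maxr.
Qed.

Let in_piece N i s : (0 < N)%N -> (i < N)%N ->
  i%:R / N%:R <= s -> s < i.+1%:R / N%:R ->
  [/\ s \in `[0, 1], (i%:R / N%:R : R) \in `[0, 1] & `|s - i%:R / N%:R| <= N%:R^-1 :> R].
Proof.
move=> N0 iN h1 h2; have NR : 0 < N%:R :> R by rewrite ltr0n.
have i0 : 0 <= i%:R / N%:R :> R by rewrite divr_ge0.
have i1 : i.+1%:R / N%:R <= 1 :> R by rewrite ler_pdivrMr// mul1r ler_nat.
rewrite !in_itv /= (le_trans i0 h1) (le_trans (ltW h2) i1) i0 /=.
split=> //; first by rewrite (le_trans h1)// (le_trans (ltW h2)).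
rewrite ger0_norm ?subr_ge0// lerBlDl (le_trans (ltW h2))//.
by rewrite -natr1 mulrDl mul1r.
Qed.

(** On each piece of the partition [v] is almost constant, so the pairs of the
    shell whose slope is in the piece lie in a fixed region, to which
    [piece_count] applies; the resulting Riemann sum is close to the volume. *)
Lemma shell_count_upper e : 0 < e -> exists2 eta, 0 < eta & \forall Q \near \oo,
  pair_count (R0 * Q) (shell eta Q) <= (kappa * vol + e) * Q%:R ^+ 2.
Proof.
move=> e0; have [eta [N [/andP[eta0 eta1] N0 h1 h2 h3]]] := mesh e0.
exists eta => //; have e3 : 0 < e / 3 by rewrite divr_gt0.
have NR : 0 < N%:R :> R by rewrite ltr0n.
pose w i := vfun u (i%:R / N%:R).
pose f i Q := if (i < N)%N then pair_count (R0 * Q)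
  (fun x y => coprime_in (piece_region (w i + 2 * eta) (w i - 2 * eta)) Q x y
       && piece N i (slope x y)) else 0 : R.
pose g i := kappa * (N%:R^-1 * slice a b c d (w i + 2 * eta) (w i - 2 * eta)).
have fg i e' : 0 < e' -> \forall Q \near \oo, f i Q <= (g i + e') * Q%:R ^+ 2.
  move=> e'0; rewrite /f; have [iN|iN] := boolP (i < N)%N; last first.
    near=> Q; apply: mulr_ge0; last exact: exprn_ge0.
    by rewrite addr_ge0 ?(ltW e'0)// !mulr_ge0 ?invr_ge0 ?area_ge0// ltW.
  have p0 : 0 <= i%:R / N%:R :> R by rewrite divr_ge0.
  have p1 : i%:R / N%:R <= i.+1%:R / N%:R :> R.
    by rewrite ler_pM2r ?invr_gt0// ler_nat.
  have p2 : i.+1%:R / N%:R <= 1 :> R by rewrite ler_pdivrMr// mul1r ler_nat.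
  have pE : i.+1%:R / N%:R - i%:R / N%:R = N%:R^-1 :> R.
    by rewrite -mulrBl -natr1 addrAC subrr add0r mul1r.
  apply: filterS (@piece_count (w i + 2 * eta) (w i - 2 * eta) _ _ p0 p1 p2 _ e'0) => Q.
  rewrite pE.
  by move=> /ler_normlW; rewrite lerBlDl -mulrDl.
apply: filterS (near_sum fg N e3) => Q hQ.
rewrite (slope_partition _ N0 (@shell_coprime eta Q)).
apply: (@le_trans _ _ (\sum_(i <- iota 0 N) f i Q)).
  rewrite big_seq [leRHS]big_seq; apply: ler_sum => i; rewrite mem_iota add0n => /= iN.
  rewrite /f iN; apply: pair_count_le => x y x0 y0.
  rewrite /shell /coprime_in => /andP[/andP[-> hr] hp] /=; rewrite hp andbT.
  case/andP: (hp) => s1 s2; have [k1 k2 k3] := in_piece N0 iN s1 s2.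
  have := h3 _ _ k1 k2 k3; rewrite ler_norml => /andP[v1 v2].
  case/and5P: hr => r1 r2 r3 r4 r5; rewrite /piece_region /region r1 r3.
  move: r2 r4; rewrite !le_min => /andP[-> r2] /andP[-> r4] /=.
  by rewrite /w; apply/and3P; split; lra.
apply: (le_trans hQ); rewrite ler_wpM2r ?exprn_ge0//.
rewrite /g -mulr_sumr.
have sl i : slice a b c d (w i + 2 * eta) (w i - 2 * eta) <=
    phi a b c d u (i%:R / N%:R) + 20 * M * eta.
  have -> : 20 * M * eta = 10 * M * (2 * eta) by ring.
  apply: slice_param => //; rewrite ?/M; move: eta1 eta0; lra.
have S : \sum_(i <- iota 0 N) N%:R^-1 * slice a b c d (w i + 2 * eta) (w i - 2 * eta) <=
    \sum_(i <- iota 0 N) phi a b c d u (i%:R / N%:R) / N%:R + 20 * M * eta.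
  apply: (@le_trans _ _ (\sum_(i <- iota 0 N) (phi a b c d u (i%:R / N%:R) / N%:R +
      20 * M * eta / N%:R))).
    by apply: ler_sum => i _; rewrite -mulrDl mulrC ler_pM2r ?invr_gt0.
  rewrite big_split /= lerD2l big_const_seq count_predT size_iota iter_addr addr0.
  by rewrite -mulrnAr -[N%:R^-1 *+ N]mulr_natl divff ?gt_eqF// mulr1.
have k0 : 0 <= kappa by exact: ltW.
apply: (@le_trans _ _ (kappa * (\sum_(i <- iota 0 N) phi a b c d u (i%:R / N%:R) / N%:R
  + 20 * M * eta) + e / 3)); first by rewrite lerD2r ler_wpM2l.
set S' := \sum_(i <- _) _ in h2 *.
have : kappa * (S' - vol) <= e / 3.
  by apply: le_trans h2; rewrite ler_wpM2l// distrC ler_norm.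
by move: h1; rewrite !mulrDr mulrN; lra.
Unshelve. all: by end_near. Qed.

(** The fixed region now has to lie inside the shell, hence the opposite signs. *)
Lemma shell_count_lower e : 0 < e -> exists2 eta, 0 < eta & \forall Q \near \oo,
  (kappa * vol - e) * Q%:R ^+ 2 <= pair_count (R0 * Q) (shell (- eta) Q).
Proof.
move=> e0; have [eta [N [/andP[eta0 eta1] N0 h1 h2 h3]]] := mesh e0.
exists eta => //; have e3 : 0 < e / 3 by rewrite divr_gt0.
have NR : 0 < N%:R :> R by rewrite ltr0n.
pose w i := vfun u (i%:R / N%:R).
pose f i Q := if (i < N)%N then - pair_count (R0 * Q)
  (fun x y => coprime_in (piece_region (w i - 2 * eta) (w i + 2 * eta)) Q x y
       && piece N i (slope x y)) else 0 : R.
pose g i := if (i < N)%N then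
  - (kappa * (N%:R^-1 * slice a b c d (w i - 2 * eta) (w i + 2 * eta))) else 0.
have fg i e' : 0 < e' -> \forall Q \near \oo, f i Q <= (g i + e') * Q%:R ^+ 2.
  move=> e'0; rewrite /f /g; have [iN|iN] := boolP (i < N)%N; last first.
    by near=> Q; rewrite add0r mulr_ge0 ?exprn_ge0// ltW.
  have p0 : 0 <= i%:R / N%:R :> R by rewrite divr_ge0.
  have p1 : i%:R / N%:R <= i.+1%:R / N%:R :> R.
    by rewrite ler_pM2r ?invr_gt0// ler_nat.
  have p2 : i.+1%:R / N%:R <= 1 :> R by rewrite ler_pdivrMr// mul1r ler_nat.
  have pE : i.+1%:R / N%:R - i%:R / N%:R = N%:R^-1 :> R.
    by rewrite -mulrBl -natr1 addrAC subrr add0r mul1r.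
  apply: filterS (@piece_count (w i - 2 * eta) (w i + 2 * eta) _ _ p0 p1 p2 _ e'0) => Q.
  rewrite pE distrC.
  by move=> /ler_normlW; rewrite /piece; set A := pair_count _ _ => h; lra.
apply: filterS (near_sum fg N e3) => Q hQ.
rewrite (slope_partition _ N0 (@shell_coprime (- eta) Q)).
apply: (@le_trans _ _ (- \sum_(i <- iota 0 N) f i Q)); last first.
  rewrite -sumrN big_seq [leRHS]big_seq; apply: ler_sum => i.
  rewrite mem_iota add0n => /= iN.
  rewrite /f iN opprK; apply: pair_count_le => x y x0 y0.
  rewrite /shell /coprime_in => /andP[/andP[-> hr] hp] /=; rewrite hp andbT.
  case/andP: (hp) => s1 s2; have [k1 k2 k3] := in_piece N0 iN s1 s2.
  have := h3 _ _ k1 k2 k3; rewrite ler_norml => /andP[v1 v2].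
  case/and5P: hr => r1 r2 r3 r4 r5; rewrite /region r1 r3.
  move: r2 r4; rewrite !le_min => /andP[-> r2] /andP[-> r4] /=.
  by rewrite -/(w i) in v1 v2; rewrite opprK; apply/and3P; split; lra.
rewrite lerNr; apply: (le_trans hQ); rewrite -mulNr ler_wpM2r ?exprn_ge0//.
have -> : \sum_(i <- iota 0 N) g i = - (kappa * \sum_(i <- iota 0 N)
    N%:R^-1 * slice a b c d (w i - 2 * eta) (w i + 2 * eta)).
  rewrite mulr_sumr -sumrN; apply: eq_big_seq => i.
  by rewrite mem_iota add0n /g => /= ->.
have sl i : phi a b c d u (i%:R / N%:R) <=
    slice a b c d (w i - 2 * eta) (w i + 2 * eta) + 20 * M * eta.
  have -> : 20 * M * eta = 10 * M * (2 * eta) by ring.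
  apply: slice_param => //; rewrite ?/M -/(w i); move: eta1 eta0; lra.
have S : \sum_(i <- iota 0 N) phi a b c d u (i%:R / N%:R) / N%:R <=
    \sum_(i <- iota 0 N) N%:R^-1 * slice a b c d (w i - 2 * eta) (w i + 2 * eta)
    + 20 * M * eta.
  apply: (@le_trans _ _ (\sum_(i <- iota 0 N)
      (N%:R^-1 * slice a b c d (w i - 2 * eta) (w i + 2 * eta) + N%:R^-1 * (20 * M * eta)))).
    by apply: ler_sum => i _; rewrite -mulrDr mulrC ler_pM2l ?invr_gt0.
  rewrite big_split /= lerD2l big_const_seq count_predT size_iota iter_addr addr0.
  by rewrite -mulrnAl -[N%:R^-1 *+ N]mulr_natl divff ?gt_eqF// mul1r.
have k0 : 0 <= kappa by exact: ltW.
move: S; set S1 := \sum_(i <- _) _; set S2 := \sum_(i <- _) _ => S.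
have : kappa * S1 <= kappa * (S2 + 20 * M * eta) by rewrite ler_wpM2l.
have : kappa * (vol - S1) <= e / 3.
  by apply: le_trans h2; rewrite ler_wpM2l// ler_norm.
by move: h1; rewrite !mulrDr mulrN; lra.
Unshelve. all: by end_near. Qed.

End shell_count.

(** * Marks in a box and elements of the Farey set *)

Section mark_count.
Context {R : realType}.
Variables (R0 : nat) (u : unit_function R).
Hypothesis vR0 : forall s, s \in `[0, 1] -> vfun u s <= R0%:R.

Lemma next_slope_itv x y : (0 < x)%N -> (0 < y)%N -> coprime x y ->
  slope x y + (x%:R * y%:R)^-1 \in `[0 : R, 1].
Proof.
move=> x0 y0 cxy; have [E py t0 tx] := sdenP x0 y0 cxy.
have xR : 0 < x%:R :> R by rewrite ltr0n.
have yR : 0 < y%:R :> R by rewrite ltr0n.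
have -> : slope x y + (x%:R * y%:R)^-1 = (sden x y)%:R / x%:R :> R.
  rewrite /slope; have -> : (sden x y)%:R = ((snum x y)%:R * x%:R + 1) / y%:R :> R.
    by rewrite -natrM -[1]/(1%:R) -natrD -E natrM mulfK// gt_eqF.
  by field; rewrite !gt_eqF.
by rewrite in_itv /= divr_ge0//= ler_pdivrMr// mul1r ler_nat.
Qed.

Let slope_in x y : (0 < y)%N -> coprime x y -> (slope x y : R) \in `[0, 1].
Proof. by move=> y0 cxy; rewrite in_itv /=; have /andP[-> /ltW ->] := @slope_itv R _ _ y0 cxy. Qed.

Let frac_seq (Q : nat) : seq (nat * nat) :=
  [seq (p, q) | p <- iota 0 (R0 * Q).+1, q <- iota 0 (R0 * Q).+1].

Let mem_frac_seq Q p q : (p < q)%N -> q%:R <= Q%:R * vfun u (p%:R / q%:R) ->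
  (p, q) \in frac_seq Q.
Proof.
move=> pq qv; have q0 : 0 < q%:R :> R by rewrite ltr0n (leq_ltn_trans _ pq).
have qQ : (q <= R0 * Q)%N.
  rewrite -(ler_nat R); apply: (le_trans qv).
  rewrite natrM mulrC ler_wpM2r// vR0// in_itv /= divr_ge0//= ler_pdivrMr//.
  by rewrite mul1r ler_nat ltnW.
apply/allpairsP; exists (p, q); split=> //.
  by rewrite mem_iota add0n ltnS (leq_trans _ qQ)// ltnW.
by rewrite mem_iota add0n ltnS.
Qed.

Lemma finite_hitting_times Q : (0 < Q)%N -> finite_set (hitting_times u Q).
Proof.
move=> Q0; apply: (@sub_finite_set _ _
  [set` [seq Q%:R ^+ 2 * (z.1%:R / z.2%:R) | z <- frac_seq Q]]); last exact: finite_seq.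
move=> t /(hitting_timesP _ _ Q0)[p [q [cpq pq -> qv]]].
by apply/mapP; exists (p, q) => //; exact: mem_frac_seq.
Qed.

Lemma FareyP Q r : Farey u Q r <-> exists p q : nat, [/\ coprime p q, (p < q)%N,
  r = p%:Q / q%:Q & q%:R <= Q%:R * vfun u (p%:R / q%:R)].
Proof.
split.
  move=> [/andP[r0 r1] h].
  have n0 : (0 <= numq r)%R by rewrite numq_ge0.
  have d0 := denq_gt0 r.
  exists `|numq r|%N, `|denq r|%N.
  have rE : r = (`|numq r|%N)%:Q / (`|denq r|%N)%:Q.
    by rewrite !abszE (ger0_norm n0) (gtr0_norm d0) divq_num_den.
  split=> //.
  - exact: coprime_num_den.
  - rewrite -ltz_nat !abszE (ger0_norm n0) (gtr0_norm d0).
    move: r1; rewrite -{1}(divq_num_den r) ltr_pdivrMr ?ltr0z// mul1r.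
    by rewrite ltr_int.
  have r01 : (ratr r : R) \in `[0, 1].
    by rewrite in_itv /= ler0q r0 -(rmorph1 (@ratr R)) ler_rat ltW.
  have rR : ratr r = (`|numq r|%N)%:R / (`|denq r|%N)%:R :> R.
    by rewrite {1}rE fmorph_div /= !ratr_int -!pmulrn.
  rewrite -rR -ler_pdivrMr ?vfun_gt0// /vfun invrK mulrC.
  by move: h; rewrite -[X in _ * X%:~R](gtr0_norm d0) -abszE -pmulrn.
move=> [p [q [cpq pq -> qv]]].
have q0 : (0 < q)%N by exact: leq_ltn_trans pq.
have qQ : 0 < q%:Q by rewrite ltr0z ltz_nat.
split; first by rewrite divr_ge0//= ltr_pdivrMr// mul1r ltr_nat.
have -> : ratr (p%:Q / q%:Q) = p%:R / q%:R :> R by rewrite fmorph_div /= !ratr_int -!pmulrn.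
have -> : denq (p%:Q / q%:Q) = q%:Z by rewrite coprimeq_den// eqz_nat (gtn_eqF q0).
have s01 : (p%:R / q%:R : R) \in `[0, 1].
  by rewrite in_itv /= divr_ge0//= ler_pdivrMr ?ltr0n// mul1r ler_nat ltnW.
by move: qv; rewrite -ler_pdivrMr ?vfun_gt0// /vfun invrK -pmulrn mulrC.
Qed.

Lemma finite_Farey Q : finite_set (Farey u Q).
Proof.
have H : Farey u Q `<=` [set` [seq z.1%:Q / z.2%:Q | z : nat * nat <- frac_seq Q]].
  move=> t /FareyP[p [q [cpq pq -> qv]]].
  by apply/mapP; exists (p, q) => //; exact: mem_frac_seq.
exact: sub_finite_set H (finite_seq _).
Qed.

(** When [x] and [y] are of order [Q], neighbouring fractions are at distance
    [O(Q ^- 2)], so that [v] takes almost the same value at both. *)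
Let near_next (a c eta : R) : 0 < a -> 0 < c -> 0 < eta -> \forall Q \near \oo,
  forall x y, coprime x y -> a < x%:R / Q%:R -> c < y%:R / Q%:R ->
  `|vfun u (slope x y + (x%:R * y%:R)^-1) - vfun u (slope x y)| <= eta.
Proof.
move=> a0 c0 eta0; have [dl dl0 hdl] := vfun_unif u eta0.
have ac : 0 < a * c by rewrite mulr_gt0.
near=> Q => x y cxy xa yc.
have Q0 : (0 < Q)%N by near: Q; exact: nbhs_infty_gt.
have Q1 : 0 < Q%:R :> R by rewrite ltr0n.
have hQ : (a * c)^-1 <= dl * Q%:R by near: Q; exact: near_scale.
have xR : 0 < x%:R :> R by rewrite -(pmulr_lgt0 _ (_ : 0 < Q%:R^-1)) ?invr_gt0// (lt_trans a0).
have yR : 0 < y%:R :> R by rewrite -(pmulr_lgt0 _ (_ : 0 < Q%:R^-1)) ?invr_gt0// (lt_trans c0).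
have x0 : (0 < x)%N by rewrite -(ltr0n R).
have y0 : (0 < y)%N by rewrite -(ltr0n R).
apply: hdl; [exact: next_slope_itv|exact: slope_in|].
rewrite addrAC subrr add0r ger0_norm ?invr_ge0 ?mulr_ge0 ?(ltW xR) ?(ltW yR)//.
move: xa yc; rewrite !ltr_pdivlMr// => xa yc.
apply: (@lt_le_trans _ _ (a * Q%:R * (c * Q%:R))^-1).
  by rewrite ltf_pV2 ?posrE ?mulr_gt0//; apply: ltr_pM => //; rewrite mulr_ge0 ?ltW.
rewrite mulrACA invfM -expr2 ler_pdivrMr ?exprn_gt0//.
apply: (le_trans hQ); rewrite ler_pM2l// expr2 ler_peMl ?(ltW Q1)// ler1n.
Unshelve. all: by end_near. Qed.

Variables (a b c d : R).
Hypotheses (bR : b <= R0%:R) (dR : d <= R0%:R).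

Let box : set (plane R) := `]a, b] `*` `]c, d].

Definition mark_count (Q : nat) : nat :=
  count (fun t => mark u Q t \in box) (fset_set (hitting_times u Q)).

Let mem_box (X Y : R) : ((X, Y) \in box) = (a < X <= b) && (c < Y <= d).
Proof.
apply/idP/idP; rewrite inE /box /= !in_itv /=; first by move=> [-> ->].
by move=> /andP[-> ->].
Qed.

(** The next candidate after [x] in its class modulo [y] is [x + y]; it fails by
    maximality of [x], which forces [v < (x + y) / Q + eta]: marks lie in the
    thickened shell. *)
Lemma mark_count_upper eta : 0 < a -> 0 < c -> 0 < eta -> \forall Q \near \oo,
  (mark_count Q)%:R <= pair_count (R0 * Q) (shell a b c d u eta Q) :> R.
Proof.
move=> a0 c0 eta0; near=> Q.
have Q0 : (0 < Q)%N by near: Q; exact: nbhs_infty_gt.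
have Q1 : 0 < Q%:R :> R by rewrite ltr0n.
have close : forall x y, coprime x y -> a < x%:R / Q%:R -> c < y%:R / Q%:R ->
  `|vfun u (slope x y + (x%:R * y%:R)^-1) - vfun u (slope x y)| <= eta.
  by near: Q; exact: near_next.
rewrite -size_pair_list ler_nat /mark_count -size_filter.
rewrite -(size_map (fun z => Q%:R ^+ 2 * (slope z.1 z.2 : R)) (pair_list _ _)).
apply: uniq_leq_size; first by rewrite filter_uniq ?fset_uniq.
move=> t; rewrite mem_filter => /andP[tA].
rewrite in_fset_set; last exact: finite_hitting_times.
rewrite inE => ht; have m0 : 0 < (mark u Q t).1.
  by move: tA; case: (mark u Q t) => X Y; rewrite mem_box => /andP[/andP[h _] _]; exact: lt_trans h.
have [x [y [[x0 y0] cxy yv [ok mx] [tE mE]]]] := mark_elim Q0 ht m0.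
apply/mapP; exists (x, y); last exact: tE.
move: tA; rewrite mE mem_box => /andP[/andP[r1 r2] /andP[r3 r4]].
have cl := close x y cxy r1 r3.
have bnd (z : nat) (e : R) : e <= R0%:R -> z%:R / Q%:R <= e -> (z <= R0 * Q)%N.
  move=> eR ze; rewrite -(ler_nat R) natrM -ler_pdivrMr//; exact: le_trans eR.
rewrite mem_pair_list x0 y0 (bnd x b)// (bnd y d)//=.
have vy : y%:R / Q%:R <= vfun u (slope x y) by rewrite ler_pdivrMr// mulrC.
rewrite /shell cxy /region r1 r3 !le_min r2 r4 /=; apply/and3P; split.
- by move: ok cl; rewrite /next_ok ler_norml => ok /andP[_ cl]; lra.
- by apply: (le_trans vy); rewrite lerDl ltW.
rewrite ltNge; apply/negP => le.
have cxy' : coprime (x + y) y by rewrite /coprime gcdnC gcdnDr gcdnC.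
have sE : snum (x + y) y = snum x y.
  have [p' pp py] := snumP y0 cxy.
  by apply: (@snum_uniq _ (p' + snum x y)) => //; rewrite mulnDl pp mulnDr addnAC.
have sl : slope (x + y) y = slope x y :> R by rewrite /slope sE.
have r1' : a < (x + y)%:R / Q%:R.
  by apply: (lt_le_trans r1); rewrite ler_pM2r ?invr_gt0// ler_nat leq_addr.
have := close (x + y)%N y cxy' r1' r3; rewrite sl ler_norml => /andP[k1 _].
have : (x + y <= x)%N.
  apply: mx => //; first by rewrite addn_gt0 x0.
  rewrite /next_ok sl; apply: (@le_trans _ _ (vfun u (slope x y) - eta)); last by lra.
  by rewrite natrD mulrDl.
by rewrite -{2}(addn0 x) leq_add2l leqNgt y0.
Unshelve. all: by end_near. Qed.

(** Conversely, if [(x + y) / Q] exceeds [v + eta], no candidate after [x] is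
    admissible, so every pair of the thinned shell is a mark. The pair is
    recovered from its mark by multiplying with [Q]. *)
Lemma mark_count_lower eta : 0 < a -> 0 < c -> 0 < eta -> \forall Q \near \oo,
  pair_count (R0 * Q) (shell a b c d u (- eta) Q) <= (mark_count Q)%:R :> R.
Proof.
move=> a0 c0 eta0; near=> Q.
have Q0 : (0 < Q)%N by near: Q; exact: nbhs_infty_gt.
have Q1 : 0 < Q%:R :> R by rewrite ltr0n.
have Qn : Q%:R != 0 :> R by rewrite gt_eqF.
have close : forall x y, coprime x y -> a < x%:R / Q%:R -> c < y%:R / Q%:R ->
  `|vfun u (slope x y + (x%:R * y%:R)^-1) - vfun u (slope x y)| <= eta.
  by near: Q; exact: near_next.
rewrite -size_pair_list ler_nat /mark_count -size_filter.
set hits := [seq t <- _ | _].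
rewrite -(size_map (fun t => (Num.truncn (Q%:R * (mark u Q t).1 : R),
                              Num.truncn (Q%:R * (mark u Q t).2 : R))) hits).
apply: uniq_leq_size; first exact: uniq_pair_list.
move=> [x y]; rewrite mem_pair_list => /and3P[/andP[x0 _] /andP[y0 _] /andP[cxy]].
move=> /and5P[r1]; rewrite le_min => /andP[r2 r2'] r3; rewrite le_min => /andP[r4 r4'] r5.
have vy : y%:R <= Q%:R * vfun u (slope x y).
  by rewrite mulrC -ler_pdivrMr//; lra.
have mx : maximal_next u Q x y.
  split; first by have := close x y cxy r1 r3; rewrite /next_ok ler_norml => /andP[k1 _]; lra.
  move=> x' x'0 cx' sx' ok; rewrite leqNgt; apply/negP => xx'.
  have xy : (x + y <= x')%N.
    have /eqP := snum_inj_mod y0 cx' cxy sx'.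
    rewrite eqn_mod_dvd ?(ltnW xx')// => /dvdn_leq; rewrite subn_gt0 => /(_ xx').
    by rewrite leq_subRL ?(ltnW xx').
  have sl : slope x' y = slope x y :> R by rewrite /slope sx'.
  have r1' : a < x'%:R / Q%:R.
    by apply: (lt_le_trans r1); rewrite ler_pM2r ?invr_gt0// ler_nat ltnW.
  have := close x' y cx' r1' r3; rewrite sl ler_norml => /andP[_ k1].
  have : x%:R / Q%:R + y%:R / Q%:R <= x'%:R / Q%:R :> R.
    by rewrite -mulrDl -natrD ler_pM2r ?invr_gt0// ler_nat.
  by move: ok; rewrite /next_ok sl; lra.
have [ht mE] := mark_intro Q0 x0 y0 cxy vy mx.
apply/mapP; exists (Q%:R ^+ 2 * slope x y); last first.
  by rewrite mE /= ![Q%:R * _]mulrC !divfK// !natrK.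
rewrite mem_filter mE mem_box r1 r2 r3 r4 /= in_fset_set ?inE//.
exact: finite_hitting_times.
Unshelve. all: by end_near. Qed.

Let farey_rat (z : nat * nat) : rat := (snum z.1 z.2)%:Q / z.2%:Q.

(** The elements of the Farey set correspond to the coprime pairs [(x, y)] with
    [x, y <= Q * v < x + y], where [v] is taken at the fraction [snum x y / y]:
    for each denominator [y] exactly one [x] of the prescribed class modulo [y]
    lies between [Q * v - y] and [Q * v]. *)
Lemma Farey_card_upper eta Q : 0 < eta -> (0 < Q)%N ->
  (Farey_card u Q)%:R <= pair_count (R0 * Q) (shell 0 R0%:R 0 R0%:R u eta Q) :> R.
Proof.
move=> eta0 Q0; have Q1 : 0 < Q%:R :> R by rewrite ltr0n.
rewrite -size_pair_list ler_nat /Farey_card -(size_map farey_rat).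
apply: uniq_leq_size; first exact: fset_uniq.
move=> r; rewrite in_fset_set; last exact: finite_Farey.
rewrite inE => /FareyP[p [q [cpq pq rE qv]]].
have q0 : (0 < q)%N by exact: leq_ltn_trans pq.
set s : R := p%:R / q%:R in qv.
have s01 : s \in `[0, 1].
  by rewrite in_itv /= divr_ge0//= ler_pdivrMr ?ltr0n// mul1r ler_nat ltnW.
(* x is the largest integer at most Q v(s) with p x = -1 modulo q *)
pose x0 := snum p q; pose K := Num.truncn (Q%:R * vfun u s).
have [p' pp x0q] := snumP q0 cpq.
have v0 : 0 <= Q%:R * vfun u s by rewrite mulr_ge0 ?(ltW (vfun_gt0 u s01)).
have qK : (q <= K)%N by rewrite truncn_ge_nat.
have /andP[K1 K2] : K%:R <= Q%:R * vfun u s < K.+1%:R by exact: truncn_itv.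
pose x := (x0 + (K - x0) %/ q * q)%N.
have x0K : (x0 <= K)%N by rewrite (leq_trans (ltnW x0q)).
have xK : (x <= K)%N by rewrite -(subnKC x0K) leq_add2l leq_trunc_div.
have Kx : (K < x + q)%N.
  by rewrite -{1}(subnKC x0K) -addnA ltn_add2l {1}(divn_eq (K - x0) q) ltn_add2l ltn_pmod.
have xgt : (0 < x)%N by rewrite -(ltn_add2r q) add0n (leq_ltn_trans qK).
have E : ((p' + p * ((K - x0) %/ q)) * q = p * x + 1)%N.
  by rewrite mulnDl pp /x mulnDr addnAC (mulnC (snum p q)) -mulnA.
have [cxq _] := bezout_coprime E.
have sx := snum_uniq pq E.
have sE : slope x q = s by rewrite /slope sx.
apply/mapP; exists (x, q); last by rewrite rE /farey_rat /= sx.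
have vs := vR0 s01.
have xQ : x%:R / Q%:R <= vfun u s.
  by rewrite ler_pdivrMr// mulrC (le_trans _ K1)// ler_nat.
have qQ : q%:R / Q%:R <= vfun u s by rewrite ler_pdivrMr// mulrC.
have bnd (z : nat) : z%:R / Q%:R <= vfun u s -> (z <= R0 * Q)%N.
  by move=> zv; rewrite -(ler_nat R) natrM -ler_pdivrMr// (le_trans zv).
rewrite mem_pair_list xgt q0 !bnd//= /shell cxq sE /region.
rewrite !divr_gt0 ?ltr0n//= !le_min (le_trans xQ)// (le_trans qQ)//=.
have sum : vfun u s < x%:R / Q%:R + q%:R / Q%:R.
  rewrite -mulrDl -natrD ltr_pdivlMr// mulrC (lt_le_trans K2)// ler_nat//.
by apply/and3P; split; lra.
Qed.

Lemma Farey_card_lower eta Q : 0 < eta -> (0 < Q)%N ->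
  pair_count (R0 * Q) (shell 0 R0%:R 0 R0%:R u (- eta) Q) <= (Farey_card u Q)%:R :> R.
Proof.
move=> eta0 Q0; have Q1 : 0 < Q%:R :> R by rewrite ltr0n.
rewrite -size_pair_list ler_nat /Farey_card -(size_map farey_rat).
have inP x y : (x, y) \in pair_list (R0 * Q) (shell 0 R0%:R 0 R0%:R u (- eta) Q) ->
    [/\ (0 < x)%N, (0 < y)%N, coprime x y, x%:R / Q%:R <= vfun u (slope x y)
      /\ y%:R / Q%:R <= vfun u (slope x y) &
      vfun u (slope x y) < x%:R / Q%:R + y%:R / Q%:R].
  rewrite mem_pair_list => /and3P[/andP[x0 _] /andP[y0 _] /andP[cxy]].
  move=> /and5P[_]; rewrite le_min => /andP[_ r2] _; rewrite le_min => /andP[_ r4] r5.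
  by split=> //; first split; lra.
apply: uniq_leq_size.
  rewrite map_inj_in_uniq; first exact: uniq_pair_list.
  move=> [x y] [x' y'] /inP[x0 y0 cxy [xv yv] xyv] /inP[x'0 y'0 cx' [x'v y'v] xyv'].
  rewrite /farey_rat /= => E.
  have [p1 pp py] := snumP y0 cxy; have [_ cp] := bezout_coprime pp.
  have [p1' pp' py'] := snumP y'0 cx'; have [_ cp'] := bezout_coprime pp'.
  have yy : y = y'.
    have := congr1 (@denq) E; rewrite !coprimeq_den// !eqz_nat (gtn_eqF y0) (gtn_eqF y'0).
    by move=> [].
  subst y'; have ss : snum x y = snum x' y.
    move: E => /(congr1 (fun r => r * y%:Q)); rewrite !divfK ?intr_eq0 ?eqz_nat ?gtn_eqF//.
    by move=> /eqP; rewrite eqr_int eqz_nat => /eqP.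
  congr pair; have sl : slope x y = slope x' y :> R by rewrite /slope ss.
  rewrite -sl in x'v xyv'.
  have /eqP xx := snum_inj_mod y0 cxy cx' ss.
  have H (m n : nat) : (m == n %[mod y])%N -> (n <= m)%N ->
      m%:R / Q%:R <= vfun u (slope x y) -> vfun u (slope x y) < n%:R / Q%:R + y%:R / Q%:R -> m = n.
    move=> mn nm k1 k2; have := le_lt_trans k1 k2.
    rewrite -mulrDl -natrD ltr_pM2r ?invr_gt0// ltr_nat => mny.
    move: mn; rewrite eqn_mod_dvd// => /dvdn_leq h.
    apply/eqP; rewrite eqn_leq nm andbT -subn_eq0; apply/contraT; rewrite -lt0n => /h.
    by rewrite leqNgt ltn_subLR// mny.
  case: (leqP x' x) => [|/ltnW] le; first exact: (H _ _ xx le xv xyv').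
  by symmetry; apply: (H _ _ _ le x'v xyv); rewrite eq_sym.
move=> r /mapP[[x y] /inP[x0 y0 cxy [_ yv] _] ->].
have [p1 pp py] := snumP y0 cxy; have [_ cp] := bezout_coprime pp.
rewrite in_fset_set; last exact: finite_Farey.
rewrite inE; apply/FareyP; exists (snum x y), y; split=> //.
by rewrite mulrC -ler_pdivrMr.
Qed.

End mark_count.

(** * Convergence on boxes *)

Section box_limit.
Context {R : realType}.
Variable u : unit_function R.

Let v2_integrable :
  (@lebesgue_measure R).-integrable `[0, 1] (EFin \o (fun s => vfun u s ^+ 2)).
Proof.
apply: continuous_compact_integrable; first exact: segment_compact.
move=> x; apply: (@continuous_comp (subspace `[0 : R, 1]) R R (vfun u) (fun y => y ^+ 2)).
  exact: vfun_continuous.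
exact: exprn_continuous.
Qed.

Let phi_integrable a b c d : 0 <= a -> 0 <= b -> 0 <= c -> 0 <= d ->
  (@lebesgue_measure R).-integrable `[0, 1] (EFin \o phi a b c d u).
Proof.
move=> a0 b0 c0 d0.
apply: continuous_compact_integrable; first exact: segment_compact.
exact: phi_continuous.
Qed.

Let Cconst_gt0 : 0 < Cconst u.
Proof.
have [c c01 hc] := EVT_min ler01 (@vfun_continuous R u).
have v0 : 0 < vfun u c by exact: vfun_gt0.
have mu01 : (@lebesgue_measure R) `[0, 1] = 1%E.
  by rewrite lebesgue_measure_itv/= lte_fin ltr01 sube0.
apply: (@lt_le_trans _ _ (\int[@lebesgue_measure R]_(s in `[0, 1]) (vfun u c ^+ 2))).
  by rewrite Rintegral_cst//= [X in fine X]mu01 mulr1 exprn_gt0.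
apply: le_Rintegral => //.
  apply: continuous_compact_integrable; first exact: segment_compact.
  by apply: continuous_subspaceT => x; exact: cvg_cst.
move=> s s01; rewrite ler_sqr ?nnegrE ?(ltW v0) ?hc//.
by rewrite ltW// vfun_gt0.
Qed.

(** A box that contains all the [Omega w] has slices of area [w ^ 2 / 2]. *)
Let volume_full (R0 : nat) : (forall s, s \in `[0, 1] -> vfun u s <= R0%:R) ->
  volume 0 R0%:R 0 R0%:R u = Cconst u / 2.
Proof.
move=> vR0; rewrite /volume /Cconst mulrC -RintegralZl//.
apply: eq_Rintegral => s; rewrite inE => s01.
have v0 := vfun_gt0 u s01; have vs := vR0 s s01.
rewrite /phi /slice; have -> : Num.min R0%:R (vfun u s) = vfun u s by exact/min_idPr.
rewrite /area (_ : regionS _ _ _ _ _ = Omega (vfun u s)).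
  by rewrite leb2_Omega//= mulrC.
apply/seteqP; split => -[X Y]; rewrite /regionS /region /Omega /=.
  by move=> /and5P[-> -> -> -> ->].
by move=> [-> -> -> -> ->].
Qed.

Definition box (a b c d : R) : set (plane R) := `]a, b] `*` `]c, d].

Let Plim_box a b c d : 0 <= a -> 0 <= b -> 0 <= c -> 0 <= d ->
  Plim u (box a b c d) = (2 / Cconst u * volume a b c d u)%:E.
Proof.
move=> a0 b0 c0 d0; have C0 := Cconst_gt0.
transitivity (\int[@lebesgue_measure R]_(s in `[0%R, 1%R])
    ((2 / Cconst u)%:E * (phi a b c d u s)%:E))%E; last first.
  rewrite integralZl//; last exact: phi_integrable.
  rewrite [RHS]EFinM /volume /Rintegral fineK//.
  by apply: integrable_fin_num => //; exact: phi_integrable.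
rewrite /Plim; apply: eq_integral => s; rewrite inE /= => s01; have v0 := vfun_gt0 u s01.
rewrite /Pslice /box setI_Omega// areaE leb2_Omega//= /mdens /phi /slice -!EFinM.
by congr EFin; field; rewrite !gt_eqF.
Qed.

Let PQ_box a b c d Q : PQ u Q (box a b c d) =
  ((Farey_card u Q)%:R^-1 * (mark_count u a b c d Q)%:R)%:E.
Proof.
rewrite /PQ /mark_count EFinM; congr (_ * _)%E.
under eq_bigr do rewrite diracE; rewrite sumEFin; congr EFin.
by rewrite -sum1_count natr_sum [RHS]big_mkcond; apply: eq_bigr => t _; case: (_ \in _).
Qed.

Let squeeze_cvg (f : nat -> R) (l : R) :
  (forall e, 0 < e -> \forall Q \near \oo, f Q <= (l + e) * Q%:R ^+ 2) ->
  (forall e, 0 < e -> \forall Q \near \oo, (l - e) * Q%:R ^+ 2 <= f Q) ->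
  (fun Q => f Q / Q%:R ^+ 2) @ \oo --> l.
Proof.
move=> up lo; apply/cvgrPdist_le => e e0; near=> Q.
have Q0 : 0 < Q%:R ^+ 2 :> R by rewrite exprn_gt0// ltr0n; near: Q; exact: nbhs_infty_gt.
rewrite distrC ler_distl ler_pdivlMr// ler_pdivrMr//.
by apply/andP; split; near: Q; [exact: lo|exact: up].
Unshelve. all: by end_near. Qed.

(** The marks in the box number about [kappa * volume * Q ^ 2] and the Farey set
    about [kappa * Cconst u / 2 * Q ^ 2], with the same density [kappa] of coprime
    pairs, which cancels in the quotient. *)
Lemma box_limit a b c d : 0 < a -> 0 < c -> a <= b -> c <= d ->
  (fun Q => fine (PQ u Q (box a b c d))) @ \oo --> fine (Plim u (box a b c d)).
Proof.
move=> a0 c0 ab cd.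
have b0 : 0 < b by exact: lt_le_trans ab.
have d0 : 0 < d by exact: lt_le_trans cd.
have [R1 vR1] := vfun_bounded u.
pose R0 := (maxn R1 (maxn (Num.truncn b).+1 (Num.truncn d).+1)).
have vR0 s : s \in `[0, 1] -> vfun u s <= R0%:R.
  by move=> /vR1 h; rewrite (le_trans h)// ler_nat leq_maxl.
have bR : b <= R0%:R.
  by apply/ltW/(lt_le_trans (truncnS_gt _)); rewrite ler_nat !leq_max leqnn orbT.
have dR : d <= R0%:R.
  by apply/ltW/(lt_le_trans (truncnS_gt _)); rewrite ler_nat !leq_max leqnn !orbT.
have aR : a <= R0%:R by exact: le_trans bR.
have cR : c <= R0%:R by exact: le_trans dR.
have R00 : 0 <= R0%:R :> R by [].
pose kappa : R := coprime_const.
have k0 : 0 < kappa by exact: coprime_const_gt0.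
have C0 := Cconst_gt0.
have lim_mark : (fun Q => (mark_count u a b c d Q)%:R / Q%:R ^+ 2) @ \oo -->
    kappa * volume a b c d u.
  apply: squeeze_cvg => e e0.
    have [eta eta0] := @shell_count_upper R R0 a b c d (ltW a0) (ltW b0) (ltW c0) (ltW d0)
      aR bR cR dR u e e0.
    apply: filterS2 (@mark_count_upper R R0 u vR0 a b c d bR dR eta a0 c0 eta0) => Q.
    exact: le_trans.
  have [eta eta0] := @shell_count_lower R R0 a b c d (ltW a0) (ltW b0) (ltW c0) (ltW d0)
    aR bR cR dR u e e0.
  apply: filterS2 (@mark_count_lower R R0 u vR0 a b c d eta a0 c0 eta0) => Q h1 h2.
  exact: le_trans h2 h1.
have lim_card : (fun Q => (Farey_card u Q)%:R / Q%:R ^+ 2) @ \oo --> kappa * (Cconst u / 2).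
  have Qpos : \forall Q \near \oo, (0 < Q)%N by exact: nbhs_infty_gt.
  rewrite -(volume_full vR0); apply: squeeze_cvg => e e0.
    have [eta eta0] := @shell_count_upper R R0 0 R0%:R 0 R0%:R (lexx _) R00 (lexx _) R00
      R00 (lexx _) R00 (lexx _) u e e0.
    apply: filterS2 Qpos => Q Q0; apply: le_trans.
    exact: Farey_card_upper.
  have [eta eta0] := @shell_count_lower R R0 0 R0%:R 0 R0%:R (lexx _) R00 (lexx _) R00
    R00 (lexx _) R00 (lexx _) u e e0.
  apply: filterS2 Qpos => Q Q0 h; apply: (le_trans h).
  exact: Farey_card_lower.
rewrite Plim_box ?ltW//=.
have -> : 2 / Cconst u * volume a b c d u =
    (kappa * (Cconst u / 2))^-1 * (kappa * volume a b c d u).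
  by field; rewrite !gt_eqF.
have n0 : kappa * (Cconst u / 2) != 0 by rewrite gt_eqF// mulr_gt0// divr_gt0.
apply: cvg_trans (cvgM (cvgV n0 lim_card) lim_mark); apply: near_eq_cvg; near=> Q.
have Q0 : Q%:R ^+ 2 != 0 :> R.
  by rewrite expf_neq0// pnatr_eq0 -lt0n; near: Q; exact: nbhs_infty_gt.
by rewrite PQ_box /= invf_div mulrC mulrA divfK// mulrC.
Unshelve. all: by end_near. Qed.

Lemma PQ_box_lty a b c d Q : (PQ u Q (box a b c d) < +oo)%E.
Proof. by rewrite PQ_box ltry. Qed.

Lemma Plim_box_lty a b c d : 0 <= a -> 0 <= b -> 0 <= c -> 0 <= d ->
  (Plim u (box a b c d) < +oo)%E.
Proof. by move=> a0 b0 c0 d0; rewrite Plim_box// ltry. Qed.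

End box_limit.

(** * Approximation by step functions on a grid of boxes *)

Section box_grid.
Context {R : realType}.
Variables (a b c d : R).
Hypotheses (ab : a < b) (cd : c < d).

Definition grid_point (x y : R) (n i : nat) : R := x + (y - x) * (i%:R / n%:R).

Let grid_point_lt (x y : R) n i j : x < y -> (0 < n)%N ->
  (grid_point x y n i < grid_point x y n j) = (i < j)%N.
Proof.
move=> xy n0; rewrite /grid_point ltrD2l ltr_pM2l ?subr_gt0//.
by rewrite ltr_pM2r ?invr_gt0 ?ltr0n// ltr_nat.
Qed.

Let grid_point0 (x y : R) n : grid_point x y n 0 = x.
Proof. by rewrite /grid_point mul0r mulr0 addr0. Qed.

Let grid_pointn (x y : R) n : (0 < n)%N -> grid_point x y n n = y.
Proof. by move=> n0; rewrite /grid_point divff ?pnatr_eq0 -?lt0n// mulr1 addrC subrK. Qed.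

Let grid_point_exists (x y : R) n t : x < y -> (0 < n)%N -> x < t <= y ->
  exists2 i, (i < n)%N & grid_point x y n i < t <= grid_point x y n i.+1.
Proof.
move=> xy n0 /andP[xt ty].
have ex : exists k, t <= grid_point x y n k by exists n; rewrite grid_pointn.
case: (ex_minnP ex) => -[|k] hk hmin; first by move: hk; rewrite grid_point0 leNgt xt.
exists k; first by apply: hmin; rewrite grid_pointn.
rewrite hk andbT ltNge; apply/negP => /hmin.
by rewrite ltnn.
Qed.

Let grid_point_uniq (x y : R) n t i j : x < y -> (0 < n)%N ->
  grid_point x y n i < t <= grid_point x y n i.+1 ->
  grid_point x y n j < t <= grid_point x y n j.+1 -> i = j.
Proof.
move=> xy n0 /andP[h1 h2] /andP[h3 h4]; apply/eqP; rewrite eqn_leq -(ltnS i) -(ltnS j).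
by rewrite -!(grid_point_lt _ _ xy n0) (lt_le_trans h1 h4) (lt_le_trans h3 h2).
Qed.

Definition grid_cell (n : nat) (z : nat * nat) : set (plane R) :=
  box (grid_point a b n z.1) (grid_point a b n z.1.+1)
      (grid_point c d n z.2) (grid_point c d n z.2.+1).

Definition grid_corner (n : nat) (z : nat * nat) : R * R :=
  (grid_point a b n z.1.+1, grid_point c d n z.2.+1).

Definition grid_index (n : nat) : seq (nat * nat) :=
  [seq (i, j) | i <- iota 0 n, j <- iota 0 n].

Let grid_cellE n z (X Y : R) : grid_cell n z (X, Y) <->
  (grid_point a b n z.1 < X <= grid_point a b n z.1.+1) /\
  (grid_point c d n z.2 < Y <= grid_point c d n z.2.+1).
Proof. by rewrite /grid_cell /box /= !in_itv. Qed.

Lemma uniq_grid_index n : uniq (grid_index n).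
Proof. by apply: allpairs_uniq; rewrite ?iota_uniq// => -[? ?] [? ?] _ _ [-> ->]. Qed.

Lemma trivIset_grid_cell n (A : set (nat * nat)) : (0 < n)%N -> trivIset A (grid_cell n).
Proof.
move=> n0 [i j] [i' j'] _ _ [[X Y] [/grid_cellE[/= h1 h2] /grid_cellE[/= h3 h4]]].
by congr pair; [exact: grid_point_uniq h1 h3|exact: grid_point_uniq h2 h4].
Qed.

Lemma measurable_grid_cell n z : measurable (grid_cell n z).
Proof. exact: measurable_rect. Qed.

Let grid_point_itv (x y : R) n i : x < y -> (i <= n)%N -> (0 < n)%N ->
  x <= grid_point x y n i <= y.
Proof.
move=> xy ilen n0; apply/andP; split.
  by rewrite -[leLHS](grid_point0 x y n) leNgt grid_point_lt.
by rewrite -[leRHS](grid_pointn x y n0) leNgt grid_point_lt// -leqNgt.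
Qed.

Lemma mem_grid_index n z : z \in grid_index n -> (z.1 < n)%N && (z.2 < n)%N.
Proof.
move=> /allpairsP[[i j] [/= hi hj ->]]; move: hi hj.
by rewrite !mem_iota !add0n /= => -> ->.
Qed.

Lemma grid_cover n : (0 < n)%N ->
  \big[setU/set0]_(z <- grid_index n) grid_cell n z = box a b c d.
Proof.
move=> n0; rewrite -bigcup_seq; apply/seteqP; split => -[X Y].
  move=> [z /= /mem_grid_index /andP[z1 z2] /grid_cellE[/andP[h1 h2] /andP[h3 h4]]].
  have /andP[p1 _] := grid_point_itv ab (ltnW z1) n0.
  have /andP[_ p2] := grid_point_itv ab z1 n0.
  have /andP[p3 _] := grid_point_itv cd (ltnW z2) n0.
  have /andP[_ p4] := grid_point_itv cd z2 n0.
  rewrite /box /= !in_itv /= (le_lt_trans p1 h1) (le_trans h2 p2).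
  by rewrite (le_lt_trans p3 h3) (le_trans h4 p4).
rewrite /box /= !in_itv /= => -[hX hY].
have [i iN hi] := grid_point_exists ab n0 hX; have [j jN hj] := grid_point_exists cd n0 hY.
exists (i, j); last exact/grid_cellE.
by apply/allpairsP; exists (i, j); split=> //; rewrite mem_iota.
Qed.

Variable f : R * R -> R.
Hypothesis f_cont : {within `[a, b] `*` `[c, d], continuous f}.

Lemma grid_approx e : 0 < e -> exists2 n, (0 < n)%N & forall z x,
  z \in grid_index n -> grid_cell n z x -> `|f x - f (grid_corner n z)| <= e.
Proof.
move=> e0; have cK : compact (`[a, b] `*` `[c, d] : set (R * R)).
  by apply: compact_setX; exact: segment_compact.
have [dl dl0 hdl] := compact_unif_continuous cK f_cont e0.
pose n := (Num.truncn (((b - a) + (d - c)) / dl)).+1.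
have nR : 0 < n%:R :> R by rewrite ltr0n.
have hn : ((b - a) + (d - c)) / n%:R < dl.
  by rewrite ltr_pdivrMr// mulrC -ltr_pdivrMr// truncnS_gt.
have step (x y : R) i t : x < y -> (y - x) / n%:R < dl ->
    grid_point x y n i < t -> t <= grid_point x y n i.+1 ->
    ball t dl (grid_point x y n i.+1).
  move=> xy small h1 h2; rewrite /ball /= ler0_norm ?subr_le0// opprB.
  apply: le_lt_trans small; rewrite lerBlDr -lerBlDl.
  apply: le_trans (ltW h1); rewrite /grid_point -natr1.
  by rewrite [(_ + 1) / _]mulrDl mulrDr mul1r addrA addrK.
exists n => // -[i j] [X Y] /mem_grid_index /andP[/= iN jN].
move=> /grid_cellE[/= /andP[h1 h2] /andP[h3 h4]].
have n0 : (0 < n)%N by [].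
have /andP[p1 _] := grid_point_itv ab (ltnW iN) n0.
have /andP[p1' p2] := grid_point_itv ab iN n0.
have /andP[p3 _] := grid_point_itv cd (ltnW jN) n0.
have /andP[p3' p4] := grid_point_itv cd jN n0.
apply: hdl.
- split; rewrite /= in_itv /=; first by rewrite (le_trans p1 (ltW h1)) (le_trans h2 p2).
  by rewrite (le_trans p3 (ltW h3)) (le_trans h4 p4).
- by split; rewrite /= in_itv /= ?p1' ?p2 ?p3' ?p4.
have ba0 : 0 <= b - a by rewrite subr_ge0 ltW.
have dc0 : 0 <= d - c by rewrite subr_ge0 ltW.
split; apply: step => //; apply: le_lt_trans hn; rewrite ler_pM2r ?invr_gt0//.
  by rewrite lerDl.
by rewrite lerDr.
Qed.

(** A function that is only continuous on the closed rectangle is a pointwise limit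
    of step functions on half-open boxes, which avoids a choice of topology on the
    measurable plane. *)
Lemma measurable_box_continuous : measurable_fun (box a b c d) f.
Proof.
have /choice[n hn] : forall m : nat, exists n, (0 < n)%N /\ forall z x,
    z \in grid_index n -> grid_cell n z x -> `|f x - f (grid_corner n z)| <= m.+1%:R^-1.
  move=> m; have [|n n0 h] := @grid_approx (m.+1%:R^-1); first by rewrite invr_gt0.
  by exists n.
pose h m (x : plane R) : R := \sum_(z <- grid_index (n m))
  f (grid_corner (n m) z) * \1_(grid_cell (n m) z) x.
apply: (@measurable_fun_cvg _ _ _ _ h).
  move=> m; apply: measurable_sum => z; apply: measurable_funM.
    exact: measurable_cst.
  by apply: measurable_indic; exact: measurable_grid_cell.
move=> x Dx; apply/cvgrPdist_le => e e0; near=> m.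
have [n0 hm] := hn m.
have : (\big[setU/set0]_(z <- grid_index (n m)) grid_cell (n m) z) x by rewrite grid_cover.
rewrite -bigcup_seq => -[z /= zi zx].
have -> : h m x = f (grid_corner (n m) z).
  rewrite /h (bigD1_seq z) ?uniq_grid_index//= indicE mem_set// mulr1.
  rewrite big1 ?addr0// => z' zz'; rewrite indicE memNset ?mulr0// => zx'.
  have := @trivIset_grid_cell (n m) setT n0 z z' I I.
  move=> /(_ (ex_intro _ x (conj zx zx'))) E; by rewrite E eqxx in zz'.
apply: (le_trans (hm z x zi zx)).
by apply/ltW; near: m; exact: (near_infty_natSinv_lt (PosNum e0)).
Unshelve. all: by end_near. Qed.

End box_grid.

(** * Weak convergence *)

(** Each point [z] has a neighbourhood on which both coordinates lie between [d]
    and [1 / d] for all small [d]; compactness makes [d] uniform. *)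
Lemma compact_in_box (R : realType) (K : set (R * R)) : compact K -> K `<=` @pquadrant R ->
  exists a b : R, [/\ 0 < a, a < b & K `<=` `]a, b] `*` `]a, b]].
Proof.
move=> /compact_near_coveringP cK Kq.
have := cK R (0^'+) (fun d z => [/\ d < z.1, z.1 <= d^-1, d < z.2 & z.2 <= d^-1]).
move=> /(_ _) [].
  move=> [x y] Kxy; have [/= x0 y0] := Kq _ Kxy.
  pose r := Num.min x y / 2; pose U := x + y + r.
  have r0 : 0 < r by rewrite divr_gt0// lt_min x0.
  have U0 : 0 < U by rewrite !addr_gt0.
  have rx : 2 * r <= x by rewrite mulrC divfK// ge_min lexx.
  have ry : 2 * r <= y by rewrite mulrC divfK// ge_min lexx orbT.
  exists (ball (x, y) r, [set d | 0 < d < Num.min r U^-1]).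
    split; first exact: nbhsx_ballx.
    exists (Num.min r U^-1) => /=; first by rewrite lt_min r0 invr_gt0.
    by move=> d /=; rewrite sub0r normrN => /ltr_normlW h ->.
  move=> [[x' y'] d] [/= [b1 b2] /andP[d0]]; rewrite lt_min => /andP[dr dU].
  have dU' : U <= d^-1 by rewrite -[U]invrK lef_pV2 ?posrE ?invr_gt0// ltW.
  move: b1 b2; rewrite /ball /= !ltr_norml => /andP[k1 k2] /andP[k3 k4].
  by rewrite /U in dU'; split; lra.
move=> r /= r0 hr; pose d := Num.min (r / 2) (1 / 2).
have d0 : 0 < d by rewrite lt_min !divr_gt0.
have d1 : d < 1 by rewrite gt_min; apply/orP; right; lra.
exists d, d^-1; split=> //.
  by rewrite (lt_trans d1)// invf_gt1.
have dr : d < r by rewrite gt_min; apply/orP; left; lra.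
move=> [x y] Kxy.
have [||/= h1 h2 h3 h4] := hr d _ _ (x, y) Kxy.
- by rewrite /= sub0r normrN gtr0_norm.
- by [].
by split; rewrite /= in_itv /= ?h1 ?h3.
Qed.

Lemma dist_thirds (R : realType) (i j s t e : R) : `|i - s| <= e / 3 ->
  `|j - t| <= e / 3 -> `|s - t| <= e / 3 -> `|i - j| <= e.
Proof.
rewrite !ler_norml => /andP[p1 p2] /andP[q1 q2] /andP[r1 r2].
by apply/andP; split; lra.
Qed.

Theorem theorem3p5 (R : realType) (u : unit_function R) (f : R * R -> R)
    (f_cont : {within pquadrant, continuous f})
    (f_supp : exists K : set (R * R), [/\ compact K, K `<=` pquadrant &
                forall z, pquadrant z -> ~ K z -> f z = 0]) :
  (fun Q : nat => \int[PQ u Q]_(z in pquadrant) (f z)%:E)%E @ \oo -->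
  (\int[Plim u]_(z in pquadrant) (f z)%:E)%E.
Proof.
have [K [cK Kq f0]] := f_supp.
have [a [b [a0 ab KD]]] := compact_in_box cK Kq.
have a0' : 0 <= a by exact: ltW.
have b0 : 0 <= b by rewrite (le_trans a0')// ltW.
pose D := box a b a b.
have Dq : D `<=` @pquadrant R.
  by move=> [x y]; rewrite /D /box /= !in_itv /= => -[/andP[h1 _] /andP[h2 _]];
    split=> /=; exact: lt_trans a0 _.
(* only the box D matters, as f vanishes on the rest of the quadrant *)
have to_D (mu : {measure set (plane R) -> \bar R}) :
    (\int[mu]_(z in pquadrant) (f z)%:E = \int[mu]_(z in D) (f z)%:E)%E.
  rewrite -[in RHS](setIidr Dq) [RHS]integral_mkcondr; apply: eq_integral => z.
  rewrite inE => qz; rewrite patchE; case: ifPn => // zD.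
  by rewrite f0// => /KD Dz; move: zD; rewrite notin_setE; apply.
have f_cont' : {within `[a, b] `*` `[a, b], continuous f}.
  apply: continuous_subspaceW f_cont => -[x y] /=; rewrite !in_itv /=.
  by move=> [/andP[h1 _] /andP[h2 _]]; split=> /=; exact: lt_le_trans a0 _.
have mf : measurable_fun D f by exact: measurable_box_continuous.
have cell_sub n z : (0 < n)%N -> z \in grid_index n -> grid_cell a b a b n z `<=` D.
  move=> n0 zi; rewrite /D -(grid_cover ab ab n0) -bigcup_seq => x zx.
  by exists z.
pose I (mu : {measure set (plane R) -> \bar R}) := (\int[mu]_(z in D) (f z)%:E)%E.
pose S (mu : {measure set (plane R) -> \bar R}) n :=
  \sum_(z <- grid_index n) f (grid_corner a b a b n z) * fine (mu (grid_cell a b a b n z)).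
have approx (mu : {measure set (plane R) -> \bar R}) n e : (0 < n)%N -> 0 <= e ->
    (forall z, (mu (grid_cell a b a b n z) < +oo)%E) ->
    (forall z x, z \in grid_index n -> grid_cell a b a b n z x ->
      `|f x - f (grid_corner a b a b n z)| <= e) ->
    I mu \is a fin_num /\ `|fine (I mu) - S mu n| <= e * fine (mu D).
  move=> n0 e0 fin h.
  have mD : mu D = (\sum_(z <- grid_index n) fine (mu (grid_cell a b a b n z)))%:E.
    rewrite /D -(grid_cover ab ab n0) -bigcup_seq measure_fin_bigcup.
    - rewrite -fsbig_seq ?uniq_grid_index//= -sumEFin; apply: eq_bigr => z _.
      by rewrite fineK// ge0_fin_numE.
    - exact: finite_seq.
    - exact: (trivIset_grid_cell ab ab).
    - by move=> z _; exact: measurable_grid_cell.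
  rewrite mD /=.
  have := @step_integral R _ (plane R) mu _ (grid_index n) (grid_cell a b a b n)
    (fun z => f (grid_corner a b a b n z)) f e (@uniq_grid_index n)
    (@trivIset_grid_cell R a b a b ab ab n _ n0) (@measurable_grid_cell R a b a b n) fin e0.
  rewrite (grid_cover ab ab n0); apply => //.
  by move=> z zi; apply: measurable_funS mf; [exact: measurable_rect|exact: cell_sub].
have gp (n i : nat) : 0 < grid_point a b n i <= grid_point a b n i.+1.
  have ba : 0 <= b - a by rewrite subr_ge0 ltW.
  rewrite ltr_wpDr ?mulr_ge0 ?divr_ge0//= lerD2l ler_wpM2l//.
  by rewrite ler_wpM2r ?invr_ge0// ler_nat.
have cell_lim n z : (fun Q => fine (PQ u Q (grid_cell a b a b n z))) @ \oo -->
    fine (Plim u (grid_cell a b a b n z)).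
  have /andP[g1 g2] := gp n z.1; have /andP[g3 g4] := gp n z.2.
  exact: box_limit.
have fin_PQ Q n z : (PQ u Q (grid_cell a b a b n z) < +oo)%E by exact: PQ_box_lty.
have fin_P n z : (Plim u (grid_cell a b a b n z) < +oo)%E.
  have /andP[g1 g2] := gp n z.1; have /andP[g3 g4] := gp n z.2.
  by apply: Plim_box_lty; rewrite ?(ltW g1) ?(ltW g3) ?(le_trans (ltW g1) g2)
    ?(le_trans (ltW g3) g4).
have S_lim n : (fun Q => S (PQ u Q) n) @ \oo --> S (Plim u) n.
  rewrite /S; elim: (grid_index n) => [|z s IH].
    by under eq_fun do rewrite big_nil; rewrite big_nil; exact: cvg_cst.
  under eq_fun do rewrite big_cons; rewrite big_cons.
  by apply: cvgD => //; apply: cvgMr; exact: cell_lim.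
pose T0 := fine (Plim u D).
have T00 : 0 <= T0 by exact: fine_ge0.
have T_lim : (fun Q => fine (PQ u Q D)) @ \oo --> T0 by apply: box_limit => //; exact: ltW.
have fin_I Q : I (PQ u Q) \is a fin_num.
  have [n n0 h] := grid_approx ab ab f_cont' ltr01.
  by have [] := approx (PQ u Q) n 1 n0 ler01 (fin_PQ Q n) h.
have fin_IP : I (Plim u) \is a fin_num.
  have [n n0 h] := grid_approx ab ab f_cont' ltr01.
  by have [] := approx (Plim u) n 1 n0 ler01 (fin_P n) h.
rewrite to_D; under eq_fun do rewrite to_D.
rewrite -/(I (Plim u)) -(fineK fin_IP); apply: cvg_EFin; first by near=> Q; exact: fin_I.
apply/cvgrPdist_le => e e0.
pose e1 := e / (3 * (T0 + 1)).
have e10 : 0 < e1 by rewrite divr_gt0// mulr_gt0// ltr_wpDl.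
have e1T : e1 * (T0 + 1) = e / 3.
  by rewrite /e1; field; rewrite gt_eqF// ltr_wpDl.
have e3 : 0 < e / 3 by rewrite divr_gt0.
have [n n0 h] := grid_approx ab ab f_cont' e10.
have [_ hP] := approx (Plim u) n e1 n0 (ltW e10) (fin_P n) h.
near=> Q.
have [_ hQ] := approx (PQ u Q) n e1 n0 (ltW e10) (fin_PQ Q n) h.
have hS : `|S (Plim u) n - S (PQ u Q) n| <= e / 3.
  by near: Q; move/cvgrPdist_le : (S_lim n); apply.
have hT : `|T0 - fine (PQ u Q D)| <= 1.
  by near: Q; move/cvgrPdist_le : T_lim; apply.
have hT' : e1 * fine (PQ u Q D) <= e / 3.
  rewrite -e1T ler_wpM2l ?(ltW e10)//.
  by move: hT; rewrite ler_distl => /andP[hT _]; lra.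
have hP' : e1 * T0 <= e / 3 by rewrite -e1T ler_wpM2l ?(ltW e10)// lerDl.
exact: dist_thirds (le_trans hP hP') (le_trans hQ hT') hS.
Unshelve. all: by end_near. Qed.
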